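(* Under the standing setup below, let $W>1$ and let $s\ge0$ be an integer. For $x\in B(R)$ let $F_x\in C^s(\overline{B(W)})$ be $F_x(y)=f_N(x+y)=(2N)^{-1/2}\sum_{1\le|n|\le N}a_ne(\langle r_n,x\rangle)e(\langle r_n,y\rangle)$. Regard $x\mapsto F_x$ as a random element of $C^s(\overline{B(W)})$ with $x$ distributed according to $\operatorname{vol}_R$, and $F_\mu|_{\overline{B(W)}}$ as a random element of the same space. Then $$\lim_{N\to\infty}\ \limsup_{R\to\infty}\ d_P(F_x,F_\mu)=0,$$ where $d_P$ is the Lévy–Prokhorov distance between the laws of $F_x$ and $F_\mu$ on $C^s(\overline{B(W)})$.
   Context: Standing setup: Fix $m\ge 2$, $e(t)=e^{2\pi it}$, $B(x,\rho)$ open ball, $B(\rho)=B(0,\rho)$. Let $\{r_n\}_{n\ge1}\subset\mathbb S^{m-1}$ be linearly independent over $\mathbb Q$ and not all contained in a hyperplane; $r_{-n}:=-r_n$. Let $a_n\in\mathbb C$ ($n\ne0$), $|a_n|=1$, $a_{-n}=\overline{a_n}$. $f_N(x)=(2N)^{-1/2}\sum_{1\le|n|\le N}a_n e(\langle r_n,x\rangle)$. $\mu_{r,N}=(2N)^{-1}\sum_{1\le|n|\le N}\delta_{r_n}$, assumed (after passing to a subsequence) to converge weak$^*$ to a probability measure $\mu$ on $\mathbb S^{m-1}$. $F_\mu$: centred stationary real Gaussian field on $\mathbb R^m$ with $\mathbb E[F_\mu(x)F_\mu(y)]=\int e(\langle x-y,\lambda\rangle)d\mu(\lambda)$. $\operatorname{vol}_R$: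 uniform probability measure on $B(R)$. Lévy–Prokhorov metric: for Borel probability measures $\mu_1,\mu_2$ on the normed space $S=C^s(\overline{B(W)})$ (norm $\|\cdot\|_{C^s}$), $d_P(\mu_1,\mu_2)=\inf\{\varepsilon>0:\mu_1(A)\le\mu_2(A_{+\varepsilon})+\varepsilon,\ \mu_2(A)\le\mu_1(A_{+\varepsilon})+\varepsilon\ \text{for all Borel }A\subset S\}$, where $A_{+\varepsilon}=\{p\in S:\exists q\in A,\ \|p-q\|_{C^s}<\varepsilon\}$. For random elements $F,F'$ of $S$, $d_P(F,F')$ is $d_P$ of their laws. *)

(* Defs.v *)
From HB Require Import structures.
From mathcomp Require Import all_boot all_order all_algebra.
From mathcomp Require Import all_classical all_reals all_analysis.
From mathcomp Require Import complex.
Set Implicit Arguments.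
Unset Strict Implicit.
Unset Printing Implicit Defensive.
Import Order.TTheory GRing.Theory Num.Theory.
Import numFieldNormedType.Exports.
Local Open Scope ring_scope.
Local Open Scope classical_set_scope.

Definition dotv (R : realType) (m : nat) (x y : 'rV[R]_m) : R :=
  \sum_(i < m) x ord0 i * y ord0 i.

Definition enorm (R : realType) (m : nat) (x : 'rV[R]_m) : R :=
  Num.sqrt (dotv x x).

Definition eball (R : realType) (m : nat) (c : 'rV[R]_m) (rho : R)
  : set 'rV[R]_m := [set y | enorm (y - c) < rho].
Definition ecball (R : realType) (m : nat) (c : 'rV[R]_m) (rho : R)
  : set 'rV[R]_m := [set y | enorm (y - c) <= rho].

Definition usphere (R : realType) (m : nat) : set 'rV[R]_m :=
  [set y | enorm y = 1].

Definition ee (R : realType) (t : R) : R[i] :=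
  (cos (2 * pi * t) +i* sin (2 * pi * t))%C.

(* f_N(x) = (2N)^{-1/2} sum_{1<=|n|<=N} a_n e(<r_n,x>);
   the sum over 1 <= |n| <= N is written as the sum over n = 1..N of the
   terms of index n and -n.  The sum is real (a_{-n} = conj a_n,
   r_{-n} = -r_n); f_N is its real part. *)
Definition fN (R : realType) (m : nat) (a : int -> R[i]) (r : int -> 'rV[R]_m)
  (N : nat) (x : 'rV[R]_m) : R :=
  complex.Re ((Num.sqrt (2 * N%:R) : R)^-1%:C *
    \sum_(1 <= n < N.+1)
       (a n%:Z * ee (dotv (r n%:Z) x) + a (- n%:Z) * ee (dotv (r (- n%:Z)) x)))%C.

Definition partial (R : realType) (m : nat) (i : 'I_m) (f : 'rV[R]_m -> R)
  : 'rV[R]_m -> R := fun y => 'D_('e_i) f y.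

Definition dalpha (R : realType) (m : nat) (al : 'I_m -> nat)
  (f : 'rV[R]_m -> R) : 'rV[R]_m -> R :=
  foldr (fun i g => iter (al i) (partial i) g) f (enum 'I_m).

Definition mi_order (m : nat) (al : 'I_m -> nat) : nat := \sum_(i < m) al i.

(* An element of C^s(closed ball B(W)) is represented by a function on R^m
   vanishing outside the closed ball, continuous on the closed ball, whose
   partial derivatives of order <= s exist on the open ball and are
   uniformly continuous there (hence extend continuously to the closed
   ball). *)
Definition CsB (R : realType) (m : nat) (s : nat) (W : R) (f : 'rV[R]_m -> R)
  : Prop :=
  [/\ (forall y, ~ ecball 0 W y -> f y = 0),
      {within ecball 0 W, continuous f},
      (forall (al : 'I_m -> nat) (i : 'I_m), (mi_order al < s)%N ->
         forall y, eball 0 W y -> derivable (dalpha al f) y 'e_i) &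
      (forall (al : 'I_m -> nat), (mi_order al <= s)%N ->
         forall e : R, 0 < e -> exists2 d : R, 0 < d &
           forall y z, eball 0 W y -> eball 0 W z -> enorm (y - z) < d ->
             `|dalpha al f y - dalpha al f z| < e)].

Definition Sset (R : realType) (m : nat) (s : nat) (W : R)
  : set ('rV[R]_m -> R) := [set f | CsB s W f].

Definition Csnorm (R : realType) (m : nat) (s : nat) (W : R)
  (f : 'rV[R]_m -> R) : R :=
  sup [set v : R | exists (al : 'I_m -> nat) (y : 'rV[R]_m),
          [/\ (mi_order al <= s)%N, eball 0 W y & v = `|dalpha al f y|]].

Definition Sopen (R : realType) (m : nat) (s : nat) (W : R)
  : set (set ('rV[R]_m -> R)) :=
  [set U | U `<=` Sset s W /\
     forall p, U p -> exists2 e : R, 0 < e &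
       forall q, Sset s W q -> Csnorm s W (fun y => q y - p y) < e -> U q].

Definition SBorel (R : realType) (m : nat) (s : nat) (W : R)
  : set (set ('rV[R]_m -> R)) :=
  <<s Sset s W, Sopen s W >>.

Definition Senl (R : realType) (m : nat) (s : nat) (W : R)
  (A : set ('rV[R]_m -> R)) (e : R) : set ('rV[R]_m -> R) :=
  [set p | Sset s W p /\ exists2 q, A q & Csnorm s W (fun y => p y - q y) < e].

Definition dP (R : realType) (m : nat) (s : nat) (W : R)
  (mu1 mu2 : set ('rV[R]_m -> R) -> \bar R) : R :=
  inf [set e : R | 0 < e /\
        forall A, SBorel s W A ->
          (mu1 A <= mu2 (Senl s W A e) + e%:E)%E /\
          (mu2 A <= mu1 (Senl s W A e) + e%:E)%E].

Definition restrB (R : realType) (m : nat) (W : R) (g : 'rV[R]_m -> R)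
  : 'rV[R]_m -> R :=
  fun y => if `[< ecball 0 W y >] then g y else 0.

(* Lebesgue measure on R^m (iterated one-dimensional Lebesgue           *)
(* integrals, Tonelli) and the uniform probability vol_R on B(R).      *)

Definition setcoord (R : realType) (m : nat) (y : 'rV[R]_m) (k : nat) (t : R)
  : 'rV[R]_m := \row_j (if (j : nat) == k then t else y ord0 j).

Fixpoint iint (R : realType) (m : nat) (k : nat) (g : 'rV[R]_m -> \bar R)
  (y : 'rV[R]_m) {struct k} : \bar R :=
  match k with
  | 0 => g y
  | k'.+1 => (\int[@lebesgue_measure R]_(t in setT) iint k' g (setcoord y k' t))%E
  end.

Definition lebm (R : realType) (m : nat) (E : set 'rV[R]_m) : \bar R :=
  iint m (fun y => (\1_E y)%:E) 0.

Definition volR (R : realType) (m : nat) (Rad : R) (A : set 'rV[R]_m) : \bar R :=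
  (lebm (A `&` eball 0 Rad) * ((fine (lebm (eball (0 : 'rV[R]_m) Rad)))^-1)%:E)%E.

Definition lawFx (R : realType) (m : nat) (W : R) (a : int -> R[i])
  (r : int -> 'rV[R]_m) (N : nat) (Rad : R) : set ('rV[R]_m -> R) -> \bar R :=
  fun A => volR Rad [set x | A (restrB W (fun y => fN a r N (x + y)))].

Definition lawF (R : realType) (m : nat) (W : R) d (T : measurableType d)
  (P : probability T R) (F : T -> 'rV[R]_m -> R)
  : set ('rV[R]_m -> R) -> \bar R :=
  fun A => P [set w | A (restrB W (F w))].

Definition borelRm (R : realType) (m : nat) : set (set 'rV[R]_m) :=
  [set A | open A].
Definition BorelRm (R : realType) (m : nat) := g_sigma_algebraType (@borelRm R m).

Definition covK (R : realType) (m : nat) (mu : probability (BorelRm R m) R)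
  (z : 'rV[R]_m) : R[i] :=
  (fine (\int[mu]_(l in setT) (cos (2 * pi * dotv z l))%:E)%E
   +i* fine (\int[mu]_(l in setT) (sin (2 * pi * dotv z l))%:E)%E)%C.

Definition gauss0 (R : realType) (sigma : R) : set R -> \bar R :=
  fun B => if sigma == 0 then \d_(0 : R) B else normal_prob 0 sigma B.

Definition centred_gaussian_field (R : realType) (m : nat) d
  (T : measurableType d) (P : probability T R) (F : T -> 'rV[R]_m -> R) : Prop :=
  (forall x, measurable_fun setT (fun w => F w x)) /\
  forall (k : nat) (xs : 'I_k -> 'rV[R]_m) (c : 'I_k -> R),
    exists2 sigma : R, 0 <= sigma &
      forall B : set R, measurable B ->
        P [set w | B (\sum_(i < k) c i * F w (xs i))] = gauss0 sigma B.

(* Main.v *)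
(* Idea.  The law of F_x is compared with that of F_mu through finitely many
   point evaluations.
   - By Q-independence all the phases <k, r> that are not constant average to 0
     over large balls, so Lindeberg's replacement of cos(X + u) by its
     second-order expansion, one frequency at a time, shows that the mean of
     cos(sum_j t_j F_x(y_j) + psi) over B(R) tends, as R and then N go to
     infinity, to exp(-V/2) cos psi, where V is the variance of
     sum_j t_j F_mu(y_j).
   - The derivatives of F_x of order at most s + 1 are bounded on B(W), outside
     a set of x of small measure and uniformly in N: a wave sum is controlled on
     the ball by a quadratic form in its amplitudes whose mean over x only keeps
     its diagonal.
   - On the resulting equicontinuous set K, closeness in C^s follows from
     closeness at a finite net of points (interpolation between derivatives),
     and Bernstein weights in the variables (1 + sin(p(y_j)/L))/2 are trigonometric
     polynomials of the point evaluations that localise p; comparing their means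
     under the two laws bounds the Levy-Prokhorov distance. *)
Require Import Defs.
From HB Require Import structures.
From mathcomp Require Import all_boot all_order all_algebra.
From mathcomp Require Import all_classical all_reals all_analysis.
From mathcomp Require Import complex.
From mathcomp Require Import measurable_realfun ring lra.
Import Order.TTheory GRing.Theory Num.Theory.
Import numFieldNormedType.Exports.
Local Open Scope ring_scope.
Local Open Scope classical_set_scope.
Set Implicit Arguments.
Unset Strict Implicit.
Unset Printing Implicit Defensive.

(** * Lebesgue measure on R^m *)

(** The order of the limits, R before N, dictates the order of the choices: the set K, the net and
    the weights are fixed before N, and only the threshold for R may depend on N. Every bound
    therefore separates an error controlled by N alone from oscillatory terms that vanish for fixed
    N. Q-independence says that a nonzero integer multiple of the n-th frequency never lies in the
    integer span of the earlier ones. The cosine of a sum of waves is not a trigonometric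
    polynomial, so it is first approximated uniformly by a polynomial in that sum. The free phase
    psi lets real cosines carry both the real and the imaginary part of a characteristic function.
    The Levy-Prokhorov bound must hold for all Borel sets at once. A finite partition of unity by
    trigonometric polynomials provides this: each Borel set merely selects a subfamily of the
    weights, so comparing all the weights once covers every set, and no compactness theorem for
    measures is called upon. Such weights are periodic in nature and localise only where sin(p/L) is
    injective, which is why p is first bounded by L on K. *)

Section borel.
Context (R : realType) (m : nat).
Local Notation V := 'rV[R]_m.
Local Notation BV := (BorelRm R m).

Lemma ball_rVP (x y : V) (e : R) : 0 < e ->
  (forall j, `|x ord0 j - y ord0 j| < e) -> ball x e y.
Proof.
by move=> e0 h; rewrite /ball/=; split => // i j; rewrite (ord1 i); exact: h.
Qed.

Lemma open_measurable_rV (U : set V) : open U -> measurable (U : set BV).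
Proof. by move=> oU; exact: sub_sigma_algebra. Qed.

Lemma continuous_measurable_rV (f : V -> R) :
  continuous f -> measurable_fun setT (f : BV -> R).
Proof.
move=> /continuousP cf; apply: (measurability _ (RGenOpens.measurableE R)).
move=> _ [_ [a [b ->] <-]]; rewrite setTI.
by apply: open_measurable_rV; apply: cf; exact: interval_open.
Qed.

(* Borel sets of R^m are generated by the coordinates: an open set is the
   countable union of the boxes with rational centre and radius 1/(n+1) that
   it contains. *)
Lemma measurable_fun_rV d (T : measurableType d) (f : T -> BV) :
  (forall j, measurable_fun setT (fun x => (f x : V) ord0 j)) ->
  measurable_fun setT f.
Proof.
move=> mf; apply: (@measurability _ _ _ BV setT f (@borelRm R m) (erefl _)).
move=> _ [U oU <-]; rewrite setTI.
pose box (p : 'rV[rat]_m * nat) : set V :=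
  [set y | forall j, `|ratr (p.1 ord0 j) - y ord0 j| < p.2.+1%:R^-1].
pose G (p : 'rV[rat]_m * nat) : set V := if `[< box p `<=` U >] then box p else set0.
have -> : U = \bigcup_p G p.
  apply/seteqP; split => [x Ux|x [p _]]; last first.
    by rewrite /G; case: asboolP => // + Bx; exact.
  have /nbhs_ballP[e /= e0 xeU] := open_nbhs_nbhs (conj oU Ux).
  have [n] : exists n, 0 + n.+1%:R^-1 < e / 2 by apply: ltr_add_invr; rewrite divr_gt0.
  rewrite add0r => ne.
  have q j : {q : rat | `|ratr q - x ord0 j| < n.+1%:R^-1}.
    apply: cid.
    have /rat_in_itvoo[q] : x ord0 j - n.+1%:R^-1 < x ord0 j + n.+1%:R^-1.
      by rewrite ltrD2l gtrN// invr_gt0.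
    by rewrite in_itv/= -ltr_distl; exists q.
  exists (\row_j (sval (q j)), n) => //.
  have h : box (\row_j sval (q j), n) `<=` U.
    move=> y yb; apply: xeU; apply: ball_rVP => // j.
    rewrite (le_lt_trans (ler_distD (ratr (sval (q j))) _ _))//.
    have := yb j; rewrite /= mxE => yj.
    have := svalP (q j); rewrite distrC => xj.
    by rewrite (splitr e) ltrD// (lt_trans _ ne).
  rewrite /G asboolT// => j; rewrite /= mxE; exact: svalP (q j).
rewrite preimage_bigcup; apply: countable_bigcupT_measurable => // p.
rewrite /G; case: asboolP => _; last by rewrite preimage_set0.
have -> : f @^-1` box p = \bigcap_(j in [set: 'I_m])
    ((fun x => `|ratr (p.1 ord0 j) - (f x : V) ord0 j|) @^-1` `]-oo, p.2.+1%:R^-1[).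
  by apply/seteqP; split => [x bx j _|x bx j]; have := bx j; rewrite /= in_itv/=; exact.
apply: fin_bigcap_measurable => [|j _]; first exact: finite_finset.
have mj : measurable_fun setT (fun x => `|ratr (p.1 ord0 j) - (f x : V) ord0 j|).
  by apply: measurableT_comp => //; exact: measurable_funB.
by rewrite -[X in measurable X]setTI; exact: mj.
Qed.

Lemma measurable_coord j : measurable_fun setT (fun x : BV => (x : V) ord0 j).
Proof. by apply: continuous_measurable_rV => x; exact: coord_continuous. Qed.

Lemma measurable_setcoord k :
  measurable_fun setT (fun p : BV * R => setcoord p.1 k p.2 : BV).
Proof.
apply: measurable_fun_rV => j; rewrite /setcoord.
under eq_fun do rewrite mxE.
case: eqP => _; first exact: measurable_snd.
exact: (measurableT_comp (measurable_coord j)).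
Qed.

Lemma iint_ge0 k (g : V -> \bar R) y :
  (forall z, 0 <= g z)%E -> (0 <= iint k g y)%E.
Proof. by move=> g0; elim: k y => //= k IH y; exact: integral_ge0. Qed.

Lemma measurable_iint k (g : BV -> \bar R) :
  measurable_fun setT g -> (forall z, 0 <= g z)%E ->
  measurable_fun setT (iint k g : BV -> \bar R).
Proof.
move=> mg g0; elim: k => //= k IH.
apply: (measurable_fun_fubini_tonelli_F (m2 := @lebesgue_measure R)
  (fun p : BV * measurableTypeR R => iint k g (setcoord p.1 k p.2))).
- exact: (measurableT_comp IH (measurable_setcoord k)).
- by move=> x; exact: iint_ge0.
Qed.

Lemma measurable_iint_slice k k' (g : BV -> \bar R) y :
  measurable_fun setT g -> (forall z, 0 <= g z)%E ->
  measurable_fun setT (fun t : measurableTypeR R => iint k g (setcoord y k' t)).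
Proof.
move=> mg g0; apply: (measurableT_comp (measurable_iint k mg g0)).
exact: (measurableT_comp (measurable_setcoord k') (pair1_measurable (y : BV))).
Qed.

Lemma iint_nneseries k (g : nat -> BV -> \bar R) y :
  (forall n, measurable_fun setT (g n)) -> (forall n z, 0 <= g n z)%E ->
  (iint k (fun z => \sum_(n <oo) g n z) y = \sum_(n <oo) iint k (g n) y)%E.
Proof.
move=> mg g0; elim: k y => //= k IH y.
under eq_integral do rewrite IH.
rewrite integral_nneseries// => [n|n x _]; first exact: measurable_iint_slice.
exact: iint_ge0.
Qed.

Lemma eq_iint k (g1 g2 : V -> \bar R) y : g1 =1 g2 -> iint k g1 y = iint k g2 y.
Proof. by move=> /funext ->. Qed.

Lemma iint0 k (y : V) : iint k (fun=> 0%E) y = 0%E.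
Proof. by elim: k y => //= k IH y; under eq_integral do rewrite IH; rewrite integral0. Qed.

(** [lebm] retyped over the Borel structure [BV], so that a measure structure can be attached to
    it. *)
Definition lebB : set BV -> \bar R := @lebm R m.

Let lebB0 : lebB set0 = 0%E.
Proof. by rewrite /lebB /lebm; under eq_fun do rewrite indic0; rewrite iint0. Qed.

Let lebB_ge0 A : (0 <= lebB A)%E.
Proof. by apply: iint_ge0 => z; rewrite lee_fin. Qed.

Let lebB_sigma_additive : semi_sigma_additive lebB.
Proof.
move=> A mA tA mUA.
have -> : lebB (\bigcup_n A n) = (\sum_(n <oo) lebB (A n))%E.
  rewrite /lebB /lebm -iint_nneseries.
  - by apply: eq_iint => z; exact: indic_bigcup.
  - by move=> n; apply/measurable_EFinP; exact: measurable_indic.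
  - by move=> n z; rewrite lee_fin.
exact: is_cvg_ereal_nneg_natsum_cond.
Qed.

HB.instance Definition _ := isMeasure.Build _ BV R lebB
  lebB0 lebB_ge0 lebB_sigma_additive.

End borel.

(** * Affine changes of variables *)

Section affine.
Context (R : realType).
Local Open Scope ereal_scope.

(** The image of c times Lebesgue measure under t -> c t + h has the right mass on half-open
    intervals, hence is Lebesgue measure by uniqueness. *)
Lemma ge0_integral_affine (c h : R) (g : R -> \bar R) : (0 < c)%R ->
  measurable_fun setT g -> (forall t, 0 <= g t) ->
  \int[lebesgue_measure]_t g t = c%:E * \int[lebesgue_measure]_t g (c * t + h)%R.
Proof.
move=> c0 mg g0.
pose f (t : measurableTypeR R) : measurableTypeR R := (c * t + h)%R.
have mf : measurable_fun setT f by exact: measurable_funD.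
pose mu' := mscale (NngNum (ltW c0)) (pushforward (@lebesgue_measure R) f).
pose mu : {measure set (measurableTypeR R) -> \bar R} := mu' mf.
have muE A : measurable A -> lebesgue_measure A = mu A.
  apply: lebesgue_measure_unique => _ [[a b] /= _ <-].
  have -> : mu `]a, b]%classic = c%:E * lebesgue_measure `]((a - h) / c)%R, ((b - h) / c)%R]%classic.
    rewrite /mu/= /mscale/= /pushforward; congr (_ * lebesgue_measure _).
    apply/seteqP; split => t /=; rewrite !in_itv/=;
      by rewrite ltr_pdivrMr// ler_pdivlMr// ltrBlDr lerBrDr mulrC.
  rewrite !lebesgue_measure_itv/= !lte_fin ltr_pM2r ?invr_gt0// ltrD2r.
  case: ifPn => _; last by rewrite mule0.
  by rewrite -!EFinD -EFinM; congr EFin; field; rewrite gt_eqF.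
rewrite (eq_measure_integral mu) => [|A mA _]; last exact: muE.
rewrite /mu ge0_integral_mscale//=.
by rewrite (ge0_integral_pushforward mf).
Qed.

End affine.

Section lebm_affine.
Context (R : realType) (m : nat).
Local Notation V := 'rV[R]_m.
Local Notation BV := (BorelRm R m).

Lemma setcoord_affine (c : R) (y h : V) k t (kj : 'I_m) : kj = k :> nat ->
  c *: setcoord y k t + h = setcoord (c *: y + h) k (c * t + h ord0 kj).
Proof.
move=> kk; apply/rowP => j; rewrite !mxE; case: eqP => // jk; congr (_ + h _ _).
by apply/val_inj; rewrite /= jk kk.
Qed.

Lemma measurable_affine (c : R) (h : V) :
  measurable_fun setT (fun x : BV => c *: (x : V) + h : BV).
Proof.
apply: measurable_fun_rV => j; under eq_fun do rewrite !mxE.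
apply: measurable_funD => //; apply: measurable_funM => //; exact: measurable_coord.
Qed.

Lemma iint_affine k (c : R) (g : BV -> \bar R) (y h : V) : (k <= m)%N -> 0 < c ->
  measurable_fun setT g -> (forall z, 0 <= g z)%E ->
  iint k g (c *: y + h) = ((c ^+ k)%:E * iint k (fun z => g (c *: z + h)%R) y)%E.
Proof.
move=> km c0 mg g0.
have mg' : measurable_fun setT (fun z : BV => g (c *: (z : V) + h)).
  exact: (measurableT_comp mg (measurable_affine c h)).
elim: k km y => [_ y|k IH km y] /=; first by rewrite mul1e.
rewrite (@ge0_integral_affine _ c (h ord0 (Ordinal km)))//; last 2 first.
- exact: measurable_iint_slice.
- by move=> t; exact: iint_ge0.
under eq_integral do rewrite -(@setcoord_affine c y h k _ (Ordinal km))// IH ?(ltnW km)//.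
rewrite ge0_integralZl//; last 3 first.
- by apply: measurable_iint_slice.
- by move=> t _; exact: iint_ge0.
- by rewrite lee_fin exprn_ge0// ltW.
by rewrite muleA -EFinM -exprS.
Qed.

(** The first k coordinates of the base point are overwritten by the integration. For k = m the base
    point is irrelevant, which allows 0 to be replaced by c 0 + h in [lebB_affine]. *)
Lemma iint_dep k (g : V -> \bar R) (y z : V) :
  (forall j : 'I_m, (k <= j)%N -> y ord0 j = z ord0 j) -> iint k g y = iint k g z.
Proof.
elim: k y z => [|k IH] y z yz /=; first by congr g; apply/rowP => j; exact: yz.
apply: eq_integral => t _; apply: IH => j kj; rewrite !mxE.
by case: eqP => // /eqP jk; apply: yz; rewrite ltn_neqAle eq_sym jk.
Qed.

Lemma lebB_affine (c : R) (h : V) (A : set BV) : 0 < c -> measurable A ->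
  lebB A = ((c ^+ m)%:E * lebB [set x | A (c *: (x : V) + h)%R])%E.
Proof.
move=> c0 mA; rewrite /lebB /lebm.
rewrite (@iint_dep _ _ 0 (c *: 0 + h)); last by move=> j; rewrite leqNgt ltn_ord.
rewrite iint_affine//.
by apply/measurable_EFinP; exact: measurable_indic.
Qed.

Lemma iint_box k (c : R) (y : V) : (k <= m)%N -> 0 <= c ->
  iint k (fun z => (\1_([set x : V | forall j, `|x ord0 j| <= c]) z)%:E) y =
  (((2 * c) ^+ k)%:E * (\1_([set x : V | forall j : 'I_m, (k <= j)%N -> `|x ord0 j| <= c]) y)%:E)%E.
Proof.
move=> km c0; elim: k km y => [_ y|k IH km y] /=.
  rewrite mul1e; congr (\1_ _ _)%:E; apply/seteqP; split => x /= h j //; exact: h.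
under eq_integral do rewrite IH ?(ltnW km)//.
set D := [set x : V | forall j : 'I_m, (k < j)%N -> `|x ord0 j| <= c].
have E t : \1_([set x : V | forall j : 'I_m, (k <= j)%N -> `|x ord0 j| <= c]) (setcoord y k t)
    = \1_D y * \1_(`[-c, c]%classic) t :> R.
  rewrite /indic -natrM mulnb; congr (_%:R); congr nat_of_bool.
  apply/idP/andP => [/set_mem/= h|[/set_mem/= h1 /set_mem/= h2]].
    split; apply/mem_set => /=.
      move=> j kj; have := h j (ltnW kj); rewrite mxE; case: eqP => // jk.
      by rewrite jk ltnn in kj.
    have := h (Ordinal km) (leqnn k); rewrite mxE/= eqxx in_itv/= => ?.
    by rewrite -ler_norml.
  apply/mem_set => /= j kj; rewrite mxE; case: eqP => [_|/eqP jk].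
    by rewrite ler_norml; move: h2; rewrite in_itv.
  by apply: h1; rewrite ltn_neqAle eq_sym jk.
under eq_integral do rewrite E EFinM muleA.
rewrite ge0_integralZl//; last 2 first.
- by apply/measurable_EFinP; exact: measurable_indic.
- by rewrite -EFinM lee_fin mulr_ge0// exprn_ge0// mulr_ge0.
rewrite integral_indic//= setIT lebesgue_measure_itv/= lte_fin.
have -> : (if - c < c then (c%:E - (- c)%:E)%E else 0%E) = (2 * c)%:E.
  case: ltP => cc; first by rewrite -EFinB; congr EFin; ring.
  have -> : c = 0 by lra.
  by rewrite mulr0.
by rewrite -!EFinM; congr EFin; rewrite exprS; ring.
Qed.

Lemma lebB_box (c : R) : 0 <= c ->
  lebB [set x : V | forall j, `|x ord0 j| <= c] = ((2 * c) ^+ m)%:E.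
Proof.
move=> c0; rewrite /lebB /lebm iint_box// indicE mem_set ?mule1//.
by move=> j; rewrite leqNgt ltn_ord.
Qed.

End lebm_affine.

Section sums.
Context (R : realType).

Lemma cvg_bigsum (T : Type) (F : set_system T) (FF : Filter F)
    (I : Type) (r : seq I) (P : pred I) (f : I -> T -> R) (l : I -> R) :
  (forall i, P i -> f i @ F --> l i) ->
  (fun x => \sum_(i <- r | P i) f i x) @ F --> \sum_(i <- r | P i) l i.
Proof.
by move=> fl; apply: cvg_big => //; exact: add_continuous.
Qed.

Lemma continuous_bigsum (T : topologicalType)
    (I : Type) (r : seq I) (P : pred I) (f : I -> T -> R) :
  (forall i, P i -> continuous (f i)) ->
  continuous (fun x => \sum_(i <- r | P i) f i x).
Proof. by move=> cf x; apply: cvg_bigsum => i Pi; exact: cf. Qed.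

End sums.

(** * Inner product and Euclidean norm *)

Section euclidean.
Context (R : realType).

Lemma ler_of_sqr (x y : R) : 0 <= y -> x ^+ 2 <= y ^+ 2 -> x <= y.
Proof.
move=> y0 xy; rewrite (le_trans (ler_norm x))// -(ler_pXn2r (n := 2))// ?nnegrE//.
by rewrite real_normK// num_real.
Qed.

Lemma sum_CauchySchwarz (I : Type) (r : seq I) (a b : I -> R) :
  (\sum_(i <- r) a i * b i) ^+ 2 <=
  (\sum_(i <- r) a i ^+ 2) * (\sum_(i <- r) b i ^+ 2).
Proof.
elim: r => [|i r]; first by rewrite !big_nil expr0n mulr0.
rewrite !big_cons.
have A0 : 0 <= \sum_(i <- r) a i ^+ 2 by apply: sumr_ge0 => j _; exact: sqr_ge0.
have B0 : 0 <= \sum_(i <- r) b i ^+ 2 by apply: sumr_ge0 => j _; exact: sqr_ge0.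
move: (\sum_(i <- r) a i ^+ 2) (\sum_(i <- r) b i ^+ 2) (\sum_(i <- r) a i * b i) A0 B0.
move=> A B C A0 B0 CAB; move: (a i) (b i) => x y.
(* Compare squares: C^2 <= A B bounds the left one by 4 A B x^2 y^2, and the right one exceeds this
   by (A y^2 - B x^2)^2. *)
have h : 2 * C * (x * y) <= A * y ^+ 2 + B * x ^+ 2.
  apply: ler_of_sqr; first by rewrite addr_ge0// mulr_ge0// sqr_ge0.
  have -> : (2 * C * (x * y)) ^+ 2 = C ^+ 2 * (4 * (x * y) ^+ 2) by ring.
  have := ler_wpM2r (mulr_ge0 (ler0n R 4) (sqr_ge0 (x * y))) CAB.
  have := sqr_ge0 (A * y ^+ 2 - B * x ^+ 2).
  move=> h1 h2; apply: (le_trans h2); rewrite -subr_ge0.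
  by apply: le_trans h1 _; rewrite le_eqVlt; apply/orP; left; apply/eqP; ring.
rewrite -subr_ge0; rewrite -subr_ge0 in CAB; rewrite -subr_ge0 in h.
apply: le_trans (addr_ge0 CAB h) _.
by rewrite le_eqVlt; apply/orP; left; apply/eqP; ring.
Qed.

Context (m : nat).
Local Notation V := 'rV[R]_m.
Implicit Types x y z : V.

Lemma dotvC x y : dotv x y = dotv y x.
Proof. by apply: eq_bigr => i _; rewrite mulrC. Qed.

Lemma dotvDr x y z : dotv x (y + z) = dotv x y + dotv x z.
Proof. by rewrite -big_split; apply: eq_bigr => i _; rewrite mxE mulrDr. Qed.

Lemma dotvDl x y z : dotv (x + y) z = dotv x z + dotv y z.
Proof. by rewrite dotvC dotvDr !(dotvC z). Qed.

Lemma dotvZr c x y : dotv x (c *: y) = c * dotv x y.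
Proof. by rewrite mulr_sumr; apply: eq_bigr => i _; rewrite mxE; ring. Qed.

Lemma dotvZl c x y : dotv (c *: x) y = c * dotv x y.
Proof. by rewrite dotvC dotvZr dotvC. Qed.

Lemma dotvNr x y : dotv x (- y) = - dotv x y.
Proof. by rewrite -scaleN1r dotvZr mulN1r. Qed.

Lemma dotvNl x y : dotv (- x) y = - dotv x y.
Proof. by rewrite dotvC dotvNr dotvC. Qed.

Lemma dotv0r x : dotv x 0 = 0.
Proof. by rewrite -(scale0r 0) dotvZr mul0r. Qed.

Lemma dotv0l x : dotv 0 x = 0.
Proof. by rewrite dotvC dotv0r. Qed.

Lemma dotv_ge0 x : 0 <= dotv x x.
Proof. by apply: sumr_ge0 => i _; rewrite -expr2 sqr_ge0. Qed.

Lemma enorm_ge0 x : 0 <= enorm x. Proof. exact: sqrtr_ge0. Qed.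

Lemma enorm_sqr x : enorm x ^+ 2 = dotv x x.
Proof. by rewrite sqr_sqrtr// dotv_ge0. Qed.

Lemma dotv_CS x y : `|dotv x y| <= enorm x * enorm y.
Proof.
rewrite -(ler_pXn2r (n := 2))// ?nnegrE ?mulr_ge0 ?enorm_ge0//.
rewrite real_normK ?num_real// exprMn !enorm_sqr.
exact: sum_CauchySchwarz.
Qed.

Lemma enorm0 : enorm (0 : V) = 0.
Proof. by rewrite /enorm dotv0r sqrtr0. Qed.

Lemma enormZ c x : enorm (c *: x) = `|c| * enorm x.
Proof.
by rewrite /enorm dotvZl dotvZr mulrA -expr2 sqrtrM ?sqr_ge0// sqrtr_sqr.
Qed.

Lemma enormN x : enorm (- x) = enorm x.
Proof. by rewrite -scaleN1r enormZ normrN1 mul1r. Qed.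

Lemma enormD x y : enorm (x + y) <= enorm x + enorm y.
Proof.
apply: ler_of_sqr; first by rewrite addr_ge0// enorm_ge0.
rewrite enorm_sqr dotvDl !dotvDr (dotvC y x) sqrrD !enorm_sqr.
have := le_trans (ler_norm _) (dotv_CS x y); lra.
Qed.

Lemma coord_le_enorm x j : `|x ord0 j| <= enorm x.
Proof.
rewrite -(ler_pXn2r (n := 2))// ?nnegrE ?enorm_ge0//.
rewrite real_normK ?num_real// enorm_sqr /dotv (bigD1 j)//= -expr2 lerDl.
by apply: sumr_ge0 => i _; rewrite -expr2 sqr_ge0.
Qed.

Lemma enorm_le_sum x : enorm x <= \sum_j `|x ord0 j|.
Proof.
have s0 (P : pred 'I_m) : 0 <= \sum_(j | P j) `|x ord0 j| by exact: sumr_ge0.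
apply: ler_of_sqr => //; rewrite enorm_sqr expr2 mulr_suml.
apply: ler_sum => i _; rewrite -expr2 -real_normK ?num_real// expr2.
by rewrite ler_wpM2l// (bigD1 i)//= lerDl.
Qed.

Lemma enorm_eq0 x : (enorm x == 0) = (x == 0).
Proof.
apply/eqP/eqP => [x0|->]; last exact: enorm0.
by apply/rowP => j; rewrite mxE; apply/eqP; rewrite -normr_le0 -x0 coord_le_enorm.
Qed.

Lemma continuous_dotv x : continuous (dotv x).
Proof.
have -> : dotv x = fun y => \sum_(i < m) x ord0 i * y ord0 i by [].
apply: continuous_bigsum => i _ y.
by apply: continuousM; [exact: cst_continuous|exact: coord_continuous].
Qed.

Lemma continuous_enorm : continuous (@enorm R m).
Proof.
move=> x; apply: (continuous_comp (f := fun x => dotv x x)) (@sqrt_continuous R _).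
have -> : (fun x : V => dotv x x) = fun y => \sum_(i < m) y ord0 i * y ord0 i by [].
by move: x; apply: continuous_bigsum => i _ y; apply: continuousM; exact: coord_continuous.
Qed.

Lemma continuous_enormB (c : V) : continuous (fun x => enorm (x - c)).
Proof.
move=> x; apply: (continuous_comp (f := fun x : V => x - c)) (@continuous_enorm _).
by apply: continuousB; [exact: cvg_id|exact: cst_continuous].
Qed.

Lemma open_eball (c : V) rho : open (eball c rho).
Proof.
have := @open_comp _ _ (fun x => enorm (x - c)) [set t | t < rho].
by apply; [move=> x _; exact: continuous_enormB|exact: open_lt].
Qed.

Lemma measurable_eball (c : V) rho : measurable (eball c rho : set (BorelRm R m)).
Proof. by apply: open_measurable_rV; exact: open_eball. Qed.

End euclidean.

(** * Volume of balls and the uniform law *)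

Section volume.
Context (R : realType) (m : nat).
Local Notation V := 'rV[R]_m.
Local Notation BV := (BorelRm R m).

Lemma lebB_translate (h : V) (A : set BV) : measurable A ->
  lebB [set x | A ((x : V) + h)] = lebB A.
Proof.
move=> mA; rewrite (lebB_affine h ltr01 mA) expr1n mul1e.
by congr lebB; apply/seteqP; split => x; rewrite /= scale1r.
Qed.

Lemma measurable_box (c : R) :
  measurable ([set x | forall j, `|x ord0 j| <= c] : set BV).
Proof.
have E : [set x : V | forall j, `|x ord0 j| <= c] =
   \bigcap_(j in [set: 'I_m]) (fun x : V => x ord0 j) @^-1` `[- c, c]%classic.
  apply/seteqP; split => [x h j _|x h j]; [have /= := h j|have /= := h j I];
    by rewrite in_itv/= ler_norml.
rewrite [X in measurable X]E.
apply: fin_bigcap_measurable => [|j _]; first exact: finite_finset.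
rewrite -[X in measurable X]setTI.
exact: (@measurable_coord R m j measurableT `[-c, c]%classic).
Qed.

Lemma lebB_eball_lty : (lebB (eball (0 : V) 1) < +oo)%E.
Proof.
apply: (@le_lt_trans _ _ (lebB [set x : BV | forall j, `|(x : V) ord0 j| <= 1])).
  apply: le_measure; rewrite ?inE//; [exact: measurable_eball|exact: measurable_box|].
  move=> x; rewrite /eball/= subr0 => x1 j.
  by rewrite (le_trans (coord_le_enorm _ _))// ltW.
by rewrite lebB_box// ltry.
Qed.

Lemma lebB_eball_gt0 : (0 < lebB (eball (0 : V) 1))%E.
Proof.
(* This half-side gives m c < 1, which puts the box inside the open unit ball by [enorm_le_sum]. *)
pose c : R := m.+1%:R^-1.
have c0 : 0 < c by rewrite invr_gt0.
apply: (@lt_le_trans _ _ (lebB [set x : BV | forall j, `|(x : V) ord0 j| <= c])).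
  by rewrite lebB_box ?ltW// lte_fin exprn_gt0// mulr_gt0.
apply: le_measure; rewrite ?inE//; last 2 first.
- exact: measurable_eball.
- move=> x xc; rewrite /eball/= subr0 (le_lt_trans (enorm_le_sum x))//.
  apply: (@le_lt_trans _ _ (m%:R * c)).
    rewrite mulr_natl -[X in _ *+ X](card_ord m) -sumr_const.
    by apply: ler_sum => j _; exact: xc.
  by rewrite /c ltr_pdivrMr// mul1r ltr_nat.
exact: measurable_box.
Qed.

Definition volball : R := fine (lebB (eball (0 : V) 1)).

Lemma volball_gt0 : 0 < volball.
Proof. by rewrite fine_gt0// lebB_eball_gt0 lebB_eball_lty. Qed.

Lemma lebB_eball rho : 0 < rho -> lebB (eball (0 : V) rho) = (rho ^+ m * volball)%:E.
Proof.
move=> r0; rewrite (lebB_affine 0 r0 (measurable_eball 0 rho)) EFinM /volball fineK; last first.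
  by rewrite ge0_fin_numE ?measure_ge0// lebB_eball_lty.
congr (_ * lebB _)%E; apply/seteqP; split => x;
  by rewrite /eball/= addr0 !subr0 enormZ gtr0_norm// -ltr_pdivlMl// mulVf// gt_eqF.
Qed.

(** The Dirac mass is the fallback of the normalisation when the ball is empty, so that this is a
    probability for every [Rad]; for [Rad] > 0 it agrees with [volR]. *)
Definition unifB (Rad : R) : probability BV R :=
  mnormalize (mrestr (@lebB R m) (measurable_eball (0 : V) Rad)) (@dirac _ BV (0 : V) R).

Lemma unifBE Rad (A : set BV) : 0 < Rad -> unifB Rad A = volR Rad A.
Proof.
move=> R0; rewrite /unifB /= /mnormalize /mrestr /=.
have v0 : 0 < Rad ^+ m * volball by rewrite mulr_gt0 ?exprn_gt0// volball_gt0.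
rewrite /mrestr setTI lebB_eball// ifF; last by apply/negbTE; rewrite negb_or eqe gt_eqF.
by rewrite /volR -[lebm (eball _ _)]/(lebB (eball (0 : V) Rad)) lebB_eball.
Qed.

End volume.

(** * Means of trigonometric polynomials over large balls *)

Section bounded_measurable.
Context (R : realType) d (T : measurableType d).
Implicit Types (f g : T -> R) (P : probability T R).

(** A class closed under sums and products and integrable for every probability, so that
    expectations can be manipulated without separate integrability proofs. *)
Definition bmeas f := measurable_fun setT f /\ exists M : R, forall x, `|f x| <= M.

Lemma bmeas_cst (c : R) : bmeas (fun=> c).
Proof. by split => //; exists `|c|. Qed.

Lemma bmeasD f g : bmeas f -> bmeas g -> bmeas (fun x => f x + g x).
Proof.
move=> [mf [M fM]] [mg [N gN]]; split; first exact: measurable_funD.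
by exists (M + N) => x; rewrite (le_trans (ler_normD _ _))// lerD.
Qed.

Lemma bmeasM f g : bmeas f -> bmeas g -> bmeas (fun x => f x * g x).
Proof.
move=> [mf [M fM]] [mg [N gN]]; split; first exact: measurable_funM.
by exists (M * N) => x; rewrite normrM ler_pM.
Qed.

Lemma bmeasZ c f : bmeas f -> bmeas (fun x => c * f x).
Proof. by apply: bmeasM; exact: bmeas_cst. Qed.

Lemma bmeasN f : bmeas f -> bmeas (fun x => - f x).
Proof. by move=> bf; under eq_fun do rewrite -mulN1r; exact: bmeasZ. Qed.

Lemma bmeasB f g : bmeas f -> bmeas g -> bmeas (fun x => f x - g x).
Proof. by move=> bf bg; apply: bmeasD => //; exact: bmeasN. Qed.

Lemma bmeas_sum I (r : seq I) (Q : pred I) (F : I -> T -> R) :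
  (forall i, bmeas (F i)) -> bmeas (fun x => \sum_(i <- r | Q i) F i x).
Proof.
move=> bF; elim: r => [|i r IH].
  by under eq_fun do rewrite big_nil; exact: bmeas_cst.
under eq_fun do rewrite big_cons.
by case: (Q i) => //; exact: bmeasD.
Qed.

Lemma bmeas_indic (A : set T) : measurable A -> bmeas (\1_A).
Proof.
move=> mA; split; first exact: measurable_indic.
by exists 1 => x; rewrite indicE ger0_norm ?ler0n// lern1 leq_b1.
Qed.

Lemma bmeas_cos f : measurable_fun setT f -> bmeas (fun x => cos (f x)).
Proof.
move=> mf; split; last first.
  by exists 1 => x; rewrite ler_norml cos_geN1 cos_le1.
by apply: measurableT_comp mf; apply: continuous_measurable_fun; exact: continuous_cos.
Qed.

Definition Ex P f : R := \int[P]_x f x.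

Lemma bmeas_integrable P f : bmeas f -> P.-integrable setT (EFin \o f).
Proof.
move=> [mf [M fM]]; apply: measurable_bounded_integrable => //.
  exact: le_lt_trans (probability_le1 P measurableT) (ltry 1).
by exists M; split; [exact: num_real|move=> z Mz x _; apply: (le_trans (fM x)); exact: ltW].
Qed.

Lemma Ex_EFin P f : bmeas f -> (\int[P]_x (f x)%:E)%E = (Ex P f)%:E.
Proof.
by move=> bf; rewrite fineK//; apply: integrable_fin_num => //; exact: bmeas_integrable.
Qed.

Lemma eq_Ex P f g : f =1 g -> Ex P f = Ex P g.
Proof. by move=> /funext ->. Qed.

Lemma Ex_cst P c : Ex P (fun=> c) = c.
Proof. by rewrite /Ex Rintegral_cst//= probability_setT mulr1. Qed.

Lemma ExD P f g : bmeas f -> bmeas g -> Ex P (fun x => f x + g x) = Ex P f + Ex P g.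
Proof. by move=> bf bg; rewrite /Ex RintegralD//; exact: bmeas_integrable. Qed.

Lemma ExZ P c f : bmeas f -> Ex P (fun x => c * f x) = c * Ex P f.
Proof. by move=> bf; rewrite /Ex RintegralZl//; exact: bmeas_integrable. Qed.

Lemma ExN P f : bmeas f -> Ex P (fun x => - f x) = - Ex P f.
Proof. by move=> bf; under eq_Ex do rewrite -mulN1r; rewrite ExZ// mulN1r. Qed.

Lemma ExB P f g : bmeas f -> bmeas g -> Ex P (fun x => f x - g x) = Ex P f - Ex P g.
Proof. by move=> bf bg; rewrite ExD ?ExN//; exact: bmeasN. Qed.

Lemma Ex_sum P I (r : seq I) (Q : pred I) (F : I -> T -> R) :
  (forall i, bmeas (F i)) ->
  Ex P (fun x => \sum_(i <- r | Q i) F i x) = \sum_(i <- r | Q i) Ex P (F i).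
Proof.
move=> bF; elim: r => [|i r IH].
  by under eq_Ex do rewrite big_nil; rewrite Ex_cst big_nil.
under eq_Ex do rewrite big_cons.
by rewrite big_cons; case: (Q i) => //; rewrite ExD ?IH//; exact: bmeas_sum.
Qed.

Lemma le_Ex P f g : bmeas f -> bmeas g -> (forall x, f x <= g x) -> Ex P f <= Ex P g.
Proof. by move=> bf bg fg; apply: le_Rintegral => //; exact: bmeas_integrable. Qed.

Lemma normr_Ex P f (M : R) : bmeas f -> (forall x, `|f x| <= M) -> `|Ex P f| <= M.
Proof.
move=> bf fM; rewrite ler_norml -{1}(Ex_cst P (- M)) -{2}(Ex_cst P M).
by apply/andP; split; apply: le_Ex => //; try exact: bmeas_cst;
  move=> x; have := fM x; rewrite ler_norml => /andP[].
Qed.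

Lemma Ex_indic P (A : set T) : measurable A -> (Ex P \1_A)%:E = P A.
Proof. by move=> mA; rewrite -Ex_EFin; [rewrite integral_indic// setIT|exact: bmeas_indic]. Qed.

Lemma Ex_markov P f (c : R) : bmeas f -> 0 < c -> (forall x, 0 <= f x) ->
  (P [set x | c <= f x]%R <= (Ex P f / c)%:E)%E.
Proof.
move=> bf c0 f0.
have mA : measurable [set x | c <= f x].
  by rewrite -[X in measurable X]setTI; apply: measurable_fun_le => //; exact: bf.1.
rewrite -Ex_indic// lee_fin ler_pdivlMr// mulrC -ExZ; last exact: bmeas_indic.
apply: le_Ex => //; first exact/bmeasZ/bmeas_indic.
move=> x; rewrite indicE; case: (boolP (x \in _)); last by rewrite mulr0.
by rewrite mulr1 => /set_mem.
Qed.

(** Meant for P uniform on a smaller ball and q the ratio of the volumes of the two balls. *)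
Lemma le_Ex_measure P (mu : {measure set T -> \bar R}) (q : R) f :
  0 <= q -> bmeas f -> (forall x, 0 <= f x) ->
  (forall A, measurable A -> q%:E * P A <= mu A)%E ->
  ((q * Ex P f)%:E <= \int[mu]_x (f x)%:E)%E.
Proof.
move=> q0 bf f0 Pmu; have mf : measurable_fun setT (EFin \o f).
  by apply/measurable_EFinP; exact: bf.1.
rewrite EFinM -Ex_EFin//.
rewrite -(@ge0_integral_mscale _ _ _ P _ measurableT (NngNum q0) _ mf)//; last first.
  by move=> x _; rewrite lee_fin.
by apply: ge0_le_measure_integral.
Qed.

End bounded_measurable.

(** * Cosines of nonzero frequency average to zero *)

Section mean_cos.
Context (R : realType) (m : nat).
Local Notation V := 'rV[R]_m.
Local Notation BV := (BorelRm R m).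

Lemma measurable_phase (v : V) (psi : R) :
  measurable_fun setT (fun x : BV => 2 * pi * dotv v x + psi).
Proof.
apply: measurable_funD => //; apply: measurable_funM => //.
by apply: continuous_measurable_rV; exact: continuous_dotv.
Qed.

(* Translating by h = v/(2|v|^2) changes the sign of the cosine, and the
   translate of the ball still contains the ball of radius Rad - |h|. *)
Lemma mean_cos_ge (v : V) (psi Rad : R) : v != 0 -> (2 * enorm v)^-1 < Rad ->
  (1 - (2 * enorm v)^-1 / Rad) ^+ m - 1 <=
  Ex (unifB m Rad) (fun x => cos (2 * pi * dotv v x + psi)).
Proof.
move=> v0; set e := (2 * enorm v)^-1 => eRad.
have nv0 : 0 < enorm v by rewrite lt_neqAle enorm_ge0 eq_sym enorm_eq0 v0.
have e0 : 0 < e by rewrite invr_gt0 mulr_gt0.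
have R0 : 0 < Rad by rewrite (lt_trans e0).
pose h : V := (2 * dotv v v)^-1 *: v.
have nh : enorm h = e.
  rewrite enormZ -enorm_sqr ger0_norm ?invr_ge0 ?mulr_ge0 ?sqr_ge0 ?enorm_ge0// /e.
  by field; rewrite gt_eqF.
have vh : 2 * pi * dotv v h = pi.
  by rewrite dotvZr -enorm_sqr; field; rewrite gt_eqF.
pose q := (1 - e / Rad) ^+ m.
have q0 : 0 <= q by rewrite exprn_ge0// subr_ge0 ler_pdivrMr// mul1r ltW.
have qE : q = ((Rad - e) ^+ m * volball R m) / (Rad ^+ m * volball R m).
  rewrite /q -[RHS]mulrA invfM [_ * (_ / _)]mulrCA divff ?gt_eqF ?volball_gt0// mulr1.
  by rewrite -exprVn -exprMn mulrBl divff// gt_eqF.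
pose nu := unifB m Rad; pose nu' := unifB m (Rad - e).
pose k := mscale (NngNum q0) nu'.
have Re0 : 0 < Rad - e by rewrite subr_gt0.
have kE A : measurable A -> (k A = lebB (A `&` eball (0 : V) (Rad - e)) * ((Rad ^+ m * volball R m)^-1)%:E)%E.
  move=> mA; rewrite /k /mscale/= /nu' unifBE// /volR -[lebm (eball _ _)]/(lebB (eball (0 : V) (Rad - e))) lebB_eball//=.
  rewrite muleCA -EFinM; congr (_ * _%:E)%E; rewrite qE; field.
  by rewrite !gt_eqF ?exprn_gt0 ?volball_gt0.
have nuE A : (nu A = lebB (A `&` eball (0 : V) Rad) * ((Rad ^+ m * volball R m)^-1)%:E)%E.
  by rewrite /nu unifBE// /volR -[lebm (eball _ _)]/(lebB (eball (0 : V) Rad)) lebB_eball.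
have Vi0 : (0 <= ((Rad ^+ m * volball R m)^-1)%:E)%E.
  by rewrite lee_fin invr_ge0 mulr_ge0 ?exprn_ge0 ?ltW// volball_gt0.
have mh : measurable_fun setT (fun x : BV => (x : V) + h : BV).
  by have := @measurable_affine R m 1 h; under eq_fun do rewrite scale1r.
pose nuh' := pushforward nu (fun x : BV => (x : V) + h : BV) : measure BV R.
pose nuh : measure BV R := nuh' mh.
have k1 A : measurable A -> (k A <= nu A)%E.
  move=> mA; rewrite kE// nuE lee_wpmul2r//.
  apply: le_measure; rewrite ?inE; [by apply: measurableI => //; exact: measurable_eball..|].
  by apply: setIS => x; rewrite /eball/= => /lt_le_trans; apply; lra.
have k2 A : measurable A -> (k A <= nuh A)%E.
  move=> mA; rewrite kE// /nuh/= /pushforward nuE lee_wpmul2r//.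
  have mA' : measurable ((fun x : BV => (x : V) + h : BV) @^-1` A).
    by have := mh measurableT _ mA; rewrite setTI.
  have mC := @measurable_eball R m (0 : V) (Rad - e).
  rewrite -(lebB_translate h); last exact: measurableI.
  have mC' : measurable ([set x | eball (0 : V) (Rad - e) ((x : V) + h)] : set BV).
    by have := mh measurableT _ mC; rewrite setTI.
  apply: le_measure; rewrite ?inE; [exact: measurableI|apply: measurableI => //; exact: measurable_eball|].
  move=> x [Ax Cx]; split => //; move: Cx; rewrite /eball/= !subr0 => xh.
  have := enormD (x + h) (- h); rewrite addrK enormN nh; lra.
pose th (x : BV) := 2 * pi * dotv v x + psi.
have bc : bmeas (fun x => cos (th x)) by apply: bmeas_cos; exact: measurable_phase.
pose g1 (x : BV) := 1 + cos (th x); pose g2 (x : BV) := 1 - cos (th x).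
have b1 : bmeas g1 by apply: bmeasD => //; exact: bmeas_cst.
have b2 : bmeas g2 by apply: bmeasB => //; exact: bmeas_cst.
have g10 x : 0 <= g1 x by have := cos_geN1 (th x); rewrite /g1; lra.
have g20 x : 0 <= g2 x by have := cos_le1 (th x); rewrite /g2; lra.
have g12 x : g2 ((x : V) + h) = g1 x.
  by rewrite /g2 /g1 /th dotvDr mulrDr vh addrAC cosDpi opprK.
have I1 : q * Ex nu' g1 <= Ex nu g1.
  by rewrite -lee_fin -(Ex_EFin nu)//; exact: le_Ex_measure.
have I2 : q * Ex nu' g2 <= Ex nu g1.
  rewrite -lee_fin -(Ex_EFin nu)//.
  have -> : (\int[nu]_x (g1 x)%:E = \int[nuh]_x (g2 x)%:E)%E.
    rewrite (ge0_integral_pushforward mh)//.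
    + by rewrite preimage_setT; apply: eq_integral => x _ /=; rewrite g12.
    + by apply/measurable_EFinP; exact: b2.1.
    + by move=> x _; rewrite lee_fin.
  exact: le_Ex_measure.
move: I1 I2; rewrite /g1 /g2 ExD ?ExB ?ExD//; try exact: bmeas_cst.
rewrite !Ex_cst -/q -/(th _) => I1 I2; rewrite -[X in _ <= X]/(Ex nu (fun x => cos (th x))).
by lra.
Qed.

Lemma mean_cos (v : V) (psi : R) : v != 0 ->
  (fun Rad => Ex (unifB m Rad) (fun x => cos (2 * pi * dotv v x + psi))) @ +oo --> 0.
Proof.
move=> v0; set e := (2 * enorm v)^-1.
have key : (fun Rad => (1 - e / Rad) ^+ m - 1) @ +oo --> (0 : R).
  rewrite -(subrr (1 : R)); apply: cvgB; last exact: cvg_cst.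
  rewrite -[X in _ --> X](expr1n _ m).
  have h : (fun Rad => 1 - e / Rad) @ +oo --> (1 : R).
    rewrite -[X in _ --> X]subr0; apply: cvgB; first exact: cvg_cst.
    rewrite -[X in _ --> X](mulr0 e); apply: cvgM; first exact: cvg_cst.
    apply/cvgrPdist_lt => eps eps0; near=> Rad.
    have R0 : 0 < Rad by near: Rad; exact: nbhs_pinfty_gt.
    rewrite sub0r normrN gtr0_norm ?invr_gt0// -[ltRHS]invrK ltf_pV2 ?posrE ?invr_gt0//.
    by near: Rad; apply: nbhs_pinfty_gt; exact: num_real.
  exact: (cvg_comp _ _ h (@exprn_continuous R m 1)).
have keyN : (fun Rad => - ((1 - e / Rad) ^+ m - 1)) @ +oo --> (0 : R).
  by rewrite -[X in _ --> X]oppr0; exact: cvgN.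
apply: squeeze_cvgr key keyN; near=> Rad.
have eR : e < Rad by near: Rad; apply: nbhs_pinfty_gt; exact: num_real.
rewrite mean_cos_ge//= lerNr.
(* The upper bound is the lower bound for the phase psi + pi, which flips the sign of the cosine. *)
have := @mean_cos_ge v (psi + pi) Rad v0 eR.
under eq_Ex do rewrite addrA cosDpi.
by rewrite ExN//; apply: bmeas_cos; exact: measurable_phase.
Unshelve. all: by end_near. Qed.

End mean_cos.

(** * Taylor bounds and polynomial approximation of the cosine *)

Section trig_estimates.
Context (R : realType).
Implicit Types (t u x M e : R).

Lemma mvt_bound (f df : R -> R) (a b M : R) :
  (forall x : R, is_derive x 1 f (df x)) ->
  (forall x, Num.min a b <= x <= Num.max a b -> `|df x| <= M) ->
  `|f b - f a| <= M * `|b - a|.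
Proof.
move=> fdf dfM.
have cf : continuous f.
  move=> x; apply: differentiable_continuous; apply/derivable1_diffP.
  by have [] := fdf x.
wlog ab : a b dfM / a < b => [H|].
  have [ab|ba|->] := ltgtP a b; first exact: H.
  - by rewrite distrC [in leRHS]distrC; apply: H => // x; rewrite minC maxC; exact: dfM.
  - by rewrite !subrr normr0 mulr0.
have [c cab ->] := MVT ab (fun x _ => fdf x) (continuous_subspaceT cf).
rewrite normrM ler_wpM2r//; apply: dfM.
by move: cab; rewrite in_itv/= (min_idPl (ltW ab)) (max_idPr (ltW ab)) => /andP[? ?]; rewrite !ltW.
Qed.

Lemma sin_lip (a b : R) : `|sin b - sin a| <= `|b - a|.
Proof.
rewrite -[leRHS]mul1r; apply: (@mvt_bound sin cos) => x _.
by rewrite ler_norml cos_geN1 cos_le1.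
Qed.

Lemma le_norm_minmax0 u x : Num.min 0 u <= x <= Num.max 0 u -> `|x| <= `|u|.
Proof.
case: (leP 0 u) => u0 /andP[x1 x2]; first by rewrite !ger0_norm.
by rewrite !ler0_norm ?(ltW u0)// lerN2.
Qed.

Lemma abs_sin_le u : `|sin u| <= `|u|.
Proof. by have := sin_lip 0 u; rewrite sin0 !subr0. Qed.

(** From here to [cos_taylor], each bound follows from the previous one by the mean value
    inequality. The constants are crude; only the exponents matter for the central limit theorem. *)
Lemma one_sub_cos_le u : `|cos u - 1| <= u ^+ 2.
Proof.
have /= := @mvt_bound cos (fun x => - sin x) 0 u `|u|.
rewrite cos0 subr0 -expr2 real_normK ?num_real//; apply => x.
by move=> /le_norm_minmax0; rewrite normrN; exact: le_trans (abs_sin_le _).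
Qed.

Lemma sin_taylor u : `|sin u - u| <= `|u| ^+ 3.
Proof.
have /= := @mvt_bound (fun x => sin x - x) (fun x => cos x - 1) 0 u (u ^+ 2).
rewrite sin0 !subr0 -[in u ^+ 2](real_normK (num_real u)) -exprSr; apply => x.
move=> /le_norm_minmax0 xu; rewrite real_normK ?num_real// (le_trans (one_sub_cos_le _))//.
by rewrite -[x ^+ 2]real_normK ?num_real// -[u ^+ 2]real_normK ?num_real// lerXn2r// nnegrE.
Qed.

Lemma cos_taylor u : `|cos u - (1 - u ^+ 2 / 2)| <= `|u| ^+ 4.
Proof.
have /= := @mvt_bound (fun x => cos x + x ^+ 2 / 2) (fun x => - sin x + x) 0 u (`|u| ^+ 3).
rewrite cos0 expr0n/= mul0r addr0 subr0 -exprSr.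
have -> : cos u - (1 - u ^+ 2 / 2) = cos u + u ^+ 2 / 2 - 1 by ring.
apply => x.
  apply: is_deriveD.
  by apply: is_derive_eq; rewrite /GRing.scale/=; field.
move=> /le_norm_minmax0 xu; rewrite addrC distrC (le_trans (sin_taylor _))//.
by rewrite lerXn2r// nnegrE.
Qed.

Lemma cosD_taylor x u :
  `|cos (x + u) - (cos x - u * sin x - u ^+ 2 / 2 * cos x)| <= `|u| ^+ 3 + `|u| ^+ 4.
Proof.
rewrite cosD.
have -> : cos x * cos u - sin x * sin u - (cos x - u * sin x - u ^+ 2 / 2 * cos x) =
  cos x * (cos u - (1 - u ^+ 2 / 2)) - sin x * (sin u - u) by ring.
rewrite (le_trans (ler_normB _ _))// addrC !normrM.
have c1 : `|cos x| <= 1 by rewrite ler_norml cos_geN1 cos_le1.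
have s1 : `|sin x| <= 1 by rewrite ler_norml sin_geN1 sin_le1.
by rewrite lerD// -[leRHS]mul1r ler_pM ?sin_taylor ?cos_taylor.
Qed.

(** On |t| <= M the tail of the cosine series is dominated term by term by the tail of the
    exponential series at M, which makes the truncation uniform in t. *)
Lemma cos_poly_approx M e : 0 < e ->
  exists n, exists c : nat -> R,
    forall t, `|t| <= M -> `|cos t - \sum_(k < n) c k * t ^+ k| <= e.
Proof.
move=> e0.
have /cauchy_cvgP := @is_cvg_series_exp_coeff R M.
move=> /cauchy_seriesP/(_ e e0)[[A B] /= [[a _ Aa] [b _ Bb]] AB].
exists (maxn a b), (fun k => (~~ odd k)%:R * (-1) ^+ k./2 / k`!%:R) => t tM.
have M0 : 0 <= M by rewrite (le_trans _ tM).
rewrite unlock; set n := maxn a b.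
have cvt := @is_cvg_series_cos_coeff R t.
have -> : \sum_(k < n) (~~ odd k)%:R * (-1) ^+ k./2 / k`!%:R * t ^+ k = series (cos_coeff t) n.
  rewrite /series/= big_mkord; apply: eq_bigr => k _.
  by rewrite cos_coeffE.
have h : (fun N => `|series (cos_coeff t) N - series (cos_coeff t) n|) @ \oo -->
    `|lim (series (cos_coeff t) @ \oo) - series (cos_coeff t) n|.
  by apply: cvg_norm; apply: cvgB => //; exact: cvg_cst.
rewrite -(cvg_lim _ h)//; apply: limr_le; first by apply/cvg_ex; eexists; exact: h.
exists n => // N /= nN.
rewrite sub_series_geq// (le_trans (ler_norm_sum _ _ _))//.
have := AB (n, N); rewrite /= => /(_ (conj (Aa _ (leq_maxl _ _)) (Bb _ _))).
move=> /(_ (leq_trans (leq_maxr _ _) nN))/ltW; apply: le_trans.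
rewrite ger0_norm; last by apply: sumr_ge0 => k _; exact: exp_coeff_ge0.
apply: ler_sum => k _; rewrite cos_coeffE /exp_coeff/=.
rewrite !normrM normrX normrN1 expr1n mulr1 normfV !normr_nat normrX.
rewrite mulrAC ler_wpM2r ?invr_ge0// (le_trans (y := `|t| ^+ k))//.
  by rewrite ler_piMl ?exprn_ge0// lern1 leq_b1.
by rewrite lerXn2r// nnegrE.
Qed.

End trig_estimates.

(** * Trigonometric polynomials over an abstract set of phases *)

Section trigpoly.
Context (R : realType) (X : Type).
Implicit Types (Ph : set (X -> R)) (f g : X -> R).

(** Cosines suffice because a sine is a cosine with shifted phase. The set of phases is a parameter
    so as to cover both functions of x in R^m, with frequencies in a lattice, and functions of
    finitely many point evaluations. *)
Inductive trigpoly Ph : (X -> R) -> Prop :=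
| trigpoly_cos th : Ph th -> trigpoly Ph (fun x => cos (th x))
| trigpolyD f g : trigpoly Ph f -> trigpoly Ph g -> trigpoly Ph (fun x => f x + g x)
| trigpolyZ c f : trigpoly Ph f -> trigpoly Ph (fun x => c * f x).

(** What the product-to-sum formula needs to make trigonometric polynomials an algebra with
    constants. *)
Definition phase_set Ph :=
  [/\ forall c, Ph (fun=> c),
      forall a b, Ph a -> Ph b -> Ph (fun x => a x + b x) &
      forall a, Ph a -> Ph (fun x => - a x)].

Variable (Ph : set (X -> R)) (hPh : phase_set Ph).

Lemma trigpoly_cst c : trigpoly Ph (fun=> c).
Proof.
have [h _ _] := hPh.
have := trigpolyZ c (trigpoly_cos (h 0)).
by under eq_fun do rewrite cos0 mulr1.
Qed.

Lemma trigpoly_cosM a g : Ph a -> trigpoly Ph g -> trigpoly Ph (fun x => cos (a x) * g x).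
Proof.
have [hc hD hN] := hPh.
move=> Pa; elim => [b Pb|f h _ IHf _ IHh|c f _ IHf].
- have := trigpolyZ (2^-1) (trigpolyD (trigpoly_cos (hD _ _ Pa Pb)) (trigpoly_cos (hD _ _ Pa (hN _ Pb)))).
  by congr trigpoly; apply/funext => x; rewrite !cosD cosN sinN; field.
- by under eq_fun do rewrite mulrDr; exact: trigpolyD.
- by under eq_fun do rewrite mulrCA; exact: trigpolyZ.
Qed.

Lemma trigpolyM f g : trigpoly Ph f -> trigpoly Ph g -> trigpoly Ph (fun x => f x * g x).
Proof.
move=> tf tg; elim: tf => [a Pa|f1 f2 _ IH1 _ IH2|c f1 _ IH].
- exact: trigpoly_cosM.
- by under eq_fun do rewrite mulrDl; exact: trigpolyD.
- by under eq_fun do rewrite -mulrA; exact: trigpolyZ.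
Qed.

Lemma trigpolyX f n : trigpoly Ph f -> trigpoly Ph (fun x => f x ^+ n).
Proof.
move=> tf; elim: n => [|n IH]; first exact: trigpoly_cst.
by under eq_fun do rewrite exprS; exact: trigpolyM.
Qed.

Lemma trigpoly_sum I (r : seq I) (P : pred I) (F : I -> X -> R) :
  (forall i, trigpoly Ph (F i)) -> trigpoly Ph (fun x => \sum_(i <- r | P i) F i x).
Proof.
move=> tF; elim: r => [|i r IH].
  by under eq_fun do rewrite big_nil; exact: trigpoly_cst.
under eq_fun do rewrite big_cons.
by case: (P i) => //; exact: trigpolyD.
Qed.

Lemma trigpoly_prod I (r : seq I) (P : pred I) (F : I -> X -> R) :
  (forall i, trigpoly Ph (F i)) -> trigpoly Ph (fun x => \prod_(i <- r | P i) F i x).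
Proof.
move=> tF; elim: r => [|i r IH].
  by under eq_fun do rewrite big_nil; exact: trigpoly_cst.
under eq_fun do rewrite big_cons.
by case: (P i) => //; exact: trigpolyM.
Qed.

Lemma trigpoly_bounded f : trigpoly Ph f -> exists M : R, forall x, `|f x| <= M.
Proof.
elim => [a _|f1 f2 _ [M1 h1] _ [M2 h2]|c f1 _ [M1 h1]].
- by exists 1 => x; rewrite ler_norml cos_geN1 cos_le1.
- by exists (M1 + M2) => x; rewrite (le_trans (ler_normD _ _))// lerD.
- by exists (`|c| * M1) => x; rewrite normrM ler_wpM2l.
Qed.

(** A trigonometric polynomial is bounded, so the cosine can be replaced on its range by an ordinary
    polynomial, and the algebra property concludes. *)
Lemma cos_trigpoly_approx f (phi e : R) : trigpoly Ph f -> 0 < e ->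
  exists2 g, trigpoly Ph g & forall x, `|cos (f x + phi) - g x| <= e.
Proof.
move=> tf e0; pose h x := f x + phi.
have th : trigpoly Ph h by apply: trigpolyD => //; exact: trigpoly_cst.
have [M hM] := trigpoly_bounded th.
have [n [c nc]] := cos_poly_approx M e0.
exists (fun x => \sum_(k < n) c k * h x ^+ k); last by move=> x; apply: nc; exact: hM.
by apply: trigpoly_sum => k; apply: trigpolyZ; exact: trigpolyX.
Qed.

End trigpoly.

Lemma eq_cvgto (R : realType) (T : Type) (F : set_system T) (f g : T -> R) (l : R) :
  f =1 g -> g @ F --> l -> f @ F --> l.
Proof. by move=> /funext ->. Qed.

Section mean_trigpoly.
Context (R : realType) (m : nat).
Local Notation V := 'rV[R]_m.
Local Notation BV := (BorelRm R m).
Implicit Types (L : set V) (v w : V).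

Definition phases L : set (BV -> R) :=
  [set th | exists v psi, L v /\ th = (fun x => 2 * pi * dotv v x + psi)].

Lemma phases_set L : L 0 -> (forall v w, L v -> L w -> L (v + w)) ->
  (forall v, L v -> L (- v)) -> phase_set (phases L).
Proof.
move=> L0 LD LN; split.
- by move=> c; exists 0, c; split => //; apply/funext => x; rewrite dotv0l mulr0 add0r.
- move=> _ _ [v [psi [Lv ->]]] [w [psi' [Lw ->]]]; exists (v + w), (psi + psi').
  by split; [exact: LD|apply/funext => x; rewrite dotvDl; ring].
- move=> _ [v [psi [Lv ->]]]; exists (- v), (- psi).
  by split; [exact: LN|apply/funext => x; rewrite dotvNl; ring].
Qed.

Lemma bmeas_phase v psi : bmeas (fun x : BV => cos (2 * pi * dotv v x + psi)).
Proof. by apply: bmeas_cos; exact: measurable_phase. Qed.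

Lemma trigpoly_bmeas L f : trigpoly (phases L) f -> bmeas f.
Proof.
elim => [th [v [psi [_ ->]]]|f1 f2 _ h1 _ h2|c f1 _ h1].
- exact: bmeas_phase.
- exact: bmeasD.
- exact: bmeasZ.
Qed.

(** By product-to-sum only the frequencies v + w and v - w occur. Both are nonzero, the second
    because L is symmetric, so [mean_cos] applies to each. *)
Lemma mean_trigpolyM L g w psi : (forall v, L v -> v + w != 0) ->
  (forall v, L v -> L (- v)) -> trigpoly (phases L) g ->
  (fun Rad => Ex (unifB m Rad) (fun x => g x * cos (2 * pi * dotv w x + psi)))
    @ +oo --> 0.
Proof.
move=> Lw LN; elim => [th [v [psi' [Lv ->]]]|f1 f2 t1 h1 t2 h2|c f1 t1 h1].
- have E Rad : Ex (unifB m Rad)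
      (fun x => cos (2 * pi * dotv v x + psi') * cos (2 * pi * dotv w x + psi)) =
    2^-1 * (Ex (unifB m Rad) (fun x => cos (2 * pi * dotv (v + w) x + (psi' + psi))) +
            Ex (unifB m Rad) (fun x => cos (2 * pi * dotv (v - w) x + (psi' - psi)))).
    rewrite -ExD; [|exact: bmeas_phase..]; rewrite -ExZ; last first.
      by apply: bmeasD; exact: bmeas_phase.
    apply: eq_Ex => x; rewrite dotvDl [dotv (v - w) x]dotvDl dotvNl.
    have -> : 2 * pi * (dotv v x + dotv w x) + (psi' + psi) =
      (2 * pi * dotv v x + psi') + (2 * pi * dotv w x + psi) by ring.
    have -> : 2 * pi * (dotv v x - dotv w x) + (psi' - psi) =
      (2 * pi * dotv v x + psi') - (2 * pi * dotv w x + psi) by ring.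
    move: (_ + psi') (_ + psi) => A B; rewrite cosD cosB; field; done.
  apply: (eq_cvgto E).
  rewrite -[X in _ --> X](mulr0 2^-1); apply: cvgM; first exact: cvg_cst.
  rewrite -[X in _ --> X](addr0 0); apply: cvgD; apply: mean_cos; first exact: Lw.
  have := Lw _ (LN _ Lv); apply: contra_neq => vw.
  by rewrite addrC -opprB vw oppr0.
- have E Rad : Ex (unifB m Rad) (fun x => (f1 x + f2 x) * cos (2 * pi * dotv w x + psi)) =
    Ex (unifB m Rad) (fun x => f1 x * cos (2 * pi * dotv w x + psi)) +
    Ex (unifB m Rad) (fun x => f2 x * cos (2 * pi * dotv w x + psi)).
    have b1 := trigpoly_bmeas t1; have b2 := trigpoly_bmeas t2.
    rewrite -ExD; [|by apply: bmeasM => //; exact: bmeas_phase..].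
    by apply: eq_Ex => x; rewrite mulrDl.
  by apply: (eq_cvgto E); rewrite -[X in _ --> X](addr0 0); exact: cvgD.
- have E Rad : Ex (unifB m Rad) (fun x => (c * f1 x) * cos (2 * pi * dotv w x + psi)) =
    c * Ex (unifB m Rad) (fun x => f1 x * cos (2 * pi * dotv w x + psi)).
    have b1 := trigpoly_bmeas t1.
    rewrite -ExZ; [|by apply: bmeasM => //; exact: bmeas_phase].
    by apply: eq_Ex => x; rewrite mulrA.
  apply: (eq_cvgto E); rewrite -[X in _ --> X](mulr0 c).
  by apply: cvgM => //; exact: cvg_cst.
Qed.

(** Uniform approximation errors pass to the mean unchanged since the extra cosine is at most 1 in
    absolute value. *)
Lemma mean_utrigM L f w psi : (forall v, L v -> v + w != 0) ->
  (forall v, L v -> L (- v)) -> bmeas f ->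
  (forall e, 0 < e -> exists2 g, trigpoly (phases L) g & forall x, `|f x - g x| <= e) ->
  (fun Rad => Ex (unifB m Rad) (fun x => f x * cos (2 * pi * dotv w x + psi)))
    @ +oo --> 0.
Proof.
move=> Lw LN bf fg; apply/cvgr0Pnorm_le => e e0.
have [g tg gfe] := fg _ (divr_gt0 e0 (ltr0n R 2)).
have /cvgr0Pnorm_le/(_ _ (divr_gt0 e0 (ltr0n R 2))) := mean_trigpolyM psi Lw LN tg.
apply: filterS => Rad h.
have bg := trigpoly_bmeas tg; have bc := bmeas_phase w psi.
have -> : Ex (unifB m Rad) (fun x => f x * cos (2 * pi * dotv w x + psi)) =
  Ex (unifB m Rad) (fun x => g x * cos (2 * pi * dotv w x + psi)) +
  Ex (unifB m Rad) (fun x => (f x - g x) * cos (2 * pi * dotv w x + psi)).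
  rewrite -ExD; last 2 first.
  - exact: bmeasM.
  - by apply: bmeasM => //; exact: bmeasB.
  by apply: eq_Ex => x; ring.
rewrite (le_trans (ler_normD _ _))// (splitr e) lerD//.
apply: normr_Ex => [|x]; first by apply: bmeasM => //; exact: bmeasB.
rewrite normrM -[leRHS]mulr1 ler_pM//.
by rewrite ler_norml cos_geN1 cos_le1.
Qed.

End mean_trigpoly.

Lemma expR_taylor1 (R : realType) (d : R) : 0 <= d -> `|expR (- d) - (1 - d)| <= d ^+ 2.
Proof.
move=> d0; rewrite ger0_norm; last by rewrite subr_ge0 expR_ge1Dx.
have h : expR (- d) <= (1 + d)^-1.
  by rewrite expRN lef_pV2 ?posrE ?expR_gt0 ?expR_ge1Dx//; lra.
have h2 : (1 + d)^-1 <= 1 - d + d ^+ 2.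
  rewrite -[leLHS]mul1r ler_pdivrMr; last lra.
  have -> : (1 - d + d ^+ 2) * (1 + d) = 1 + d ^+ 3 by ring.
  by rewrite lerDl exprn_ge0.
lra.
Qed.

(** * The central limit theorem for wave sums *)

Section clt.
Context (R : realType) (m : nat).
Local Notation V := 'rV[R]_m.
Local Notation BV := (BorelRm R m).
Variable (rr : nat -> V).
Hypothesis rr_ind : forall (k : nat) (c : 'I_k -> rat),
  \sum_(i < k) ratr (c i) *: rr i = 0 -> forall i, c i = 0.

Definition intspan (n : nat) : set V :=
  [set v | exists c : nat -> int, v = \sum_(i < n) (c i)%:~R *: rr i].

Lemma intspan0 n : intspan n 0.
Proof. by exists (fun=> 0); rewrite big1// => i _; rewrite scale0r. Qed.

Lemma intspanD n v w : intspan n v -> intspan n w -> intspan n (v + w).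
Proof.
move=> [c ->] [c' ->]; exists (fun i => c i + c' i); rewrite -big_split/=.
by apply: eq_bigr => i _; rewrite rmorphD scalerDl.
Qed.

Lemma intspanN n v : intspan n v -> intspan n (- v).
Proof.
move=> [c ->]; exists (fun i => - c i); rewrite -sumrN.
by apply: eq_bigr => i _; rewrite rmorphN scaleNr.
Qed.

Lemma intspan_gen n i : (i < n)%N -> intspan n (rr i).
Proof.
move=> ni; exists (fun j => if j == i then 1 else 0).
rewrite (bigD1 (Ordinal ni))//= eqxx scale1r big1 ?addr0// => j.
by rewrite -val_eqE/= => /negbTE ->; rewrite scale0r.
Qed.

(** Q-independence enters here: a vanishing sum would be a rational relation among the first n + 1
    frequencies whose last coefficient is z. *)
Lemma intspan_indep n v (z : int) : z != 0 -> intspan n v -> v + z%:~R *: rr n != 0.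
Proof.
move=> z0 [c ->]; apply: contra_neq z0 => h.
pose c' (i : 'I_n.+1) : rat := (if (i < n)%N then c i else z)%:~R.
have := @rr_ind n.+1 c'; rewrite big_ord_recr/= /c'/= ltnn ratr_int => /(_ _ ord_max)/=.
rewrite ltnn => H; apply/eqP; rewrite -(intr_eq0 rat); apply/eqP; apply: H.
rewrite -[RHS]h; congr (_ + _); apply: eq_bigr => i _.
by rewrite ltn_ord ratr_int.
Qed.

Definition intphases n := phases (intspan n).

Lemma intphases_set n : phase_set (intphases n).
Proof. apply: phases_set; [exact: intspan0|exact: intspanD|exact: intspanN]. Qed.

Definition theta (n : nat) (x : BV) : R := 2 * pi * dotv (rr n) x.

Lemma measurable_theta n psi : measurable_fun setT (fun x => theta n x + psi).
Proof. exact: measurable_phase. Qed.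

Variables (p q : nat -> R).

Definition wave n (x : BV) := p n * cos (theta n x) + q n * sin (theta n x).
Definition wsum n (x : BV) := \sum_(i < n) wave i x.

Lemma sin_cosB (t : R) : sin t = cos (t - pi / 2).
Proof. by rewrite cosB cos_pihalf sin_pihalf mulr0 mulr1 add0r. Qed.

Lemma trigpoly_theta n i psi : (i < n)%N ->
  trigpoly (intphases n) (fun x => cos (theta i x + psi)).
Proof.
move=> ni; apply: trigpoly_cos; exists (rr i), psi; split => //; exact: intspan_gen.
Qed.

Lemma trigpoly_wsum n : trigpoly (intphases n) (wsum n).
Proof.
have h (i : 'I_n) : trigpoly (intphases n) (wave i).
  apply: trigpolyD; apply: trigpolyZ.
    by have := trigpoly_theta 0 (ltn_ord i); under eq_fun do rewrite addr0.
  by have := trigpoly_theta (- (pi / 2)) (ltn_ord i); under eq_fun do rewrite -sin_cosB.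
exact: (trigpoly_sum (intphases_set n)).
Qed.

Lemma bmeas_wsum n : bmeas (wsum n).
Proof. exact: trigpoly_bmeas (trigpoly_wsum n). Qed.

Lemma bmeas_cos_wsum n phi : bmeas (fun x => cos (wsum n x + phi)).
Proof. by apply: bmeas_cos; apply: measurable_funD => //; exact: (bmeas_wsum n).1. Qed.

(** Asymptotic decorrelation of the n-th wave from the earlier ones. It is used for k = 1 and k = 2,
    the harmonics present in the linear and the quadratic term of the expansion. *)
Lemma mean_wsumM n phi (k : nat) psi : (0 < k)%N ->
  (fun Rad => Ex (unifB m Rad)
     (fun x => cos (wsum n x + phi) * cos (k%:R * theta n x + psi))) @ +oo --> 0.
Proof.
move=> k0.
have E Rad : Ex (unifB m Rad) (fun x => cos (wsum n x + phi) * cos (k%:R * theta n x + psi))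
  = Ex (unifB m Rad) (fun x => cos (wsum n x + phi) *
      cos (2 * pi * dotv (k%:R *: rr n) x + psi)).
  by apply: eq_Ex => x; rewrite dotvZl /theta mulrCA.
apply: (eq_cvgto E).
apply: (@mean_utrigM R m (intspan n)).
- by move=> v vn; apply: (@intspan_indep n v k%:Z) => //; rewrite eqz_nat -lt0n.
- exact: intspanN.
- exact: bmeas_cos_wsum.
- move=> e e0; exact: (cos_trigpoly_approx (intphases_set n) phi (trigpoly_wsum n) e0).
Qed.

Let b n : R := `|p n| + `|q n|.
(** Half the mean square of the n-th wave, so that the sum of the [d i] plays the role of V/2. *)
Let d n : R := (p n ^+ 2 + q n ^+ 2) / 4.

Lemma wave_le n x : `|wave n x| <= b n.
Proof.
rewrite (le_trans (ler_normD _ _))// !normrM lerD// ler_piMr//.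
  by rewrite ler_norml cos_geN1 cos_le1.
by rewrite ler_norml sin_geN1 sin_le1.
Qed.

(** One Lindeberg step. In the expansion at the earlier sum, every term that oscillates with theta n
    or 2 theta n has vanishing mean; the constant part of the halved square of the wave is [d n],
    and the remainder is of third order. *)
Lemma clt_step n phi : exists o : R -> R, o @ +oo --> 0 /\ forall Rad,
  `|Ex (unifB m Rad) (fun x => cos (wsum n.+1 x + phi)) -
    (1 - d n) * Ex (unifB m Rad) (fun x => cos (wsum n x + phi))| <=
  b n ^+ 3 + b n ^+ 4 + `|o Rad|.
Proof.
pose G phi' (k : nat) psi Rad := Ex (unifB m Rad)
   (fun x => cos (wsum n x + phi') * cos (k%:R * theta n x + psi)).
pose h := pi / 2 : R.
(* The oscillating terms: a shift by h turns cosines into sines, and the square of the wave is (p^2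
   + q^2)/2 + (p^2 - q^2)/2 cos(2 theta) + p q sin(2 theta). *)
exists (fun Rad => - p n * G (phi - h) 1%N 0 Rad - q n * G (phi - h) 1%N (- h) Rad
  - (p n ^+ 2 - q n ^+ 2) / 4 * G phi 2%N 0 Rad - p n * q n / 2 * G phi 2%N (- h) Rad).
split.
  have Z c phi' k psi : (0 < k)%N -> (fun Rad => c * G phi' k psi Rad) @ +oo --> 0.
    move=> k0; rewrite -[X in _ --> X](mulr0 c); apply: cvgM; first exact: cvg_cst.
    exact: mean_wsumM.
  have -> : 0 = 0 - 0 - 0 - 0 :> R by rewrite !subr0.
  by apply: cvgB; [apply: cvgB; [apply: cvgB|]|]; exact: Z.
move=> Rad; set E := Ex (unifB m Rad).
have bG phi' (k : nat) psi : bmeas (fun x => cos (wsum n x + phi') * cos (k%:R * theta n x + psi)).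
  apply: bmeasM; first exact: bmeas_cos_wsum.
  apply: bmeas_cos; apply: measurable_funD => //; apply: measurable_funM => //.
  by have := measurable_theta n 0; under eq_fun do rewrite addr0.
pose rem x := cos (wsum n.+1 x + phi) - (1 - d n) * cos (wsum n x + phi)
  - (- p n * (cos (wsum n x + (phi - h)) * cos (1%:R * theta n x + 0))
     - q n * (cos (wsum n x + (phi - h)) * cos (1%:R * theta n x + - h))
     - (p n ^+ 2 - q n ^+ 2) / 4 * (cos (wsum n x + phi) * cos (2%:R * theta n x + 0))
     - p n * q n / 2 * (cos (wsum n x + phi) * cos (2%:R * theta n x + - h))).
have remE x : `|rem x| <= b n ^+ 3 + b n ^+ 4.
  have bx := wave_le n x.
  have := cosD_taylor (wsum n x + phi) (wave n x).
  move=> H; apply: (@le_trans _ _ (`|wave n x| ^+ 3 + `|wave n x| ^+ 4)); last first.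
    by rewrite lerD// lerXn2r// nnegrE (le_trans _ bx).
  move: H; congr (`|_| <= _); rewrite /rem.
  have -> : wsum n.+1 x + phi = wsum n x + phi + wave n x.
    by rewrite /wsum big_ord_recr/=; ring.
  have -> : cos (wsum n x + (phi - h)) = sin (wsum n x + phi) by rewrite addrA -sin_cosB.
  have -> : cos (1 * theta n x - h) = sin (theta n x) by rewrite mul1r -sin_cosB.
  have -> : cos (2 * theta n x - h) = 2 * sin (theta n x) * cos (theta n x).
    by rewrite -sin_cosB mulr_natl mulr2n sinD; ring.
  have -> : cos (2 * theta n x + 0) = cos (theta n x) ^+ 2 - sin (theta n x) ^+ 2.
    by rewrite addr0 mulr_natl mulr2n cosD; ring.
  rewrite mul1r addr0 /wave /d.
  move: (cos (_ + _ + _)) (cos2Dsin2 (theta n x)) => Z.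
  move: (cos (theta n x)) (sin (theta n x)) (cos (wsum n x + phi)) (sin (wsum n x + phi)).
  (* Writing p^2 + q^2 as (p^2 + q^2)(c^2 + s^2) turns the claim into a polynomial identity. *)
  move=> c s C S cs; rewrite -[X in (1 - X / 4)]mulr1 -[X in (1 - _ * X / 4)]cs.
  by field.
have brem : bmeas rem.
  apply: bmeasB; first by apply: bmeasB; [|apply: bmeasZ]; exact: bmeas_cos_wsum.
  by apply: bmeasB; [apply: bmeasB; [apply: bmeasB|]|]; apply: bmeasZ.
have -> : E (fun x => cos (wsum n.+1 x + phi)) -
    (1 - d n) * E (fun x => cos (wsum n x + phi)) = E rem +
   (- p n * G (phi - h) 1%N 0 Rad - q n * G (phi - h) 1%N (- h) Rad
  - (p n ^+ 2 - q n ^+ 2) / 4 * G phi 2%N 0 Rad - p n * q n / 2 * G phi 2%N (- h) Rad).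
  have bZ c phi' k psi : bmeas (fun x => c * (cos (wsum n x + phi') * cos (k%:R * theta n x + psi))).
    exact: bmeasZ.
  have bZ' c phi' k : bmeas (fun x => c * cos (wsum k x + phi')).
    by apply: bmeasZ; exact: bmeas_cos_wsum.
  rewrite /rem /E ExB; last 2 first.
  - by apply: bmeasB => //; exact: bmeas_cos_wsum.
  - by do 3 (apply: bmeasB => //).
  rewrite ExB; [|exact: bmeas_cos_wsum|exact: bZ'].
  rewrite ExZ; last exact: bmeas_cos_wsum.
  rewrite ExB; last 2 first.
  - by do 2 (apply: bmeasB => //).
  - exact: bZ.
  rewrite ExB; last 2 first.
  - by do 1 (apply: bmeasB => //).
  - exact: bZ.
  rewrite ExB; [|exact: bZ..].
  by rewrite !ExZ// subrK.
by rewrite (le_trans (ler_normD _ _))// lerD2r; exact: normr_Ex.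
Qed.

(** The errors of the single steps simply add up, because the factor 1 - [d n] lies in [0, 1].
    Replacing it by expR(- [d n]) costs [d n]^2, and eta absorbs the oscillating terms, whose size
    depends on [Rad]. *)
Lemma clt n phi (eta : R) : (forall i, d i <= 1) -> 0 < eta ->
  \forall Rad \near +oo,
  `|Ex (unifB m Rad) (fun x => cos (wsum n x + phi)) -
    expR (- \sum_(i < n) d i) * cos phi| <=
  \sum_(i < n) (b i ^+ 3 + b i ^+ 4 + d i ^+ 2) + eta.
Proof.
move=> d1; elim: n eta => [eta eta0|n IH eta eta0].
  near=> Rad; rewrite !big_ord0 oppr0 expR0 mul1r add0r.
  rewrite (_ : (fun x => _) = fun=> cos phi); last first.
    by apply/funext => x; rewrite /wsum big_ord0 add0r.
  by rewrite Ex_cst subrr normr0 ltW.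
have [er [er0 her]] := clt_step n phi.
have e2 : 0 < eta / 2 by rewrite divr_gt0.
have H1 := IH _ e2.
have /cvgr0Pnorm_le/(_ _ e2) H2 := er0.
move: H1 H2; apply: filterS2 => Rad H1 H2.
have := her Rad; rewrite !big_ord_recr/= opprD expRD.
have dn0 : 0 <= d n by rewrite divr_ge0// addr_ge0// sqr_ge0.
have H3 := expR_taylor1 dn0.
move: H1 H2 H3; set x := Ex _ _; set y := Ex _ _; set s := \sum_(i < n) (_ + _).
set D := expR (- \sum_(i < n) d i).
move=> H1 H2 H3 H4.
have D1 : `|D * cos phi| <= 1.
  rewrite normrM -[leRHS]mulr1 ler_pM//; last by rewrite ler_norml cos_geN1 cos_le1.
  rewrite ger0_norm ?expR_ge0// -[leRHS]expR0 ler_expR oppr_le0.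
  by apply: sumr_ge0 => i _; rewrite divr_ge0// addr_ge0// sqr_ge0.
have -> : y - D * expR (- d n) * cos phi =
  (y - (1 - d n) * x) + (1 - d n) * (x - D * cos phi) - D * cos phi * (expR (- d n) - (1 - d n)) by ring.
have h2 : `|(1 - d n) * (x - D * cos phi)| <= s + eta / 2.
  rewrite normrM (le_trans _ H1)// ler_piMl// ger0_norm; last by have := d1 n; lra.
  by lra.
have h3 : `|D * cos phi * (expR (- d n) - (1 - d n))| <= d n ^+ 2.
  by rewrite normrM -[leRHS]mul1r ler_pM.
rewrite (le_trans (ler_normB _ _))//.
have := ler_normD (y - (1 - d n) * x) ((1 - d n) * (x - D * cos phi)).
by move: h2 h3 H4 H2; lra.
Unshelve. all: by end_near. Qed.

End clt.

(** * Characteristic function of a Gaussian variable *)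

Section gaussian.
Context (R : realType) (sigma : R).
Hypothesis s0 : sigma != 0.
Local Notation mu := (@lebesgue_measure R).
Local Notation N := (normal_prob 0 sigma).
Local Notation pdf := (normal_pdf 0 sigma).

(** Change of variables by the Radon-Nikodym derivative, which equals the density almost everywhere
    since both have the same integral over every measurable set. *)
Lemma integral_normal_prob (f : R -> \bar R) U : measurable U ->
  N.-integrable U f ->
  (\int[N]_(x in U) f x = \int[mu]_(x in U) (f x * (pdf x)%:E))%E.
Proof.
move=> mU intf; have mf := measurable_int _ intf.
have dom := normal_prob_dominates 0 sigma.
rewrite -(Radon_Nikodym_change_of_variables dom)//=.
apply: ae_eq_integral => //.
- apply: emeasurable_funM => //; apply: (measurable_int mu).
  apply: (integrableS _ _ (@subsetT _ _)) => //=.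
  exact: Radon_Nikodym_integrable.
- apply: emeasurable_funM => //=; apply/measurableT_comp => //=.
  by apply/measurable_funTS; exact: measurable_normal_pdf.
- apply: ae_eqe_mul2l => /=.
  rewrite Radon_NikodymE//=.
  case: cid => /= h [h1 h2 h3].
  apply: integral_ae_eq => //=.
  + exact: integrableS h2.
  + by apply/measurable_funTS/measurableT_comp => //; exact: measurable_normal_pdf.
  + by move=> E E01 mE; rewrite -h3.
Qed.

Lemma is_derive_normal_pdf (x : R) :
  is_derive x 1 pdf (- (x / sigma ^+ 2) * pdf x).
Proof.
rewrite normal_pdfE//= /normal_fun.
have -> : (fun x : R => normal_peak sigma * expR (- (x - 0) ^+ 2 / (sigma ^+ 2 *+ 2))) =
          (fun x : R => normal_peak sigma * expR (- (sigma ^+ 2 *+ 2)^-1 * x ^+ 2)).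
  by apply/funext => y; rewrite subr0; congr (_ * expR _); ring.
apply: is_derive_eq.
rewrite /GRing.scale/= subr0.
have -> : - x ^+ 2 / (sigma ^+ 2 *+ 2) = - (sigma ^+ 2 *+ 2)^-1 * x ^+ 2 by ring.
by field.
Qed.

(** From y < exp y with y = x^2 / (2 sigma^2). Quadratic decay is enough to kill boundary terms of
    linear growth. *)
Lemma normal_pdf_decay (x : R) : 0 < x -> pdf x <= normal_peak sigma * (2 * sigma ^+ 2) / x ^+ 2.
Proof.
move=> x0; rewrite normal_pdfE//= /normal_fun subr0 -mulrA ler_wpM2l ?normal_peak_ge0//.
have s20 : 0 < sigma ^+ 2 by rewrite exprn_even_gt0.
have -> : - x ^+ 2 / (sigma ^+ 2 *+ 2) = - (x ^+ 2 / (2 * sigma ^+ 2)).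
  by rewrite mulNr mulr_natl.
have y0 : 0 < x ^+ 2 / (2 * sigma ^+ 2) by rewrite divr_gt0 ?exprn_gt0// mulr_gt0.
rewrite expRN -[leRHS]invrK lef_pV2 ?posrE ?expR_gt0 ?invr_gt0//; last first.
  by rewrite divr_gt0 ?exprn_gt0// mulr_gt0.
rewrite invf_div (le_trans _ (expR_ge1Dx _))//; lra.
Qed.

Lemma normal_pdf_sym (x : R) : pdf (- x) = pdf x.
Proof. by rewrite normal_pdfE//= /normal_fun !subr0 sqrrN. Qed.

(* Stein's identity; the interval [-n,n] is used to apply the fundamental
   theorem of calculus to h * pdf, whose boundary values tend to 0. *)
Lemma stein (h h' : R -> R) (A : R) :
  (forall x : R, is_derive x 1 h (h' x)) -> continuous h' ->
  (forall x, `|h x| <= A * (1 + `|x|)) -> (forall x, `|h' x| <= A) ->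
  N.-integrable setT (fun x => (x ^+ 2)%:E) ->
  (\int[N]_x (sigma ^+ 2 * h' x - x * h x)%:E = 0)%E.
Proof.
move=> hh ch' hA h'A int2.
have A0 : 0 <= A by rewrite (le_trans _ (h'A 0)).
pose k x := sigma ^+ 2 * h' x - x * h x.
have ch : continuous h.
  move=> x; apply: differentiable_continuous; apply/derivable1_diffP.
  by have [] := hh x.
have ck : continuous k.
  move=> x; rewrite /k; apply: cvgB; apply: cvgM;
    [exact: cvg_cst|exact: ch'|exact: cvg_id|exact: ch].
have mk : measurable_fun setT k by exact: continuous_measurable_fun.
pose g x : R := A * sigma ^+ 2 + A + 2 * A * x ^+ 2.
have kg x : `|k x| <= g x.
  rewrite /k /g (le_trans (ler_normB _ _))// (normrM (sigma ^+ 2)) (normrM x) (ger0_norm (sqr_ge0 sigma)) -addrA lerD//.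
    by rewrite mulrC ler_wpM2r ?sqr_ge0.
  rewrite (le_trans (ler_wpM2l (normr_ge0 x) (hA x)))//.
  rewrite -[x ^+ 2]real_normK ?num_real//; move: `|x| (normr_ge0 x) => y y0.
  have -> : y * (A * (1 + y)) = A * (y + y ^+ 2) by ring.
  have -> : A + 2 * A * y ^+ 2 = A * (1 + 2 * y ^+ 2) by ring.
  rewrite ler_wpM2l//; have := sqr_ge0 (y - 1); rewrite sqrrB; lra.
have intg : N.-integrable setT (EFin \o g).
  rewrite /g; have -> : EFin \o (fun x => A * sigma ^+ 2 + A + 2 * A * x ^+ 2) =
    (fun x => (A * sigma ^+ 2 + A)%:E + (2 * A)%:E * (x ^+ 2)%:E)%E by [].
  apply: integrableD => //; last exact: integrableZl.
  by apply: (bmeas_integrable N (bmeas_cst _ _)).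
have intk : N.-integrable setT (EFin \o k).
  apply: le_integrable intg => //; first exact/measurable_EFinP.
  move=> x _ /=; rewrite lee_fin (le_trans (kg x))//.
  exact: ler_norm.
pose I n : set R := `[- n.+1%:R, n.+1%:R]%classic.
have mI n : measurable (I n : set (measurableTypeR R)) by exact: measurable_itv.
have part n : (\int[N]_(x in I n) (k x)%:E =
    (sigma ^+ 2 * (h n.+1%:R - h (- n.+1%:R)) * pdf n.+1%:R)%:E)%E.
  have intkn : N.-integrable (I n) (fun x => (k x)%:E).
    exact: integrableS measurableT (mI n) (@subsetT _ _) intk.
  rewrite (integral_normal_prob (mI n) intkn).
  have nn : - n.+1%:R < n.+1%:R :> R by rewrite gtrN.
  (* An antiderivative of [k x * pdf x], because the derivative of the density is -(x / sigma^2)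
     times the density. *)
  pose H (x : R) := sigma ^+ 2 * (h x * pdf x).
  have dH (x : R) : is_derive x 1 H (k x * pdf x).
    have := is_derive_normal_pdf x => d1.
    apply: is_derive_eq; rewrite /GRing.scale/= /k; field; exact: s0.
  have cH : continuous H.
    move=> x; apply: differentiable_continuous; apply/derivable1_diffP.
    by have [] := dH x.
  transitivity ((H n.+1%:R)%:E - (H (- n.+1%:R))%:E)%E; last first.
    by rewrite -EFinB /H normal_pdf_sym; congr EFin; ring.
  rewrite -(@continuous_FTC2 _ (fun x => k x * pdf x))//.
  - apply: continuous_subspaceT => x.
    by apply: continuousM; [exact: ck|exact: continuous_normal_pdf].
  - split.
    + by move=> x _; have [] := dH x.
    + exact/cvg_at_right_filter/cH.
    + exact/cvg_at_left_filter/cH.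
  - by move=> x _; rewrite derive1E; exact: derive_val.
have lim1 : (fun n => (\int[N]_(x in I n) (k x)%:E)%E) @ \oo --> (\int[N]_x (k x)%:E)%E.
  have [||||_ _] := @dominated_convergence _ _ _ N _ measurableT
     (fun n => (EFin \o k) \_ (I n)) (EFin \o k) (EFin \o g) _ _ _ intg.
  - move=> n; apply/(measurable_restrictT _ (mI n))/measurable_funTS.
    exact/measurable_EFinP.
  - exact/measurable_EFinP.
  - apply: aeW => x _; apply: cvg_near_cst; near=> n.
    rewrite patchE ifT// inE /I/= in_itv/= -ler_norml ltW//.
    rewrite (@lt_trans _ _ n%:R) ?ltr_nat//.
    by near: n; exact: nbhs_infty_gtr.
  - apply: aeW => x n _; rewrite patchE; case: ifP => _ /=.
      by rewrite lee_fin.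
    by rewrite lee_fin normr0 (le_trans _ (kg x)).
  have -> : (fun n => \int[N]_(x in I n) (k x)%:E)%E =
      (fun n => \int[N]_x ((EFin \o k) \_ (I n)) x)%E.
    by apply/funext => n; rewrite [LHS]integral_mkcond.
  exact.
have lim0 : (fun n => (\int[N]_(x in I n) (k x)%:E)%E) @ \oo --> 0%E.
  rewrite (_ : (fun n => _) =
      EFin \o (fun n => sigma ^+ 2 * (h n.+1%:R - h (- n.+1%:R)) * pdf n.+1%:R)); last first.
    by apply/funext => n; exact: part.
  apply: cvg_EFin; first by near=> n.
  apply/cvgr0Pnorm_le => e e0.
  (* With y = n + 1, the boundary term is at most C (1 + y) / y^2, hence at most 2 C / y. *)
  pose C := sigma ^+ 2 * (2 * A) * (normal_peak sigma * (2 * sigma ^+ 2)).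
  near=> n.
  have C0 : 0 <= C.
    rewrite /C; move: (sigma ^+ 2) (normal_peak sigma) (sqr_ge0 sigma) (normal_peak_ge0 sigma).
    by move=> u v u0 v0; rewrite !mulr_ge0.
  have n0 : 0 < n.+1%:R :> R by [].
  have hn : `|h n.+1%:R - h (- n.+1%:R)| <= 2 * A * (1 + n.+1%:R).
    rewrite (le_trans (ler_normB _ _))//.
    have -> : 2 * A * (1 + n.+1%:R) = A * (1 + n.+1%:R) + A * (1 + n.+1%:R) by ring.
    have := hA n.+1%:R; have := hA (- n.+1%:R).
    by rewrite normrN (gtr0_norm n0) => h1 h2; exact: lerD.
  rewrite /= normrM (normrM (sigma ^+ 2)) (ger0_norm (sqr_ge0 sigma)) (ger0_norm (normal_pdf_ge0 _ _ _)).
  apply: (@le_trans _ _ (C * (2 / n.+1%:R))).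
    set y : R := n.+1%:R in n0 hn *.
    have y1 : 1 <= y by rewrite ler1n.
    apply: (@le_trans _ _ (sigma ^+ 2 * (2 * A * (1 + y)) * (normal_peak sigma * (2 * sigma ^+ 2) / y ^+ 2))).
      rewrite ler_pM ?normal_pdf_ge0//; first by apply: mulr_ge0; rewrite ?sqr_ge0.
        by rewrite ler_wpM2l ?sqr_ge0.
      exact: normal_pdf_decay.
    rewrite [leLHS](_ : _ = C * ((1 + y) / y ^+ 2)); last by rewrite /C; ring.
    rewrite ler_wpM2l// ler_pdivrMr ?exprn_gt0//.
    have -> : 2 / y * y ^+ 2 = 2 * y by field; rewrite gt_eqF.
    by lra.
  rewrite mulrA ler_pdivrMr//.
  rewrite -ler_pdivrMl// (@le_trans _ _ n%:R) ?ler_nat//.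
  by near: n; exact: nbhs_infty_ger.
by apply: (cvg_unique _ lim1 lim0).
Unshelve. all: by end_near. Qed.

Lemma is_derive_affine_cos (a c x : R) :
  is_derive x 1 (fun x : R => cos (a * x + c)) (- (a * sin (a * x + c))).
Proof.
by apply: is_derive_eq; rewrite /GRing.scale/=; ring.
Qed.

Lemma is_derive_affine_sin (a c x : R) :
  is_derive x 1 (fun x : R => sin (a * x + c)) (a * cos (a * x + c)).
Proof.
by apply: is_derive_eq; rewrite /GRing.scale/=; ring.
Qed.

Hypothesis int2 : N.-integrable setT (fun x => (x ^+ 2)%:E).

(** Stein's identity for h = id. Square integrability is assumed in this section; for the field it
    is later read off from the finite covariance. *)
Lemma normal_second_moment : (\int[N]_x (x ^+ 2)%:E = (sigma ^+ 2)%:E)%E.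
Proof.
have h1 : forall x : R, `|x| <= 1 * (1 + `|x|) by move=> x; rewrite mul1r lerDr.
have h2 : R -> `|1 : R| <= 1 by rewrite normr1.
have h3 : continuous (fun _ : R => 1 : R) by move=> x; exact: cvg_cst.
have := @stein id (fun=> 1) 1 (fun x => is_derive_id x 1) h3 h1 h2 int2.
under eq_integral do rewrite mulr1 -expr2 EFinB.
rewrite integralB//; last first.
  by apply: (bmeas_integrable N (bmeas_cst _ _)).
rewrite integral_cst//= probability_setT mule1 => h.
have fi : (\int[N]_x (x ^+ 2)%:E)%E \is a fin_num by exact: integrable_fin_num.
move: h; rewrite -(fineK fi) -EFinB => /eqP; rewrite eqe subr_eq0 => /eqP <-.
by [].
Qed.

(** The function g(t) = E cos(t Y + phi) satisfies g' = - sigma^2 t g, by differentiation under the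
    integral and Stein's identity for sin(t y + phi). So g(t) exp(sigma^2 t^2 / 2) is constant, and
    its values at 0 and 1 are compared. *)
Lemma normal_char (phi : R) :
  Ex N (fun x => cos (x + phi)) = expR (- (sigma ^+ 2 / 2)) * cos phi.
Proof.
pose f (t y : R) := cos (t * y + phi).
pose g (t : R) := \int[N]_y f t y.
have bf t : bmeas (f t).
  by apply: bmeas_cos; apply: measurable_funD => //; exact: measurable_funM.
have d1 t y : partial1of2 f t y = - (y * sin (t * y + phi)).
  rewrite partial1of2E /f.
  have -> : (fun t => cos (t * y + phi)) = (fun t => cos (y * t + phi)).
    by apply/funext => u; rewrite mulrC.
  by rewrite (@derive_val _ _ _ _ _ _ _ (is_derive_affine_cos y phi t)) [t * y]mulrC.
have intabs : N.-integrable setT (EFin \o (fun y : R => `|y|)).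
  have h1 : N.-integrable setT (EFin \o (fun x : R => 1 + x ^+ 2)).
    have -> : EFin \o (fun x : R => 1 + x ^+ 2) = (fun x => 1%:E + (x ^+ 2)%:E)%E by [].
    apply: integrableD => //.
    by apply: (bmeas_integrable N (bmeas_cst _ _)).
  apply: le_integrable h1 => //.
    by apply/measurable_EFinP; exact: measurableT_comp.
  move=> x _ /=; rewrite lee_fin normr_id [leRHS]ger0_norm ?addr_ge0 ?sqr_ge0//.
  rewrite -[x ^+ 2]real_normK ?num_real//.
  by have := sqr_ge0 (`|x| - 1); rewrite sqrrB; have := normr_ge0 x; lra.
have dg (t : R) : is_derive t 1 g (- (sigma ^+ 2 * t) * g t).
  have ht : `](t - 1)%R, (t + 1)%R[%classic t by rewrite /= in_itv/=; apply/andP; split; lra.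
  have hi (x : R) : `](t - 1)%R, (t + 1)%R[%classic x -> N.-integrable setT (EFin \o f x).
    by move=> _; exact: (bmeas_integrable N (bf x)).
  have hd (x y : R) : `](t - 1)%R, (t + 1)%R[%classic x -> setT y -> derivable (f^~ y) x 1.
    move=> _ _; rewrite /f.
    have -> : (fun t => cos (t * y + phi)) = (fun t => cos (y * t + phi)).
      by apply/funext => u; rewrite mulrC.
    by have [] := is_derive_affine_cos y phi x.
  have hG (x y : R) : `](t - 1)%R, (t + 1)%R[%classic x -> setT y -> `|partial1of2 f x y| <= `|y|.
    move=> _ _; rewrite d1 normrN normrM ler_piMr//.
    by rewrite ler_norml sin_geN1 sin_le1.
  have G0 (y : R) : 0 <= `|y| by [].
  apply: DeriveDef; first exact: (derivable_under_integral measurableT ht hi hd G0 intabs hG).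
  rewrite -derive1E (differentiation_under_integral measurableT ht hi hd G0 intabs hG).
  have := @stein (fun x => sin (t * x + phi)) (fun x => t * cos (t * x + phi)) (1 + `|t|).
  move=> /(_ (is_derive_affine_sin t phi)).
  have c1 : continuous (fun x : R => t * cos (t * x + phi)).
    move=> x; apply: cvgM; first exact: cvg_cst.
    apply: (cvg_comp (fun x => t * x + phi) cos); last exact: continuous_cos.
    by apply: cvgD; [apply: cvgM; [exact: cvg_cst|exact: cvg_id]|exact: cvg_cst].
  have c2 (x : R) : `|sin (t * x + phi)| <= (1 + `|t|) * (1 + `|x|).
    rewrite (@le_trans _ _ 1) ?ler_norml ?sin_geN1 ?sin_le1//.
    by rewrite mulrDr mulr1 -addrA lerDl addr_ge0// mulr_ge0// addr_ge0.
  have c3 (x : R) : `|t * cos (t * x + phi)| <= 1 + `|t|.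
    rewrite normrM (@le_trans _ _ `|t|) ?lerDr// ler_piMr//.
    by rewrite ler_norml cos_geN1 cos_le1.
  move=> /(_ c1 c2 c3 int2) st.
  have intx : N.-integrable setT (EFin \o (fun x => x * sin (t * x + phi))).
    apply: le_integrable intabs => //.
      apply/measurable_EFinP; apply: measurable_funM => //.
      apply: (@measurableT_comp _ _ _ _ _ _ sin).
        by apply: continuous_measurable_fun; exact: continuous_sin.
      by apply: measurable_funD => //; exact: measurable_funM.
    move=> x _ /=; rewrite lee_fin normr_id normrM ler_piMr//.
    by rewrite ler_norml sin_geN1 sin_le1.
  have E : \int[N]_y (sigma ^+ 2 * (t * cos (t * y + phi)) - y * sin (t * y + phi)) = 0.
    by rewrite /Rintegral st.
  under eq_Rintegral do rewrite d1 -mulN1r.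
  rewrite RintegralZl// mulN1r.
  move: E; rewrite RintegralB//; last first.
    exact: (bmeas_integrable N (bmeasZ _ (bmeasZ _ (bf t)))).
  under eq_Rintegral do rewrite mulrA.
  rewrite RintegralZl//; last exact: (bmeas_integrable N (bf t)).
  by move=> /eqP; rewrite subr_eq0 => /eqP <-; rewrite /g mulNr.
pose G (t : R) := g t * expR (sigma ^+ 2 / 2 * t ^+ 2).
have dG (t : R) : is_derive t 1 G 0.
  have := dg t => dgt; apply: is_derive_eq; rewrite /GRing.scale/=; field; done.
have := is_derive_0_is_cst 1 0 dG.
rewrite /G expr1n mulr1 expr0n/= mulr0 expR0 mulr1 => G10.
have -> : Ex N (fun x => cos (x + phi)) = g 1.
  by rewrite /g /f /Ex; under [RHS]eq_Rintegral do rewrite mul1r.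
have -> : cos phi = g 0.
  rewrite /g /f; under eq_Rintegral do rewrite mul0r add0r.
  by rewrite -[RHS]/(Ex N (fun=> cos phi)) Ex_cst.
by rewrite -G10 mulrC -mulrA -expRD subrr expR0 mulr1.
Qed.

End gaussian.

(** A Gaussian field only promises some sigma for each linear combination; the second moment
    identifies sigma^2 with V, in the degenerate Dirac case as well. *)
Lemma gauss0_char (R : realType) d (T : measurableType d) (P : probability T R)
    (X : T -> R) (sigma V phi : R) :
  measurable_fun setT X ->
  (forall B : set R, measurable B -> P [set w | B (X w)] = gauss0 sigma B) ->
  (\int[P]_w (X w ^+ 2)%:E = V%:E)%E ->
  Ex P (fun w => cos (X w + phi)) = expR (- (V / 2)) * cos phi.
Proof.
move=> mX XB X2.
have msq : measurable_fun setT (fun x : R => (x ^+ 2)%:E).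
  by apply/measurable_EFinP; exact: measurable_funX.
have mX' : measurable_fun setT (X : T -> measurableTypeR R) by [].
have [Q QE] : exists Q : probability (measurableTypeR R) R, forall B, Q B = gauss0 sigma B.
  rewrite /gauss0; case: eqP => _; first by exists (@dirac _ (measurableTypeR R) (0 : R) R).
  by exists (normal_prob 0 sigma).
have PX (f : R -> \bar R) : measurable_fun setT f -> (forall x, 0 <= f x)%E ->
    (\int[Q]_x f x = \int[P]_w f (X w))%E.
  move=> mf f0; pose pf := pushforward P (X : T -> measurableTypeR R) : measure (measurableTypeR R) R.
  rewrite (eq_measure_integral (pf mX')); last by move=> A mA _; exact: (etrans (QE A) (esym (XB A mA))).
  by rewrite (ge0_integral_pushforward mX').
have bX : bmeas (fun w => cos (X w + phi)).
  by apply: bmeas_cos; exact: measurable_funD.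
have bQ : bmeas (fun x : measurableTypeR R => cos (x + phi)).
  by apply: bmeas_cos; exact: measurable_funD.
have EPQ : Ex P (fun w => cos (X w + phi)) = Ex Q (fun x => cos (x + phi)).
  (* Adding 1 makes the integrand nonnegative, as the transfer [PX] requires. *)
  have : Ex P (fun w => 1 + cos (X w + phi)) = Ex Q (fun x => 1 + cos (x + phi)).
    apply: EFin_inj; rewrite -!Ex_EFin; try by apply: bmeasD => //; exact: bmeas_cst.
    rewrite (PX (fun x => (1 + cos (x + phi))%:E))//.
      by apply/measurable_EFinP; apply: measurable_funD => //; exact: bQ.1.
  by rewrite !ExD ?Ex_cst//; [exact: addrI|exact: bmeas_cst..].
have Q2 : (\int[Q]_x (x ^+ 2)%:E = V%:E)%E.
  by rewrite PX// => x; rewrite lee_fin sqr_ge0.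
rewrite EPQ.
have [s0|s0] := eqVneq sigma 0.
  have QD A : measurable A -> A `<=` setT -> Q A = @dirac _ (measurableTypeR R) (0 : R) R A.
    by move=> _ _; rewrite (QE A) /gauss0 s0 eqxx.
  have -> : Ex Q (fun x => cos (x + phi)) = cos phi.
    rewrite /Ex /Rintegral (eq_measure_integral _ QD) integral_dirac//=.
      by rewrite indicE in_setT mul1r add0r.
    by apply/measurable_EFinP; exact: bQ.1.
  have -> : V = 0.
    apply: EFin_inj; rewrite -Q2 (eq_measure_integral _ QD) integral_dirac//=.
    by rewrite expr0n/= mule0.
  by rewrite mul0r oppr0 expR0 mul1r.
have QN A : measurable A -> A `<=` setT -> Q A = normal_prob 0 sigma A.
  by move=> _ _; rewrite (QE A) /gauss0 (negbTE s0).
have -> : Ex Q (fun x => cos (x + phi)) = Ex (normal_prob 0 sigma) (fun x => cos (x + phi)).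
  by rewrite /Ex /Rintegral (eq_measure_integral _ QN).
have int2 : (normal_prob 0 sigma).-integrable setT (fun x : R => (x ^+ 2)%:E).
  apply/integrableP; split => //.
  under eq_integral do rewrite /= ger0_norm ?sqr_ge0//.
  by rewrite -(eq_measure_integral _ QN) Q2 ltry.
rewrite normal_char//.
have := normal_second_moment s0 int2.
by rewrite -(eq_measure_integral _ QN) Q2 => -[->].
Qed.

(** * The space C^s of the ball *)

Section multi_index.
Context (R : realType) (m : nat).
Local Notation V := 'rV[R]_m.
Implicit Types (al : 'I_m -> nat) (f g : V -> R).

Let dl al (l : seq 'I_m) f := foldr (fun i g => iter (al i) (partial i) g) f l.

Definition mi_pred al i : 'I_m -> nat := fun j => if j == i then (al i).-1 else al j.

Let dl_pred_notin al i l f : i \notin l -> dl (mi_pred al i) l f = dl al l f.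
Proof.
elim: l => //= j l IH; rewrite inE negb_or => /andP[ij il].
by rewrite IH// /mi_pred eq_sym (negbTE ij).
Qed.

Let dl_pred al l : uniq l -> (exists2 i, i \in l & (0 < al i)%N) ->
  exists2 i, (0 < al i)%N & forall f, dl al l f = partial i (dl (mi_pred al i) l f).
Proof.
elim: l => [_ [] // | j l IH /= /andP[jl ul] [k0 +]].
have [aj|aj] := posnP (al j); last first.
  move=> _ _; exists j => // f; rewrite dl_pred_notin// /mi_pred eqxx.
  by rewrite -iterS prednK.
rewrite inE => /orP[/eqP ->|kl ak0]; first by rewrite aj.
have [|k ak hk] := IH ul; first by exists k0.
exists k => // f; rewrite aj/= hk.
by have -> : mi_pred al k j = 0%N by rewrite /mi_pred; case: eqP => [<-|//]; rewrite aj.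
Qed.

Lemma mi_order0 al f : mi_order al = 0%N -> dalpha al f = f.
Proof.
move=> /eqP; rewrite /mi_order sum_nat_eq0 => /forallP al0.
rewrite /dalpha; elim: (enum 'I_m) => //= i l ->.
by have /eqP -> := al0 i.
Qed.

(* In [dalpha al] the outermost derivative is the first coordinate of positive
   exponent, so peeling it off needs no symmetry of partial derivatives. *)
Lemma dalphaS al k : mi_order al = k.+1 ->
  exists i al', mi_order al' = k /\ forall f, dalpha al f = partial i (dalpha al' f).
Proof.
move=> alk.
have [|i ai h] := @dl_pred al (enum 'I_m) (enum_uniq _).
  apply: contrapT => h.
  have : mi_order al = 0%N.
    rewrite /mi_order big1// => i _; apply/eqP; rewrite -leqn0 leqNgt.
    by apply/negP => ai; apply: h; exists i; rewrite ?mem_enum.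
  by rewrite alk.
exists i, (mi_pred al i); split; last exact: h.
move: alk; rewrite /mi_order (bigD1 i)//= (bigD1 i (F := mi_pred al i))//=.
rewrite {1}/mi_pred eqxx -(prednK ai) addSn => -[<-]; congr (_ + _)%N.
by apply: eq_bigr => j ji; rewrite /mi_pred (negbTE ji).
Qed.

Lemma eq_dalpha (U : set V) al f g : open U -> (forall y, U y -> f y = g y) ->
  forall y, U y -> dalpha al f y = dalpha al g y.
Proof.
move=> oU fg; rewrite /dalpha.
have step (i : 'I_m) f' g' : (forall y, U y -> f' y = g' y) ->
    forall y, U y -> partial i f' y = partial i g' y.
  move=> fg' y Uy; apply: near_eq_derive; near=> z; apply: fg'.
  by near: z; exact: open_nbhs_nbhs.
elim: (enum 'I_m) => //= i l IH; elim: (al i) => //= n IHn; exact: step.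
Unshelve. all: by end_near. Qed.

End multi_index.

(** * Norm, Borel sets and regularity classes of C^s *)

Section Cs_space.
Context (R : realType) (m s : nat) (W : R) (W0 : 0 < W).
Local Notation V := 'rV[R]_m.
Local Notation B := (eball (0 : V) W).
Implicit Types (al : 'I_m -> nat) (f g p q : V -> R).
Local Notation S := (@Sset R m s W).
Local Notation nrm := (@Csnorm R m s W).

Lemma eball0 : B 0. Proof. by rewrite /eball/= subr0 enorm0. Qed.

Lemma eball_shrink (y : V) (c : R) : 0 <= c -> c <= 1 -> B y -> B (c *: y).
Proof.
rewrite /eball/= !subr0 => c0 c1; apply: le_lt_trans.
by rewrite enormZ ger0_norm// ler_piMl ?enorm_ge0.
Qed.

(** Restricted to the open ball, where the derivatives are known to exist; the induction peels off
    the outermost one with [dalphaS]. *)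
Lemma dalpha_lin al (c : R) f g : S f -> S g -> (mi_order al <= s)%N ->
  (forall y, B y -> dalpha al (fun z => f z + c * g z) y = dalpha al f y + c * dalpha al g y).
Proof.
move=> Sf Sg; move Ek : (mi_order al) => k; elim: k al Ek => [|k IH] al alk als y By.
  by rewrite !mi_order0.
have [i [al' [al'k E]]] := dalphaS R alk.
have [_ _ df _] := Sf; have [_ _ dg _] := Sg.
have al's : (mi_order al' < s)%N by rewrite al'k.
rewrite !E /partial (near_eq_derive (g := dalpha al' f + c *: dalpha al' g)).
  have h1 := df al' i al's y By; have h2 := dg al' i al's y By.
  by rewrite (deriveD h1 (derivableZ (k := c) h2)) (deriveZ c h2).
near=> z; apply: IH => //; first exact: ltnW.
by near: z; apply: open_nbhs_nbhs; split => //; exact: open_eball.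
Unshelve. all: by end_near. Qed.

Lemma dalphaB al f g : S f -> S g -> (mi_order al <= s)%N ->
  (forall y, B y -> dalpha al (fun z => f z - g z) y = dalpha al f y - dalpha al g y).
Proof.
move=> Sf Sg als y By; rewrite -mulN1r -dalpha_lin//.
by congr (dalpha al _ y); apply/funext => z; rewrite mulN1r.
Qed.

Lemma SsetB f g : S f -> S g -> S (fun z => f z - g z).
Proof.
move=> Sf Sg; have [f0 cf df uf] := Sf; have [g0 cg dg ug] := Sg; split.
- by move=> y yB; rewrite f0// g0// subrr.
- by move=> y; apply: continuousB; [exact: cf|exact: cg].
- move=> al i als y By.
  apply: (@near_eq_derivable _ _ _ (dalpha al f - dalpha al g)).
    near=> z; rewrite dalphaB// ?(ltnW als)//; near: z; apply: open_nbhs_nbhs; split => //.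
    exact: open_eball.
  by apply: derivableB; [exact: df|exact: dg].
- move=> al als e e0; have e2 : 0 < e / 2 by rewrite divr_gt0.
  have [d1 d10 h1] := uf al als _ e2; have [d2 d20 h2] := ug al als _ e2.
  exists (Num.min d1 d2); first by rewrite lt_min d10.
  move=> y z By Bz; rewrite lt_min => /andP[yz1 yz2].
  rewrite !dalphaB// (splitr e); have := h1 y z By Bz yz1; have := h2 y z By Bz yz2.
  set a := dalpha al f y; set a' := dalpha al f z; set b := dalpha al g y.
  move=> h3 h4; have -> : a - b - (a' - dalpha al g z) = (a - a') - (b - dalpha al g z) by ring.
  by rewrite (le_lt_trans (ler_normB _ _))// ltrD.
Unshelve. all: by end_near. Qed.

(** Walk from 0 to y in n equal steps shorter than the uniform continuity radius for 1; each step
    changes the value by less than 1, and n depends on W only. *)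
Lemma dalpha_bounded f al : S f -> (mi_order al <= s)%N ->
  exists M : R, forall y, B y -> `|dalpha al f y| <= M.
Proof.
move=> [_ _ _ uf] als; have [d d0 h] := uf al als 1 ltr01.
have [n nd] : exists n : nat, W / d < n%:R.
  by have [n _ /(_ n (leqnn n))] := @nbhs_infty_gtr R (W / d); exists n.
have n0 : 0 < n%:R :> R by rewrite (lt_trans _ nd)// divr_gt0.
exists (`|dalpha al f 0| + n%:R) => y By.
have key k : (k <= n)%N -> `|dalpha al f ((k%:R / n%:R) *: y)| <= `|dalpha al f 0| + k%:R.
  elim: k => [_|k IH kn]; first by rewrite mul0r scale0r addr0.
  have inB j : (j <= n)%N -> B ((j%:R / n%:R) *: y).
    move=> jn; apply: eball_shrink => //.
    by rewrite ler_pdivrMr// mul1r ler_nat.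
  have := h _ _ (inB _ kn) (inB _ (ltnW kn)).
  rewrite -scalerBl -mulrBl -natrB// subSnn enormZ mul1r ger0_norm ?invr_ge0//.
  have -> : n%:R^-1 * enorm y < d.
    rewrite mulrC ltr_pdivrMr// (lt_trans (y := W))//.
      by move: By; rewrite /eball/= subr0.
    by rewrite mulrC -ltr_pdivrMr.
  move=> /(_ isT); have := IH (ltnW kn).
  set a := dalpha al f ((k.+1%:R / _) *: y); set b := dalpha al f ((k%:R / _) *: y).
  by move=> hb hab; have := ler_normD (a - b) b; rewrite subrK -natr1; lra.
by have := key n (leqnn n); rewrite divff ?gt_eqF// scale1r.
Qed.

Let Cset f := [set v : R | exists (al : 'I_m -> nat) (y : V),
          [/\ (mi_order al <= s)%N, B y & v = `|dalpha al f y|]].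

(** Encoding the relevant multi-indices in a finite type lets one choose a bound for each of them
    and add the bounds up. *)
Lemma mi_finite al : (mi_order al <= s)%N ->
  exists be : {ffun 'I_m -> 'I_s.+1}, forall i, be i = al i :> nat.
Proof.
move=> als; exists [ffun i => inord (al i)] => i; rewrite ffunE inordK// ltnS.
by rewrite (leq_trans _ als)// /mi_order (bigD1 i)//= leq_addr.
Qed.

(** Without a bound the supremum in [Csnorm] would be a default value; this makes it a true upper
    bound. *)
Lemma Cset_bounded f : S f -> exists M : R, forall v, Cset f v -> v <= M.
Proof.
move=> Sf.
have /choice[M hM] : forall be : {ffun 'I_m -> 'I_s.+1}, exists M : R, 0 <= M /\
    ((mi_order (fun i => be i : nat) <= s)%N ->
     forall y, B y -> `|dalpha (fun i => be i : nat) f y| <= M).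
  move=> be; have [h|h] := boolP (mi_order (fun i => be i : nat) <= s)%N; last by exists 0.
  have [M hM] := dalpha_bounded Sf h; exists M; split => //.
  by rewrite (le_trans _ (hM 0 eball0)).
exists (\sum_be M be) => _ [al [y [als By ->]]].
have [be bal] := mi_finite als.
have E : al = (fun i => be i : nat) by apply/funext.
rewrite E in als *; have [_ h] := hM be.
rewrite (le_trans (h als _ By))// (bigD1 be)//= lerDl sumr_ge0// => i _.
by have [] := hM i.
Qed.

Lemma le_Csnorm f al y : S f -> (mi_order al <= s)%N -> B y ->
  `|dalpha al f y| <= nrm f.
Proof.
move=> Sf als By; have [M hM] := Cset_bounded Sf.
apply: sup_ubound; last by exists al, y.
by exists M.
Qed.

Lemma Csnorm_le f (c : R) :
  (forall al y, (mi_order al <= s)%N -> B y -> `|dalpha al f y| <= c) -> nrm f <= c.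
Proof.
move=> h; apply: ge_sup.
  exists `|dalpha (fun=> 0%N) f 0|, (fun=> 0%N), 0; split => //; last exact: eball0.
  by rewrite /mi_order big1.
by move=> _ [al [y [als By ->]]]; exact: h.
Qed.

Lemma Csnorm_triangle f g h : S f -> S g -> S h ->
  nrm (fun y => f y - h y) <= nrm (fun y => f y - g y) + nrm (fun y => g y - h y).
Proof.
move=> Sf Sg Sh; apply: Csnorm_le => al y als By.
have := le_Csnorm (SsetB Sf Sg) als By; have := le_Csnorm (SsetB Sg Sh) als By.
rewrite !dalphaB// => h1 h2.
have -> : dalpha al f y - dalpha al h y = (dalpha al f y - dalpha al g y) +
  (dalpha al g y - dalpha al h y) by ring.
by rewrite (le_trans (ler_normD _ _))// lerD.
Qed.

Lemma SBorel_sub (A : set (V -> R)) : SBorel s W A -> A `<=` S.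
Proof.
move: A; apply: (@smallest_sub _ _ _ [set A | A `<=` S]); last by move=> U [].
split => /=; first by move=> ?.
- by move=> A _ x [].
- by move=> A hA x [n _ Anx]; exact: hA Anx.
Qed.

Lemma SBorel_open (U : set (V -> R)) : Sopen s W U -> SBorel s W U.
Proof. exact: sub_sigma_algebra. Qed.

Lemma SBorelC (A : set (V -> R)) : SBorel s W A -> SBorel s W (S `\` A).
Proof. exact: sigma_algebraCD. Qed.

Lemma SBorelI (A1 A2 : set (V -> R)) : SBorel s W A1 -> SBorel s W A2 -> SBorel s W (A1 `&` A2).
Proof.
move=> h1 h2; have s1 := SBorel_sub h1; have s2 := SBorel_sub h2.
have -> : A1 `&` A2 = S `\` \bigcup_n (if n is 0 then S `\` A1 else S `\` A2).
  apply/seteqP; split => [x [x1 x2]|x [Sx h]].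
    split; [exact: s1|by move=> [[|n] _ []]].
  split; apply: contrapT => hx; apply: h; first by exists 0.
  by exists 1.
by apply: SBorelC; apply: sigma_algebra_bigcup => -[|n]; exact: SBorelC.
Qed.

Lemma SBorel_Senl (A : set (V -> R)) (e : R) : A `<=` S -> SBorel s W (Senl s W A e).
Proof.
move=> AS; apply: SBorel_open; split; first by move=> p [].
move=> p [Sp [q Aq pq]]; exists (e - nrm (fun y => p y - q y)); first by rewrite subr_gt0.
move=> p' Sp' pp'; split => //; exists q => //.
have Sq := AS _ Aq.
by rewrite (le_lt_trans (Csnorm_triangle Sp' Sp Sq))// -ltrBrDr.
Qed.

(** Even for an uncountable family the set is closed: a violated bound stays violated nearby. The
    Lipschitz constant 2 accommodates differences of values at two points. *)
Lemma SBorel_bounded (I : Type) (D : set I) (F : I -> (V -> R) -> R) (c : R) :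
  (forall i p q, D i -> S p -> S q -> `|F i p - F i q| <= 2 * nrm (fun y => p y - q y)) ->
  SBorel s W [set p | S p /\ forall i, D i -> `|F i p| <= c].
Proof.
move=> hF.
have -> : [set p | S p /\ forall i, D i -> `|F i p| <= c] =
    S `\` [set p | S p /\ exists2 i, D i & c < `|F i p|].
  apply/seteqP; split => p [Sp h]; split => //.
    by move=> [_ [i Di]]; rewrite ltNge h.
  by move=> i Di; rewrite leNgt; apply/negP => ci; apply: h; split => //; exists i.
apply: SBorelC; apply: SBorel_open; split; first by move=> p [].
move=> p [Sp [i Di ci]]; exists ((`|F i p| - c) / 2); first by rewrite divr_gt0// subr_gt0.
move=> q Sq qp; split => //; exists i => //.
have := hF i q p Di Sq Sp; have := ler_normB (F i q) (F i q - F i p).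
by rewrite opprB addrC subrK; lra.
Qed.

(** Equicontinuity at one scale only. Finitely many such classes are intersected later, so no
    compact set is needed. *)
Definition Smod (eta delta : R) : set (V -> R) :=
  [set p | S p /\ forall al y z, (mi_order al <= s)%N -> B y -> B z ->
     enorm (y - z) < delta -> `|dalpha al p y - dalpha al p z| <= eta].

Definition Sbd (L : R) : set (V -> R) := [set p | S p /\ forall y, B y -> `|p y| <= L].

Lemma SBorel_Smod eta delta : SBorel s W (Smod eta delta).
Proof.
pose D : set (('I_m -> nat) * (V * V)) := [set i | [/\ (mi_order i.1 <= s)%N,
  B i.2.1, B i.2.2 & enorm (i.2.1 - i.2.2) < delta]].
pose Fu (i : ('I_m -> nat) * (V * V)) p := dalpha i.1 p i.2.1 - dalpha i.1 p i.2.2.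
have -> : Smod eta delta = [set p | S p /\ forall i, D i -> `|Fu i p| <= eta].
  apply/seteqP; split => p [Sp h]; split => //; first by move=> [al [y z]] [] *; exact: h.
  by move=> al y z *; apply: (h (al, (y, z))).
apply: SBorel_bounded => -[al [y z]] p q [/= als By Bz _] Sp Sq.
have := le_Csnorm (SsetB Sp Sq) als By; have := le_Csnorm (SsetB Sp Sq) als Bz.
rewrite !dalphaB// /Fu/= => h1 h2.
set a := dalpha al p y; set b := dalpha al q y; set a' := dalpha al p z.
have -> : a - a' - (b - dalpha al q z) = (a - b) - (a' - dalpha al q z) by ring.
by rewrite (le_trans (ler_normB _ _))// mulr_natl mulr2n lerD.
Qed.

Lemma SBorel_Sbd L : SBorel s W (Sbd L).
Proof.
apply: (@SBorel_bounded _ B (fun y p => p y)) => y p q By Sp Sq.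
have E0 : mi_order (fun _ : 'I_m => 0%N) = 0%N by rewrite /mi_order big1.
have := @le_Csnorm _ (fun=> 0%N) y (SsetB Sp Sq); rewrite E0 mi_order0// => /(_ isT By).
move=> h; apply: (le_trans h).
by rewrite ler_peMl ?ler1n// (le_trans _ h).
Qed.

Lemma line_derive f (v a : V) (t : R) : derivable f (a + t *: v) v ->
  is_derive t 1 (fun t : R => f (a + t *: v)) ('D_v f (a + t *: v)).
Proof.
move=> df.
have E : (fun h : R => h^-1 *: ((fun t : R => f (a + t *: v)) (h *: 1 + t) - f (a + t *: v))) =
   (fun h : R => h^-1 *: (f (h *: v + (a + t *: v)) - f (a + t *: v))).
  apply/funext => h; congr (_ *: (f _ - _)).
  by rewrite [h%:A]mulr1 scalerDl addrCA.
by split; rewrite ?/derivable /derive /= E.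
Qed.

(** A Landau-Kolmogorov argument: the mean value theorem on a segment of length delta/2 in direction
    i finds a point where the derivative of p - q is at most 4 tau / delta, and the moduli of p and
    q carry this to y at the cost 2 eta. *)
Lemma interpolation_step p q eta delta al al' i (tau : R) : S p -> S q ->
  Smod eta delta p -> Smod eta delta q -> 0 < delta -> delta <= W ->
  (mi_order al' < s)%N -> (mi_order al <= s)%N ->
  (forall f, dalpha al f = partial i (dalpha al' f)) ->
  (forall y, B y -> `|dalpha al' (fun z => p z - q z) y| <= tau) ->
  forall y, B y -> `|dalpha al (fun z => p z - q z) y| <= 4 * tau / delta + 2 * eta.
Proof.
move=> Sp Sq [_ Mp] [_ Mq] d0 dW al's als E htau y By.
pose g z := p z - q z.
have Sg : S g by exact: SsetB.
pose h := delta / 2.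
have h0 : 0 < h by rewrite divr_gt0.
(* Pulling y towards the centre makes room for the segment: |y'| < W - h while |y - y'| < h, so the
   whole segment is within 2 h = delta of y. The hypothesis delta <= W keeps the factor
   nonnegative. *)
pose y' : V := (1 - h / W) *: y.
have ny : enorm y < W by move: By; rewrite /eball/= subr0.
have hW1 : 0 <= 1 - h / W by rewrite subr_ge0 ler_pdivrMr// mul1r /h; lra.
have ny' : enorm y' <= (1 - h / W) * enorm y by rewrite enormZ ger0_norm.
have ny2 : enorm y' < W - h.
  apply: (le_lt_trans ny'); rewrite (_ : W - h = (1 - h / W) * W); last first.
    by rewrite mulrBl mul1r divfK// gt_eqF.
  rewrite ltr_pM2l//; rewrite subr_gt0 ltr_pdivrMr// mul1r /h; lra.
have yy' : enorm (y - y') < h.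
  have -> : y - y' = (h / W) *: y by rewrite /y' scalerBl scale1r opprB addrC subrK.
  rewrite enormZ ger0_norm ?divr_ge0 ?ltW// mulrAC ltr_pdivrMr// ltr_pM2l//.
have ne : enorm ('e_i : V) = 1.
  rewrite /enorm /dotv (bigD1 i)//= big1 ?addr0.
    by rewrite !mxE !eqxx mulr1 sqrtr1.
  by move=> j ji; rewrite !mxE (negbTE ji) andbF mulr0.
have inB (t : R) : 0 <= t <= h -> B (y' + t *: ('e_i : V)).
  move=> /andP[t0 th]; rewrite /eball/= subr0 (le_lt_trans (enormD _ _))//.
  by rewrite enormZ ne mulr1 ger0_norm//; lra.
pose ph (t : R) := dalpha al' g (y' + t *: ('e_i : V)).
have dph (t : R) : 0 <= t <= h -> is_derive t 1 ph (dalpha al g (y' + t *: 'e_i)).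
  move=> th; rewrite E; apply: line_derive.
  by have [_ _ dg _] := Sg; exact: dg al' i al's _ (inB _ th).
have [c ch phE] : exists2 c, c \in `]0, h[%R & ph h - ph 0 = dalpha al g (y' + c *: 'e_i) * (h - 0).
  apply: (@MVT _ ph (fun c => dalpha al g (y' + c *: 'e_i))) => //.
    by move=> t; rewrite in_itv/= => /andP[t0 th]; apply: dph; rewrite !ltW.
  apply: derivable_within_continuous => t; rewrite in_itv/= => th.
  by have [] := dph t th.
have ch' : 0 <= c <= h by move: ch; rewrite in_itv/= => /andP[? ?]; rewrite !ltW.
have h1 : `|dalpha al g (y' + c *: 'e_i)| <= 2 * tau / h.
  rewrite ler_pdivlMr// -[X in _ * X](ger0_norm (ltW h0)) -normrM.
  rewrite subr0 in phE; rewrite -phE (le_trans (ler_normB _ _))//.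
  have i1 : 0 <= h <= h by rewrite lexx (ltW h0).
  have i2 : 0 <= (0 : R) <= h by rewrite lexx (ltW h0).
  by rewrite mulr_natl mulr2n lerD//; apply: htau; exact: inB.
have zz : enorm (y - (y' + c *: 'e_i)) < delta.
  rewrite opprD addrA (le_lt_trans (enormD _ _))// enormN enormZ ne mulr1.
  by move: ch' => /andP[c0 c1]; rewrite ger0_norm//; move: yy' c1; rewrite /h; lra.
have := Mp al y _ als By (inB _ ch') zz; have := Mq al y _ als By (inB _ ch') zz.
move: h1; rewrite !dalphaB//; last exact: inB.
have -> : 2 * tau / h = 4 * tau / delta by rewrite /h; field; rewrite gt_eqF.
set a := dalpha al p y; set b := dalpha al q y; set a' := dalpha al p _; set b' := dalpha al q _.
move=> h1 h2 h3.
have -> : a - b = (a' - b') + (a - a') - (b - b') by ring.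
rewrite (le_trans (ler_normB _ _))//.
by have := ler_normD (a' - b') (a - a'); lra.
Qed.

End Cs_space.

(** * Tightness of the translated wave sums *)

Section wave_sums.
Context (R : realType) (m : nat) (rr : nat -> 'rV[R]_m).
Local Notation V := 'rV[R]_m.
Local Notation ws := (wsum rr).
Implicit Types (p q : nat -> R) (x y z v : V).

Lemma is_derive_line (f : V -> R) x v (df : R) :
  is_derive (0 : R) 1 (fun t : R => f (t *: v + x)) df -> is_derive x v f df.
Proof.
move=> [h1 h2].
have E : (fun h : R => h^-1 *: (((fun t : R => f (t *: v + x)) \o shift (0 : R)) (h *: (1 : R)) -
      (fun t : R => f (t *: v + x)) 0)) = (fun h : R => h^-1 *: ((f \o shift x) (h *: v) - f x)).
  by apply/funext => h; rewrite /= [h%:A]mulr1 addr0 scale0r add0r.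
by split; [rewrite /derivable -E|rewrite /derive -E].
Qed.

Lemma thetaD i x y : theta rr i (x + y) = theta rr i x + theta rr i y.
Proof. by rewrite /theta dotvDr mulrDr. Qed.

Lemma thetaZ i c x : theta rr i (c *: x) = c * theta rr i x.
Proof. by rewrite /theta dotvZr mulrCA. Qed.

Lemma is_derive_wsum p q N x v : is_derive x v (ws p q N)
  (ws (fun i => theta rr i v * q i) (fun i => - (theta rr i v * p i)) N x).
Proof.
apply: is_derive_line.
have -> : (fun t : R => ws p q N (t *: v + x)) =
  \sum_(i < N) (fun t : R => p i * cos (theta rr i v * t + theta rr i x) +
                            q i * sin (theta rr i v * t + theta rr i x)).
  apply/funext => t; rewrite fct_sumE; apply: eq_bigr => i _.
  by rewrite /wave thetaD thetaZ [t * _]mulrC.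
have h (i : 'I_N) : is_derive (0 : R) 1 (fun t : R => p i * cos (theta rr i v * t + theta rr i x) +
    q i * sin (theta rr i v * t + theta rr i x))
    (wave rr (fun i => theta rr i v * q i) (fun i => - (theta rr i v * p i)) i x).
  have h1 := is_derive_affine_cos (theta rr i v) (theta rr i x) 0.
  have h2 := is_derive_affine_sin (theta rr i v) (theta rr i x) 0.
  have h3 := is_deriveD (is_deriveZ (p i) h1) (is_deriveZ (q i) h2).
  apply: (is_derive_eq h3).
  rewrite /wave mulr0 add0r /GRing.scale/=; ring.
have := is_derive_sum h.
exact.
Qed.

Lemma wsumZ c p q N x : c * ws p q N x = ws (fun i => c * p i) (fun i => c * q i) N x.
Proof. by rewrite mulr_sumr; apply: eq_bigr => i _; rewrite /wave; ring. Qed.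

Lemma wsumB p q p' q' N x : ws p q N x - ws p' q' N x =
  ws (fun i => p i - p' i) (fun i => q i - q' i) N x.
Proof. by rewrite -sumrB; apply: eq_bigr => i _; rewrite /wave; ring. Qed.

Lemma wsum_le p q N x : `|ws p q N x| <= \sum_(i < N) (`|p i| + `|q i|).
Proof.
rewrite (le_trans (ler_norm_sum _ _ _))//; apply: ler_sum => i _; exact: wave_le.
Qed.

Hypothesis rr1 : forall i, enorm (rr i) = 1.

Lemma coord_rr_le1 i j : `|(rr i) ord0 j| <= 1.
Proof. by rewrite -(rr1 i) coord_le_enorm. Qed.

Lemma theta_delta i (j : 'I_m) : theta rr i ('e_j : V) = 2 * pi * (rr i) ord0 j.
Proof.
rewrite /theta /dotv (bigD1 j)//= big1 ?addr0; first by rewrite mxE !eqxx mulr1.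
by move=> k kj; rewrite mxE (negbTE kj) andbF mulr0.
Qed.

(* Every derivative of a wave sum is the wave sum obtained from a common
   quarter-turn of all the amplitudes (p i, q i), rescaled by ka i. *)
Lemma dalpha_wsum al : exists ka : nat -> R,
  (forall i, `|ka i| <= (2 * pi) ^+ mi_order al) /\
  forall p q, exists p' q',
    (forall N, dalpha al (ws p q N) = ws p' q' N) /\
    forall i j, p' i * p' j + q' i * q' j = ka i * ka j * (p i * p j + q i * q j).
Proof.
move Ek : (mi_order al) => k; elim: k al Ek => [|k IH] al alk.
  exists (fun=> 1); split; first by move=> i; rewrite normr1 expr0.
  by move=> p q; exists p, q; split => [N|i j]; [rewrite mi_order0|rewrite !mul1r].
have [i [al' [al'k E]]] := dalphaS R alk.
have [ka [kale hka]] := IH _ al'k.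
exists (fun n => 2 * pi * (rr n) ord0 i * ka n); split.
  move=> n; rewrite normrM exprS ler_pM//.
  rewrite normrM ger0_norm ?mulr_ge0 ?pi_ge0// ler_piMr ?coord_rr_le1//.
  by rewrite mulr_ge0 ?pi_ge0.
move=> p q; have [p' [q' [h1 h2]]] := hka p q.
exists (fun n => theta rr n ('e_i : V) * q' n), (fun n => - (theta rr n ('e_i : V) * p' n)).
split => [N|n n'].
  rewrite E h1; apply/funext => y; rewrite /partial.
  exact: (@derive_val _ _ _ _ _ _ _ (is_derive_wsum p' q' N y 'e_i)).
rewrite !theta_delta.
transitivity ((2 * pi * (rr n) ord0 i) * (2 * pi * (rr n') ord0 i) * (p' n * p' n' + q' n * q' n')).
  by ring.
by rewrite h2; ring.
Qed.

Lemma derivable_dalpha_wsum al p q N y v : derivable (dalpha al (ws p q N)) y v.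
Proof.
have [ka [_ h]] := dalpha_wsum al; have [p' [q' [-> _]]] := h p q.
by have [] := is_derive_wsum p' q' N y v.
Qed.

(** Monomials are indexed by words of length k, not by exponents, so that powers of the inner
    product expand without multinomial coefficients. *)
Let mono k x (f : {ffun 'I_k -> 'I_m}) : R := \prod_(l < k) x ord0 (f l).

Let dotv_pow k x y : dotv x y ^+ k = \sum_(f : {ffun 'I_k -> 'I_m}) mono x f * mono y f.
Proof.
rewrite -[in LHS](card_ord k) -prodr_const /dotv bigA_distr_bigA/=.
by apply: eq_bigr => f _; rewrite -big_split.
Qed.

Let gram N (u : nat -> R) k := \sum_(i < N) \sum_(j < N) u i * u j * dotv (rr i) (rr j) ^+ k.

(** A sum of squares, which yields both positivity and the Cauchy-Schwarz bound [gram_CS]. *)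
Let gramE N u k : gram N u k =
  \sum_(f : {ffun 'I_k -> 'I_m}) (\sum_(i < N) u i * mono (rr i) f) ^+ 2.
Proof.
rewrite /gram; under [RHS]eq_bigr do rewrite expr2 mulr_suml.
rewrite [RHS]exchange_big/=; apply: eq_bigr => i _.
under [RHS]eq_bigr do rewrite mulr_sumr.
rewrite [RHS]exchange_big/=; apply: eq_bigr => j _.
by rewrite dotv_pow mulr_sumr; apply: eq_bigr => f _; ring.
Qed.

Let gram_ge0 N u k : 0 <= gram N u k.
Proof. by rewrite gramE; apply: sumr_ge0 => f _; exact: sqr_ge0. Qed.

Let gram_CS N (u : nat -> R) k y :
  (\sum_(i < N) u i * dotv (rr i) y ^+ k) ^+ 2 <= (enorm y ^+ 2) ^+ k * gram N u k.
Proof.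
have -> : \sum_(i < N) u i * dotv (rr i) y ^+ k =
    \sum_(f : {ffun 'I_k -> 'I_m}) mono y f * (\sum_(i < N) u i * mono (rr i) f).
  under eq_bigr do rewrite dotv_pow mulr_sumr.
  rewrite exchange_big/=; apply: eq_bigr => f _; rewrite mulr_sumr.
  by apply: eq_bigr => i _; ring.
rewrite (le_trans (sum_CauchySchwarz _ _ _))// -gramE enorm_sqr dotv_pow.
by under eq_bigr do rewrite expr2.
Qed.

Variable W : R.
Hypothesis W0 : 0 < W.
Let K := 2 * pi * W.

(** The exponential kernel sums the forms [gram] of all degrees k with weights K^k / k!. *)
Definition gramZ N p q := \sum_(i < N) \sum_(j < N)
  (p i * p j + q i * q j) * expR (K * dotv (rr i) (rr j)).

Let K0 : 0 <= K. Proof. by rewrite !mulr_ge0 ?pi_ge0 ?ltW. Qed.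

(* Reproducing-kernel estimate: expand the waves in power series in y and
   apply Cauchy-Schwarz to the sum over all monomials. *)
Lemma wsum_gram N p q y : enorm y <= W -> ws p q N y ^+ 2 <= expR K * gramZ N p q.
Proof.
move=> yW.
pose S n := \sum_(i < N) (p i * series (cos_coeff (theta rr i y)) n + q i * series (sin_coeff (theta rr i y)) n).
pose T n := \sum_(i < N) \sum_(j < N) (p i * p j + q i * q j) * series (exp_coeff (K * dotv (rr i) (rr j))) n.
have cS : S @ \oo --> ws p q N y.
  apply: cvg_bigsum => i _; rewrite /wave; apply: cvgD; apply: cvgM; try exact: cvg_cst.
    by rewrite cos.unlock; exact: is_cvg_series_cos_coeff.
  by rewrite sin.unlock; exact: is_cvg_series_sin_coeff.
have cT : T @ \oo --> gramZ N p q.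
  apply: cvg_bigsum => i _; apply: cvg_bigsum => j _; apply: cvgM; first exact: cvg_cst.
  exact: is_cvg_series_exp_coeff.
have TE n : T n = \sum_(k < n) K ^+ k / k`!%:R * (gram N p k + gram N q k).
  rewrite /T; under eq_bigr do under eq_bigr do rewrite /series/= big_mkord mulr_sumr.
  under eq_bigr do rewrite exchange_big.
  rewrite exchange_big/=; apply: eq_bigr => k _.
  rewrite /gram -big_split mulr_sumr/=; apply: eq_bigr => i _.
  rewrite -big_split mulr_sumr/=; apply: eq_bigr => j _.
  by rewrite /exp_coeff/= exprMn; ring.
(* In degree k only the cosine amplitude (k even) or the sine amplitude (k odd) survives, up to a
   sign that the Gram form does not see. *)
pose ec k (a b : R) := if odd k then (-1) ^+ k.-1./2 * b else (-1) ^+ k./2 * a.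
have SE n : S n = \sum_(k < n) (2 * pi) ^+ k / k`!%:R * \sum_(i < N) ec k (p i) (q i) * dotv (rr i) y ^+ k.
  rewrite /S; under eq_bigr do rewrite /series/= !big_mkord !mulr_sumr -big_split/=.
  rewrite exchange_big/=; apply: eq_bigr => k _; rewrite mulr_sumr; apply: eq_bigr => i _.
  rewrite cos_coeffE sin_coeffE /ec/= /theta exprMn.
  by case: (odd k) => /=; ring.
have Sle n : S n ^+ 2 <= expR K * T n.
  have fk (k : nat) : 0 < k`!%:R :> R by rewrite ltr0n fact_gt0.
  have kk k : 0 <= K ^+ k / k`!%:R by apply: divr_ge0; [exact: exprn_ge0|exact: ltW].
  have Tn0 : 0 <= T n.
    by rewrite TE; apply: sumr_ge0 => k _; rewrite mulr_ge0// addr_ge0.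
  have e1 : \sum_(k < n) K ^+ k / k`!%:R <= expR K.
    have := @nondecreasing_cvgn_le R (series (exp_coeff K)) _ (@is_cvg_series_exp_coeff R K) n.
    rewrite /series/= big_mkord; apply.
    apply: nondecreasing_series => k _ _; exact: exp_coeff_ge0.
  apply: (@le_trans _ _ ((\sum_(k < n) K ^+ k / k`!%:R) * T n)); last by rewrite ler_wpM2r.
  rewrite SE TE.
  have b0 k : 0 < K ^+ k / k`!%:R by rewrite divr_gt0// exprn_gt0// !mulr_gt0 ?pi_gt0.
  pose E k := \sum_(i < N) ec k (p i) (q i) * dotv (rr i) y ^+ k.
  have EG k : E k ^+ 2 <= (W ^+ 2) ^+ k * (gram N p k + gram N q k).
    rewrite (le_trans (gram_CS N (fun i => ec k (p i) (q i)) k y))// ler_pM//.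
    - by rewrite exprn_ge0// sqr_ge0.
    - have e2 : enorm y ^+ 2 <= W ^+ 2.
        by rewrite lerXn2r// nnegrE ?enorm_ge0// ltW.
      by rewrite lerXn2r// nnegrE sqr_ge0.
    - have sg (l : nat) (a b : R) : ((-1) ^+ l * a) * ((-1) ^+ l * b) = a * b.
        by rewrite mulrACA -expr2 sqrr_sign mul1r.
      rewrite /ec; case: (odd k).
        rewrite (_ : gram N _ k = gram N q k) ?lerDr//.
        by apply: eq_bigr => i _; apply: eq_bigr => j _; rewrite sg.
      rewrite (_ : gram N _ k = gram N p k) ?lerDl//.
      by apply: eq_bigr => i _; apply: eq_bigr => j _; rewrite sg.
  (* Cauchy-Schwarz over the degrees with weights K^k / k!: the first factor is at most expR K, and
     in the second W^(2k) restores exactly the weight K^k / k!, since K = 2 pi W. *)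
  have -> : \sum_(k < n) (2 * pi) ^+ k / k`!%:R * (\sum_(i < N) ec k (p i) (q i) * dotv (rr i) y ^+ k) =
     \sum_(k < n) Num.sqrt (K ^+ k / k`!%:R) *
       ((2 * pi) ^+ k / k`!%:R / Num.sqrt (K ^+ k / k`!%:R) * E k).
    apply: eq_bigr => k _; rewrite -/(E k).
    by field; rewrite !gt_eqF ?sqrtr_gt0.
  rewrite (le_trans (sum_CauchySchwarz _ _ _))// ler_pM//.
  - by apply: sumr_ge0 => k _; exact: sqr_ge0.
  - by apply: sumr_ge0 => k _; exact: sqr_ge0.
  - by apply: ler_sum => k _; rewrite sqr_sqrtr.
  have sqE (a b e : R) : 0 < b -> (a / Num.sqrt b * e) ^+ 2 = a ^+ 2 / b * e ^+ 2.
    by move=> b0'; rewrite [LHS]exprMn [in LHS]exprMn exprVn sqr_sqrtr// ltW.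
  apply: ler_sum => k _; rewrite sqE//.
  apply: (@le_trans _ _ (((2 * pi) ^+ k / k`!%:R) ^+ 2 / (K ^+ k / k`!%:R) *
      ((W ^+ 2) ^+ k * (gram N p k + gram N q k)))).
    by rewrite ler_wpM2l// divr_ge0 ?sqr_ge0.
  rewrite le_eqVlt; apply/orP; left; apply/eqP.
  have p2 : (2 * pi : R) ^+ k != 0 by rewrite gt_eqF// exprn_gt0// mulr_gt0 ?pi_gt0.
  have w2 : W ^+ k != 0 by rewrite gt_eqF// exprn_gt0.
  have f2 : k`!%:R != 0 :> R by rewrite gt_eqF.
  rewrite /K [(2 * pi * W) ^+ k]exprMn exprAC; field.
  by rewrite p2 w2 f2.
apply: (ler_cvg_to (cvgM cS cS) (cvgM (cvg_cst (expR K)) cT)).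
by apply: nearW => n /=; rewrite -expr2; exact: Sle.
Qed.

Lemma gramZ_ge0 N p q : 0 <= gramZ N p q.
Proof.
have := @wsum_gram N p q 0; rewrite enorm0 => /(_ (ltW W0)) h.
by rewrite -(pmulr_rge0 _ (expR_gt0 K)) (le_trans _ h)// sqr_ge0.
Qed.

End wave_sums.

(** * Translated wave sums as random elements of C^s *)

Section translates.
Context (R : realType) (m : nat) (rr : nat -> 'rV[R]_m).
Local Notation V := 'rV[R]_m.
Local Notation BV := (BorelRm R m).
Local Notation ws := (wsum rr).
Local Notation wv := (wave rr).
Implicit Types (p q ka : nat -> R) (x y z : V).

Lemma wsum_translate p q N x y : ws p q N (x + y) =
  ws (wv p q ^~ x) (wv q (fun i => - p i) ^~ x) N y.
Proof.
apply: eq_bigr => i _; rewrite /wave thetaD cosD sinD; ring.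
Qed.

(** Translation turns each amplitude pair by its own angle, so inner products of pairs depend on x
    only through the difference of two frequencies and average out off the diagonal. *)
Lemma wave_gram p q x i j :
  wv p q i x * wv p q j x + wv q (fun i => - p i) i x * wv q (fun i => - p i) j x =
  (p i * p j + q i * q j) * cos (2 * pi * dotv (rr i - rr j) x + 0) +
  (q i * p j - p i * q j) * cos (2 * pi * dotv (rr i - rr j) x + - (pi / 2)).
Proof.
rewrite -sin_cosB addr0 dotvDl dotvNl mulrBr -!/(theta rr _ x) sinB cosB /wave; ring.
Qed.

Hypothesis rr1 : forall i, enorm (rr i) = 1.
Variable W : R.
Hypothesis W0 : 0 < W.
Let K := 2 * pi * W.

Lemma theta_sum i (v : V) : theta rr i v = \sum_j v ord0 j * theta rr i ('e_j : V).
Proof.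
rewrite {1}/theta /dotv mulr_sumr; apply: eq_bigr => j _.
by rewrite theta_delta; ring.
Qed.

Lemma continuous_wave p q i : continuous (fun x : V => wv p q i x).
Proof.
move=> x.
have ct : {for x, continuous (fun x : V => 2 * pi * dotv (rr i) x)}.
  by apply: continuousM; [exact: cst_continuous|exact: continuous_dotv].
apply: (@continuousD _ _ _ (fun x : V => p i * cos (theta rr i x)) (fun x : V => q i * sin (theta rr i x)));
  apply: continuousM; try exact: cst_continuous.
- exact: (continuous_comp ct (@continuous_cos R _)).
- exact: (continuous_comp ct (@continuous_sin R _)).
Qed.

Lemma continuous_wsum p q N : continuous (ws p q N : V -> R).
Proof. by apply: continuous_bigsum => i _; exact: continuous_wave. Qed.

Lemma wsum_lip p q N (L : R) y z :
  (forall (j : 'I_m) w, eball 0 W w ->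
    `|ws (fun i => theta rr i ('e_j : V) * q i) (fun i => - (theta rr i ('e_j : V) * p i)) N w| <= L) ->
  eball 0 W y -> eball 0 W z -> `|ws p q N y - ws p q N z| <= m%:R * L * enorm (y - z).
Proof.
move=> hL By Bz; pose v : V := y - z.
have L0 (j : 'I_m) : 0 <= L by apply: le_trans (hL j _ By).
have df (t : R) : is_derive t 1 (fun t : R => ws p q N (z + t *: v))
    (ws (fun i => theta rr i v * q i) (fun i => - (theta rr i v * p i)) N (z + t *: v)).
  have [d1 d2] := is_derive_wsum rr p q N (z + t *: v) v.
  by rewrite -d2; exact: line_derive.
have := @mvt_bound _ _ _ 0 1 (m%:R * L * enorm v) df.
have -> : z + 1 *: v = y by rewrite scale1r addrC subrK.
rewrite scale0r addr0 subr0 normr1 mulr1; apply => t.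
rewrite min_l// max_r// => /andP[t0 t1].
have Bt : eball 0 W (z + t *: v).
  have -> : z + t *: v = (1 - t) *: z + t *: y by rewrite scalerBl scalerBr scale1r -addrA [- _ + _]addrC.
  move: By Bz; rewrite /eball/= !subr0 => By Bz; rewrite (le_lt_trans (enormD _ _))// !enormZ.
  (* The strict inequality is taken from the z term, which disappears at t = 1. *)
  rewrite !ger0_norm ?subr_ge0//; have [->|t1'] := eqVneq t 1.
    by rewrite subrr mul0r add0r mul1r.
  have t2 : 0 < 1 - t by rewrite subr_gt0 lt_neqAle t1'.
  have -> : W = (1 - t) * W + t * W by rewrite -mulrDl subrK mul1r.
  by rewrite ltr_leD// ?ltr_pM2l// ler_wpM2l// ltW.
have -> : ws (fun i => theta rr i v * q i) (fun i => - (theta rr i v * p i)) N (z + t *: v) =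
    \sum_j v ord0 j * ws (fun i => theta rr i ('e_j : V) * q i)
                         (fun i => - (theta rr i ('e_j : V) * p i)) N (z + t *: v).
  rewrite /wsum; under [RHS]eq_bigr do rewrite mulr_sumr.
  rewrite exchange_big/=; apply: eq_bigr => i _; rewrite /wave theta_sum.
  under [RHS]eq_bigr do rewrite mulrDr.
  rewrite big_split/= !mulr_suml -sumrN mulr_suml; congr (_ + _); apply: eq_bigr => j _; ring.
rewrite (le_trans (ler_norm_sum _ _ _))//.
have -> : m%:R * L * enorm v = \sum_(j < m) (enorm v * L).
  by rewrite sumr_const card_ord -mulr_natl; ring.
apply: ler_sum => j _; rewrite normrM ler_pM//; first exact: coord_le_enorm.
exact: hL.
Qed.
Hypothesis rr_inj : forall i j, i != j -> rr i - rr j != 0.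
Variable s : nat.

Lemma dalpha_restrB (g : V -> R) al y : eball 0 W y ->
  dalpha al (restrB W g) y = dalpha al g y.
Proof.
move=> By; apply: (@eq_dalpha _ _ (eball 0 W)) By; first exact: open_eball.
by move=> z Bz; rewrite /restrB asboolT//; exact: ltW.
Qed.

Lemma wsum_amp_le p q N c : (forall i, `|p i| <= c i) -> (forall i, `|q i| <= c i) ->
  forall y, `|ws p q N y| <= \sum_(i < N) (c i + c i).
Proof.
by move=> hp hq y; rewrite (le_trans (wsum_le _ _ _ _ _))//; apply: ler_sum => i _; rewrite lerD.
Qed.

Lemma Sset_wsum p q N : Sset s W (restrB W (ws p q N)).
Proof.
split.
- by move=> y yB; rewrite /restrB asboolF.
- apply: (@subspace_eq_continuous _ _ _ (ws p q N : V -> R)).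
    by move=> y; rewrite inE => yB; rewrite /from_subspace /restrB asboolT.
  by apply: continuous_subspaceT; exact: continuous_wsum.
- move=> al i als y By; apply: (@near_eq_derivable _ _ _ (dalpha al (ws p q N))).
    near=> z; rewrite dalpha_restrB//; near: z; apply: open_nbhs_nbhs; split => //.
    exact: open_eball.
  exact: derivable_dalpha_wsum.
- move=> al als e e0; have [ka [_ /(_ p q)[p' [q' [h _]]]]] := dalpha_wsum rr1 al.
  pose c i := 2 * pi * (`|p' i| + `|q' i|); pose L := \sum_(i < N) (c i + c i) + 1.
  have c0 i : 0 <= c i by rewrite !mulr_ge0 ?pi_ge0 ?addr_ge0.
  have L0 : 0 < L by rewrite ltr_wpDl// sumr_ge0// => i _; rewrite addr_ge0.
  have th i (j : 'I_m) : `|theta rr i ('e_j : V)| <= 2 * pi.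
    rewrite theta_delta normrM ger0_norm ?mulr_ge0 ?pi_ge0//.
    by rewrite ler_piMr ?coord_rr_le1// mulr_ge0 ?pi_ge0.
  have hL (j : 'I_m) w : eball 0 W w -> `|ws (fun i => theta rr i ('e_j : V) * q' i)
      (fun i => - (theta rr i ('e_j : V) * p' i)) N w| <= L.
    move=> _; rewrite (le_trans (@wsum_amp_le _ _ N c _ _ w)) ?lerDl// => i.
      by rewrite normrM ler_pM// lerDr.
    by rewrite normrN normrM ler_pM// lerDl.
  have mL : 0 < m%:R * L + 1 by rewrite ltr_wpDl// mulr_ge0// ltW.
  exists (e / (m%:R * L + 1)); first by rewrite divr_gt0.
  move=> y z By Bz; rewrite ltr_pdivlMr// => yz; rewrite !dalpha_restrB// h.
  rewrite (le_lt_trans (wsum_lip hL By Bz))// (le_lt_trans _ yz)// mulrC ler_wpM2l ?enorm_ge0//.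
  by rewrite lerDl.
Unshelve. all: by end_near. Qed.

Lemma restrB_wsumB p q p' q' N :
  (fun y => restrB W (ws p q N) y - restrB W (ws p' q' N) y) =
  restrB W (ws (fun i => p i - p' i) (fun i => q i - q' i) N).
Proof.
apply/funext => y; rewrite /restrB; case: asboolP => _; [exact: wsumB|exact: subrr].
Qed.

(** A crude bound, not uniform in N; it serves only to make the translate depend continuously on
    x. *)
Lemma Csnorm_wsum p q N : Csnorm s W (restrB W (ws p q N)) <=
  \sum_(i < N) 2 * (2 * pi) ^+ s * (`|p i| + `|q i|).
Proof.
apply: Csnorm_le => // al y als By; rewrite dalpha_restrB//.
have [ka [kale /(_ p q)[p' [q' [-> E]]]]] := dalpha_wsum rr1 al.
have pi1 : 1 <= 2 * pi :> R by have := @pi_ge2 R; lra.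
pose c i := (2 * pi) ^+ s * (`|p i| + `|q i|).
have c0 i : 0 <= c i by rewrite mulr_ge0 ?addr_ge0// exprn_ge0// mulr_ge0 ?pi_ge0.
have kc i : (ka i * (`|p i| + `|q i|)) ^+ 2 <= c i ^+ 2.
  rewrite -[X in X <= _]real_normK ?num_real// normrM [ `| _ + _|]ger0_norm ?addr_ge0//.
  have h : `|ka i| * (`|p i| + `|q i|) <= c i.
    by rewrite ler_wpM2r ?addr_ge0// (le_trans (kale i))// ler_weXn2l.
  by rewrite lerXn2r// nnegrE// mulr_ge0// addr_ge0.
have pq i : p' i ^+ 2 + q' i ^+ 2 <= c i ^+ 2.
  rewrite (le_trans _ (kc i))// expr2 [q' i ^+ 2]expr2 E exprMn -!expr2 ler_wpM2l ?sqr_ge0//.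
  rewrite -[p i ^+ 2]real_normK ?num_real// -[q i ^+ 2]real_normK ?num_real//.
  by rewrite sqrrD -addrA lerD2l lerDr mulrn_wge0// mulr_ge0.
rewrite (le_trans (@wsum_amp_le _ _ N c _ _ y))//.
- move=> i; apply: ler_of_sqr => //; rewrite real_normK ?num_real//.
  by rewrite (le_trans _ (pq i))// lerDl sqr_ge0.
- move=> i; apply: ler_of_sqr => //; rewrite real_normK ?num_real//.
  by rewrite (le_trans _ (pq i))// lerDr sqr_ge0.
by apply: ler_sum => i _; rewrite -/(c i) -mulrA -/(c i) mulr_natl mulr2n.
Qed.

(** The sets with measurable preimage form a sigma-algebra, and open sets have open preimages
    because the turned amplitudes vary continuously with x. *)
Lemma measurable_translates p q N (A : set (V -> R)) : SBorel s W A ->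
  measurable ([set x | A (restrB W (fun y => ws p q N (x + y)))] : set BV).
Proof.
pose Phi x := restrB W (fun y => ws p q N (x + y)).
have PhiE x : Phi x = restrB W (ws (wv p q ^~ x) (wv q (fun i => - p i) ^~ x) N).
  by congr (restrB W _); apply/funext => y; exact: wsum_translate.
have SPhi x : Sset s W (Phi x) by rewrite PhiE; exact: Sset_wsum.
move: A; apply: (@smallest_sub _ _ _ [set A | measurable (Phi @^-1` A : set BV)]).
  split => /=.
  - by rewrite preimage_set0.
  - move=> A mA; have -> : Phi @^-1` (Sset s W `\` A) = ~` (Phi @^-1` A).
      by apply/seteqP; split => x; [move=> []|split].
    exact: measurableC.
  - by move=> A mA; rewrite preimage_bigcup; apply: bigcup_measurable => n _; exact: mA.
move=> U [_ oU]; apply: open_measurable_rV; rewrite openE => x /= Ux.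
have [e e0 he] := oU _ Ux.
pose g (x' : V) := \sum_(i < N) 2 * (2 * pi) ^+ s * (`|wv p q i x' - wv p q i x| +
   `|wv q (fun i => - p i) i x' - wv q (fun i => - p i) i x|).
have cg : continuous g.
  have cn p' q' i : continuous (fun x' : V => `|wv p' q' i x' - wv p' q' i x|).
    move=> x'; apply: (@continuous_comp _ _ _ (fun x' : V => wv p' q' i x' - wv p' q' i x) (fun t : R => `|t|));
      last exact: norm_continuous.
    by apply: continuousB; [exact: continuous_wave|exact: cst_continuous].
  have cC (c : R) (h : V -> R) : continuous h -> continuous (fun x => c * h x).
    by move=> ch x'; apply: continuousM; [exact: cst_continuous|exact: ch].
  have cD (h k : V -> R) : continuous h -> continuous k -> continuous (fun x => h x + k x).
    by move=> ch ck x'; apply: continuousD; [exact: ch|exact: ck].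
  by apply: continuous_bigsum => i _; apply: cC; apply: cD; exact: cn.
have gx : g x = 0 by apply: big1 => i _; rewrite !subrr normr0 addr0 mulr0.
have : \forall x' \near x, g x' < e.
  by have := cvgr_lt _ (cg x) e; rewrite gx; apply.
apply: filterS => x' gx' /=; apply: he; first exact: SPhi.
rewrite -/(Phi x) -/(Phi x') !PhiE restrB_wsumB.
exact: le_lt_trans (Csnorm_wsum _ _ _) gx'.
Qed.

Lemma bmeas_gram p q N ka : bmeas (fun x : BV =>
  gramZ rr W N (fun i => ka i * wv p q i x) (fun i => ka i * wv q (fun i => - p i) i x)).
Proof.
have bw p' q' i : bmeas (fun x : BV => wv p' q' i x).
  apply: bmeasD; apply: bmeasZ.
    by have := bmeas_cos (measurable_theta rr i 0); under eq_fun do rewrite addr0.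
  by have := bmeas_cos (measurable_theta rr i (- (pi / 2))); under eq_fun do rewrite -sin_cosB.
do 2 apply: bmeas_sum => ?; apply: bmeasM; last exact: bmeas_cst.
by apply: bmeasD; apply: bmeasM; apply: bmeasZ.
Qed.

(** Off the diagonal the frequency rr i - rr j is nonzero and the mean vanishes; on the diagonal the
    kernel equals expR K because the rr i are unit vectors. *)
Lemma mean_gram p q N ka :
  (fun Rad => Ex (unifB m Rad) (fun x : BV =>
     gramZ rr W N (fun i => ka i * wv p q i x) (fun i => ka i * wv q (fun i => - p i) i x)))
  @ +oo --> expR K * \sum_(i < N) ka i ^+ 2 * (p i ^+ 2 + q i ^+ 2).
Proof.
pose C i j := ka i * ka j * expR (K * dotv (rr i) (rr j)).
pose A i j := C i j * (p i * p j + q i * q j).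
pose B i j := C i j * (q i * p j - p i * q j).
pose ph i j psi := fun x : BV => cos (2 * pi * dotv (rr i - rr j) x + psi).
have bph i j psi : bmeas (ph i j psi) by apply: bmeas_cos; exact: measurable_phase.
have E Rad : Ex (unifB m Rad) (fun x : BV =>
     gramZ rr W N (fun i => ka i * wv p q i x) (fun i => ka i * wv q (fun i => - p i) i x)) =
  \sum_(i < N) \sum_(j < N) (A i j * Ex (unifB m Rad) (ph i j 0) +
                             B i j * Ex (unifB m Rad) (ph i j (- (pi / 2)))).
  have -> : Ex (unifB m Rad) (fun x : BV =>
     gramZ rr W N (fun i => ka i * wv p q i x) (fun i => ka i * wv q (fun i => - p i) i x)) =
    Ex (unifB m Rad) (fun x => \sum_(i < N) \sum_(j < N) (A i j * ph i j 0 x + B i j * ph i j (- (pi / 2)) x)).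
    apply: eq_Ex => x; apply: eq_bigr => i _; apply: eq_bigr => j _.
    have := wave_gram p q x i j; rewrite /A /B /C /ph -/K.
    set c1 := cos _; set c2 := cos _ => h.
    transitivity (ka i * ka j * expR (K * dotv (rr i) (rr j)) * ((p i * p j + q i * q j) * c1 + (q i * p j - p i * q j) * c2)).
      by rewrite -h; ring.
    by ring.
  have bt i j : bmeas (fun x : BV => A i j * ph i j 0 x + B i j * ph i j (- (pi / 2)) x).
    by apply: bmeasD; exact: bmeasZ.
  rewrite Ex_sum; last by move=> i; apply: bmeas_sum.
  apply: eq_bigr => i _; rewrite Ex_sum//; apply: eq_bigr => j _.
  by rewrite ExD ?ExZ//; exact: bmeasZ.
apply: (eq_cvgto E).
have -> : expR K * \sum_(i < N) ka i ^+ 2 * (p i ^+ 2 + q i ^+ 2) =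
   \sum_(i < N) \sum_(j < N) (if i == j then A i j else 0).
  rewrite mulr_sumr; apply: eq_bigr => i _; rewrite (bigD1 i)//= eqxx big1 ?addr0.
    by rewrite /A /C -enorm_sqr rr1 expr1n mulr1; ring.
  by move=> j ji; rewrite eq_sym (negbTE ji).
apply: cvg_bigsum => i _; apply: cvg_bigsum => j _.
have [<-|ij] := eqVneq i j.
  have E1 Rad : A i i * Ex (unifB m Rad) (ph i i 0) + B i i * Ex (unifB m Rad) (ph i i (- (pi / 2))) = A i i.
    have -> : B i i = 0 by rewrite /B [p i * _]mulrC subrr mulr0.
    rewrite mul0r addr0 -[RHS]mulr1; congr (_ * _).
    rewrite -[RHS](Ex_cst (unifB m Rad)); apply: eq_Ex => x.
    by rewrite /ph subrr dotv0l mulr0 addr0 cos0.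
  by apply: (eq_cvgto E1); exact: cvg_cst.
have ijn : rr i - rr j != 0 by apply: rr_inj.
have -> : 0 = A i j * 0 + B i j * 0 by rewrite !mulr0 addr0.
by apply: cvgD; (apply: cvgM; [exact: cvg_cst|exact: mean_cos]).
Qed.

Lemma eq_gramZ N p q p' q' :
  (forall i j, p i * p j + q i * q j = p' i * p' j + q' i * q' j) ->
  gramZ rr W N p q = gramZ rr W N p' q'.
Proof. by move=> h; apply: eq_bigr => i _; apply: eq_bigr => j _; rewrite h. Qed.

(** The point is that L is chosen before p, q and N: Markov's inequality is applied to the sum of
    the Gram forms of all derivatives, whose limiting mean involves the amplitudes only through
    C. *)
Lemma wave_tight (C eps : R) : 0 <= C -> 0 < eps -> exists2 L : R, 0 < L &
  forall p q N, \sum_(i < N) (p i ^+ 2 + q i ^+ 2) <= C ->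
  \forall Rad \near +oo, exists E : set BV,
    [/\ measurable E, (unifB m Rad E <= eps%:E)%E & forall x, ~ E x ->
       let G := restrB W (fun y => ws p q N (x + y)) in
       Sbd s W L G /\ forall eta delta, m%:R * L * delta <= eta -> Smod s W eta delta G].
Proof.
move=> C0 eps0.
have pi1 : 1 <= 2 * pi :> R by have := @pi_ge2 R; lra.
have pi0 : 0 <= 2 * pi :> R by lra.
have /choice[ka hka] : forall be : {ffun 'I_m -> 'I_s.+1}, exists ka : nat -> R,
    (forall i, `|ka i| <= (2 * pi) ^+ s) /\
    ((mi_order (fun i => be i : nat) <= s)%N -> forall p q, exists p' q',
      (forall N, dalpha (fun i => be i : nat) (ws p q N) = ws p' q' N) /\
      forall i j, p' i * p' j + q' i * q' j = ka i * ka j * (p i * p j + q i * q j)).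
  move=> be; have [h|h] := boolP (mi_order (fun i => be i : nat) <= s)%N; last first.
    by exists (fun=> 0); split => // i; rewrite normr0 exprn_ge0.
  have [ka [h1 h2]] := dalpha_wsum rr1 (fun i => be i : nat); exists ka; split => // i.
  by rewrite (le_trans (h1 i))// ler_weXn2l.
(* The option adds one further derivative, up to order s + 1, from which the Lipschitz bounds on the
   derivatives of order s are obtained. *)
pose I : finType := ({ffun 'I_m -> 'I_s.+1} * option 'I_m)%type.
pose kk (u : I) (i : nat) := if u.2 is Some j then theta rr i ('e_j : V) * ka u.1 i else ka u.1 i.
have kkle u i : `|kk u i| <= (2 * pi) ^+ s.+1.
  have [h _] := hka u.1; rewrite /kk; case: u.2 => [j|].
    rewrite normrM exprS ler_pM// theta_delta normrM ger0_norm//.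
    by rewrite ler_piMr ?coord_rr_le1.
  by rewrite (le_trans (h i))// ler_weXn2l.
pose D := #|I|%:R * (expR K * ((2 * pi) ^+ s.+1 ^+ 2 * C)).
have D0 : 0 <= D.
  by apply: mulr_ge0 => //; apply: mulr_ge0; [exact: expR_ge0|apply: mulr_ge0 => //; exact: sqr_ge0].
pose M := (D + 1) / eps.
have M0 : 0 < M by rewrite divr_gt0// ltr_wpDl.
(* Chosen so that expR K * M <= L^2, which avoids a square root. *)
pose L := 1 + expR K * M.
have L0 : 0 < L by rewrite ltr_wpDr// mulr_ge0 ?expR_ge0// ltW.
exists L => // p q N hC.
pose gr u (x : BV) := gramZ rr W N (fun i => kk u i * wv p q i x)
   (fun i => kk u i * wv q (fun i => - p i) i x).
have bgr u : bmeas (gr u) by exact: bmeas_gram.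
pose H (x : BV) := \sum_u gr u x.
have bH : bmeas H by exact: bmeas_sum.
have gr0 u x : 0 <= gr u x by exact: gramZ_ge0.
have H0 x : 0 <= H x by apply: sumr_ge0.
have cH : (fun Rad => Ex (unifB m Rad) H) @ +oo -->
    \sum_u expR K * \sum_(i < N) kk u i ^+ 2 * (p i ^+ 2 + q i ^+ 2).
  have E Rad : Ex (unifB m Rad) H = \sum_u Ex (unifB m Rad) (gr u) by exact: Ex_sum.
  by apply: (eq_cvgto E); apply: cvg_bigsum => u _; exact: mean_gram.
have cHD : \sum_u expR K * \sum_(i < N) kk u i ^+ 2 * (p i ^+ 2 + q i ^+ 2) < D + 1.
  apply: (@le_lt_trans _ _ D); last by rewrite ltrDl.
  rewrite /D mulr_natl -sumr_const; apply: ler_sum => u _.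
  rewrite ler_wpM2l ?expR_ge0// (le_trans _ (ler_wpM2l _ hC)) ?sqr_ge0//.
  rewrite mulr_sumr; apply: ler_sum => i _; rewrite ler_wpM2r ?addr_ge0 ?sqr_ge0//.
  rewrite -[X in X <= _]real_normK ?num_real// lerXn2r// nnegrE exprn_ge0//.
apply: filterS (cvgr_lt _ cH _ cHD) => Rad HRad.
exists [set x | M <= H x]; split.
- by rewrite -[X in measurable X]setTI; apply: measurable_fun_le => //; exact: bH.1.
- apply: (le_trans (Ex_markov _ bH M0 H0)); rewrite lee_fin ler_pdivrMr// /M.
  by rewrite mulrCA divff ?gt_eqF// mulr1 ltW.
move=> x /= /negP; rewrite -ltNge => Hx.
set G := restrB W _.
have GE : G = restrB W (ws (wv p q ^~ x) (wv q (fun i => - p i) ^~ x) N).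
  by congr (restrB W _); apply/funext => y; exact: wsum_translate.
have SG : Sset s W G by rewrite GE; exact: Sset_wsum.
have key u p' q' w : eball 0 W w -> (forall i j, p' i * p' j + q' i * q' j =
   kk u i * wv p q i x * (kk u j * wv p q j x) +
   kk u i * wv q (fun i => - p i) i x * (kk u j * wv q (fun i => - p i) j x)) ->
   `|ws p' q' N w| <= L.
  move=> Bw hpq; have := @wsum_gram _ _ rr W W0 N p' q' w.
  rewrite (eq_gramZ N hpq) -/(gr u x) => /(_ _) h.
  have guM : gr u x <= M.
    by rewrite (le_trans _ (ltW Hx))// /H (bigD1 u)//= lerDl sumr_ge0.
  apply: ler_of_sqr; first exact: ltW.
  rewrite real_normK ?num_real//; apply: (@le_trans _ _ (expR K * M)).
    rewrite (le_trans (h _))//; last by rewrite ler_wpM2l// expR_ge0.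
    by move: Bw; rewrite /eball/= subr0 => /ltW.
  have : 0 <= expR K * M by rewrite mulr_ge0 ?expR_ge0// ltW.
  by rewrite /L; set t := expR K * M => t0; nra.
have main al : (mi_order al <= s)%N -> exists p' q', (forall w, eball 0 W w ->
     dalpha al G w = ws p' q' N w /\ `|ws p' q' N w| <= L) /\
   forall (j : 'I_m) w, eball 0 W w -> `|ws (fun i => theta rr i ('e_j : V) * q' i)
     (fun i => - (theta rr i ('e_j : V) * p' i)) N w| <= L.
  move=> als; have [be bal] := mi_finite als.
  have E : al = (fun i => be i : nat) by apply/funext.
  rewrite E in als *; have [_ /(_ als)] := hka be.
  move=> /(_ (wv p q ^~ x) (wv q (fun i => - p i) ^~ x))[p' [q' [h1 h2]]].
  exists p', q'; split => [w Bw|j w Bw].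
    split; first by rewrite GE dalpha_restrB// h1.
    by apply: (key (be, None)) => // i j; rewrite h2 /kk/=; ring.
  apply: (key (be, Some j)) => // i j'; rewrite /kk/=.
  transitivity (theta rr i ('e_j : V) * theta rr j' ('e_j : V) * (p' i * p' j' + q' i * q' j')).
    by ring.
  by rewrite h2; ring.
split.
  split => // y By.
  have mi0 : mi_order (fun _ : 'I_m => 0%N) = 0%N by rewrite /mi_order big1.
  have [|p' [q' [h _]]] := main (fun=> 0%N); first by rewrite mi0.
  by have := h y By; rewrite mi_order0// => -[->].
move=> eta delta hed; split => // al y z als By Bz yz.
have [p' [q' [h h']]] := main al als.
rewrite (h y By).1 (h z Bz).1 (le_trans (wsum_lip h' By Bz))// (le_trans _ hed)//.
by apply: ler_wpM2l; [apply: mulr_ge0 => //; exact: ltW|exact: ltW].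
Qed.

End translates.

(** * Convergence of the finite-dimensional distributions *)

Section second_moment.
Context (R : realType) (m : nat) d (T : measurableType d) (P : probability T R).
Variable F : T -> 'rV[R]_m -> R.
Hypothesis mF : forall x, measurable_fun setT (fun w => F w x).
Variable C : 'rV[R]_m -> 'rV[R]_m -> R.
Hypothesis FC : forall x y, ('E_P[fun w => (F w x * F w y)%R])%E = (C x y)%:E.

(** The covariance on the diagonal is finite, which makes every F x square integrable and hence all
    the products integrable. *)
Lemma second_moment_sum k (c : 'I_k -> R) (xs : 'I_k -> 'rV[R]_m) :
  (\int[P]_w ((\sum_(i < k) c i * F w (xs i)) ^+ 2)%:E)%E =
  (\sum_(i < k) \sum_(j < k) c i * c j * C (xs i) (xs j))%:E.
Proof.
have FCi x y : (\int[P]_w (F w x * F w y)%:E = (C x y)%:E)%E by rewrite -FC unlock.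
have sq x : P.-integrable setT (fun w => (F w x ^+ 2)%:E).
  apply/integrableP; split.
    by apply/measurable_EFinP; exact: measurable_funX.
  rewrite (eq_integral (fun w => (F w x * F w x)%:E)) ?FCi ?ltry// => w _.
  by rewrite abse_EFin ger0_norm ?sqr_ge0// expr2.
have it x y : P.-integrable setT (fun w => (F w x * F w y)%:E).
  apply: (le_integrable measurableT _ _ (integrableD measurableT (sq x) (sq y))).
    by apply/measurable_EFinP; exact: measurable_funM.
  move=> w _; rewrite /= lee_fin [leRHS]ger0_norm ?addr_ge0 ?sqr_ge0// ler_norml.
  have := sqr_ge0 (F w x - F w y); have := sqr_ge0 (F w x + F w y); nra.
transitivity (\int[P]_w (\sum_(i < k) \sum_(j < k) (c i * c j)%:E * (F w (xs i) * F w (xs j))%:E))%E.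
  apply: eq_integral => w _; rewrite expr2 mulr_suml -sumEFin; apply: eq_bigr => i _.
  by rewrite mulr_sumr -sumEFin; apply: eq_bigr => j _; rewrite -EFinM; congr EFin; ring.
have it' i j : P.-integrable setT (fun w => ((c i * c j)%:E * (F w (xs i) * F w (xs j))%:E)%E).
  exact: integrableZl.
rewrite integral_sum//; last by move=> i; apply: integrable_sum.
rewrite -sumEFin; apply: eq_bigr => i _; rewrite integral_sum// -sumEFin; apply: eq_bigr => j _.
by rewrite integralZl// FCi -EFinM.
Qed.

End second_moment.

(** * The random wave of the theorem as a wave sum *)

Section random_wave.
Context (R : realType) (m : nat).
Local Notation V := 'rV[R]_m.
Local Notation BV := (BorelRm R m).
Variables (r : int -> V) (a : int -> R[i]).
Hypothesis hr_sph : forall n : nat, (0 < n)%N -> usphere (r n%:Z).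
Hypothesis hr_neg : forall n : nat, (0 < n)%N -> r (- n%:Z) = - r n%:Z.
Hypothesis hr_Qind : forall (k : nat) (c : 'I_k -> rat),
      \sum_(i < k) ratr (c i) *: r (i.+1)%:Z = 0 -> forall i, c i = 0.
Hypothesis ha_unit : forall n : nat, (0 < n)%N -> `|a n%:Z| = 1.
Hypothesis ha_conj : forall n : nat, (0 < n)%N -> a (- n%:Z) = ((a n%:Z)^*)%C.

Definition rpos (i : nat) : V := r (i.+1)%:Z.
Local Notation ws := (wsum rpos).
Local Notation wv := (wave rpos).

Lemma rpos1 i : enorm (rpos i) = 1. Proof. exact: hr_sph. Qed.

Lemma rpos_inj i j : i != j -> rpos i - rpos j != 0.
Proof.
move=> ij; apply/negP => /eqP h.
pose k := (maxn i j).+1.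
have ik : (i < k)%N by rewrite ltnS leq_maxl.
have jk : (j < k)%N by rewrite ltnS leq_maxr.
pose c (l : 'I_k) : rat := ((l == i :> nat)%:R - (l == j :> nat)%:R).
have := @hr_Qind k c; rewrite /c.
have -> : \sum_(l < k) ratr ((l == i :> nat)%:R - (l == j :> nat)%:R) *: r (l.+1)%:Z = 0.
  transitivity (rpos i - rpos j); last exact: h.
  under eq_bigr do rewrite rmorphB !rmorph_nat scalerBl.
  rewrite sumrB; congr (_ - _).
    rewrite (bigD1 (Ordinal ik))//= eqxx scale1r big1 ?addr0// => l.
    by rewrite -val_eqE/= => /negbTE ->; rewrite scale0r.
  rewrite (bigD1 (Ordinal jk))//= eqxx scale1r big1 ?addr0// => l.
  by rewrite -val_eqE/= => /negbTE ->; rewrite scale0r.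
move=> /(_ erefl (Ordinal ik)) /=; rewrite eqxx (negbTE ij) subr0 => /eqP.
by rewrite oner_eq0.
Qed.

(** The terms of index n and -n are conjugate, so each pair is twice a real part: hence the factor 2
    and the amplitudes Re a and -Im a below. *)
Definition ampc (N : nat) : R := 2 / Num.sqrt (2 * N%:R).
Definition ampp N i : R := ampc N * complex.Re (a (i.+1)%:Z).
Definition ampq N i : R := - (ampc N * complex.Im (a (i.+1)%:Z)).

Lemma ampc_ge0 N : 0 <= ampc N.
Proof. by rewrite divr_ge0// sqrtr_ge0. Qed.

Lemma ampc_sqr N : (0 < N)%N -> ampc N ^+ 2 = 2 / N%:R.
Proof.
move=> N0; have N1 : 0 < N%:R :> R by rewrite ltr0n.
rewrite /ampc exprMn exprVn sqr_sqrtr ?mulr_ge0//; field.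
by rewrite gt_eqF.
Qed.

Lemma amp_sqr N i : ampp N i ^+ 2 + ampq N i ^+ 2 = ampc N ^+ 2.
Proof.
have h : complex.Re (a (i.+1)%:Z) ^+ 2 + complex.Im (a (i.+1)%:Z) ^+ 2 = 1.
  have /(congr1 (fun z => complex.Re (z ^+ 2))) := ha_unit (ltn0Sn i).
  by rewrite expr1n -add_Re2_Im2 /= => ->.
rewrite /ampp /ampq sqrrN !exprMn -mulrDr h mulr1//.
Qed.

Lemma fN_wsum N x : fN a r N x = ws (ampp N) (ampq N) N x.
Proof.
have ReZ (c : R) (z : R[i]) : complex.Re (c%:C * z)%C = c * complex.Re z.
  by case: z => u v /=; rewrite mul0r subr0.
rewrite /fN ReZ big_add1/= big_mkord.
rewrite (big_morph (@complex.Re R) (id1 := 0) (op1 := +%R)); last 2 first.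
- by move=> [? ?] [? ?].
- by [].
rewrite mulr_sumr; apply: eq_bigr => i _.
rewrite ha_conj// hr_neg// dotvNl /ampp /ampq /wave /theta /rpos /ampc /ee.
case: (a (i.+1)%:Z) => u v /=; rewrite mulrN cosN sinN; ring.
Qed.

Section characteristic_functions.
Variables (k : nat) (t : 'I_k -> R) (y : 'I_k -> V).

(** Its integral against [mu] is the variance of sum_j t j F(y j). The phase 0 gives the cosines the
    shape of [measurable_phase]. *)
Definition covT (l : V) : R :=
  \sum_(j < k) \sum_(j' < k) t j * t j' * cos (2 * pi * dotv (y j - y j') l + 0).

(** With [Q], the amplitudes of sum_j t j f_N(x + y j) seen as one wave sum in x: here the
    translation is by y j. *)
Let P N i := \sum_(j < k) t j * wv (ampp N) (ampq N) i (y j).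
Let Q N i := \sum_(j < k) t j * wv (ampq N) (fun i => - ampp N i) i (y j).
Let c1 : R := \sum_(j < k) `|t j|.

Lemma sum_fN_wsum N x : \sum_(j < k) t j * fN a r N (x + y j) = ws (P N) (Q N) N x.
Proof.
under eq_bigr do rewrite fN_wsum addrC wsum_translate wsumZ.
rewrite /wsum exchange_big/=; apply: eq_bigr => i _.
by rewrite /wave !mulr_suml -big_split.
Qed.

(** The mean square of the i-th wave is thus proportional to [covT] at its direction, so the total
    variance is an average of [covT] over the directions, to which weak convergence applies. *)
Let PQ N i : P N i ^+ 2 + Q N i ^+ 2 = ampc N ^+ 2 * covT (rpos i).
Proof.
rewrite !expr2 /P /Q !mulr_suml -big_split /covT mulr_sumr/=; apply: eq_bigr => j _.
rewrite !mulr_sumr -big_split /=; apply: eq_bigr => j' _.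
rewrite addr0 dotvC dotvDr dotvNr mulrBr -!/(theta rpos i _) cosB -expr2 -(amp_sqr N i) /wave.
ring.
Qed.

Let covT_le l : `|covT l| <= c1 ^+ 2.
Proof.
rewrite (le_trans (ler_norm_sum _ _ _))// expr2 mulr_suml; apply: ler_sum => j _.
rewrite (le_trans (ler_norm_sum _ _ _))// mulr_sumr; apply: ler_sum => j' _.
by rewrite !normrM ler_piMr// ?mulr_ge0// ler_norml cos_geN1 cos_le1.
Qed.

Let c10 : 0 <= c1. Proof. exact: sumr_ge0. Qed.

Let PQle N i : P N i ^+ 2 + Q N i ^+ 2 <= (ampc N * c1) ^+ 2.
Proof.
rewrite PQ [leRHS]exprMn; apply: ler_wpM2l; first exact: sqr_ge0.
exact: le_trans (ler_norm _) (covT_le _).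
Qed.

Let PQle2 N i : `|P N i| + `|Q N i| <= 2 * (ampc N * c1).
Proof.
have h := PQle N i; have c0 : 0 <= ampc N * c1 by rewrite mulr_ge0 ?ampc_ge0.
rewrite mulr_natl mulr2n lerD//; apply: ler_of_sqr => //; rewrite real_normK ?num_real//;
  by rewrite (le_trans _ h)// ?lerDl ?lerDr sqr_ge0.
Qed.

(** Each of the N waves contributes an error of order u^3 with u = [ampc N * c1]. Since N [ampc N]^2
    = 2, the total is of order u, that is N^(-1/2). *)
Lemma clt_fN N phi eta : (0 < N)%N -> ampc N * c1 <= 1 -> 0 < eta ->
  \forall Rad \near +oo,
  `|Ex (unifB m Rad) (fun x => cos (\sum_(j < k) t j * fN a r N (x + y j) + phi)) -
    expR (- ((2 * N%:R)^-1 * \sum_(i < N) covT (rpos i))) * cos phi| <=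
  50 * c1 ^+ 2 * (ampc N * c1) + eta.
Proof.
move=> N0 cT eta0.
have N1 : 0 < N%:R :> R by rewrite ltr0n.
have u0 : 0 <= ampc N * c1 by rewrite mulr_ge0 ?ampc_ge0.
have dE i : (P N i ^+ 2 + Q N i ^+ 2) / 4 = (2 * N%:R)^-1 * covT (rpos i).
  by rewrite PQ ampc_sqr//; field; rewrite gt_eqF.
have u2 : (ampc N * c1) ^+ 2 <= ampc N * c1 by rewrite expr2 ler_piMl.
have d0 i : 0 <= (P N i ^+ 2 + Q N i ^+ 2) / 4 by rewrite divr_ge0// addr_ge0 ?sqr_ge0.
have dle i : (P N i ^+ 2 + Q N i ^+ 2) / 4 <= (ampc N * c1) ^+ 2 / 4.
  by rewrite ler_pM2r.
have d1 i : (P N i ^+ 2 + Q N i ^+ 2) / 4 <= 1.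
  by rewrite (le_trans (dle i))//; lra.
have ind (n : nat) (c : 'I_n -> rat) : \sum_(i < n) ratr (c i) *: rpos i = 0 -> forall i, c i = 0.
  exact: hr_Qind.
have := @clt R m rpos ind (P N) (Q N) N phi eta d1 eta0.
apply: filterS => Rad.
under eq_Ex do rewrite -sum_fN_wsum.
rewrite mulr_sumr; under eq_bigr do rewrite dE.
move=> h; apply: (le_trans h); rewrite lerD2r.
(* The three errors are at most 8 u^3, 16 u^4 and u^4 / 16; as u <= 1, their sum is below 25 u^3. *)
apply: (@le_trans _ _ (\sum_(i < N) 25 * (ampc N * c1) ^+ 3)).
  apply: ler_sum => i _.
  have b0 : 0 <= `|P N i| + `|Q N i| by rewrite addr_ge0.
  have bu := PQle2 N i; have := d0 i; have := dle i.
  set b := `|P N i| + `|Q N i| in b0 bu *; set dd := _ / 4; set u := ampc N * c1 in u0 u2 bu cT *.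
  move=> h1 h2.
  have b3 : b ^+ 3 <= (2 * u) ^+ 3 by rewrite lerXn2r// nnegrE mulr_ge0.
  have b4 : b ^+ 4 <= (2 * u) ^+ 4 by rewrite lerXn2r// nnegrE mulr_ge0.
  have b5 : dd ^+ 2 <= (u ^+ 2 / 4) ^+ 2 by rewrite lerXn2r// nnegrE (le_trans h2).
  have u34 : u ^+ 4 <= u ^+ 3 by rewrite exprS ler_piMl// exprn_ge0.
  have u3 : 0 <= u ^+ 3 by exact: exprn_ge0.
  have e4 : (2 * u) ^+ 4 = 16 * u ^+ 4 by ring.
  have e3 : (2 * u) ^+ 3 = 8 * u ^+ 3 by ring.
  have e5 : (u ^+ 2 / 4) ^+ 2 = u ^+ 4 / 16 by field.
  by move: b3 b4 b5; rewrite e3 e4 e5; lra.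
rewrite sumr_const card_ord -mulr_natl le_eqVlt; apply/orP; left; apply/eqP.
rewrite exprSr exprMn ampc_sqr//; field; by rewrite gt_eqF.
Qed.

End characteristic_functions.

Section convergence.
Variables (phi : nat -> nat) (mu : probability (BorelRm R m) R).
Hypothesis hphi : forall k, (phi k < phi k.+1)%N.
Hypothesis hmu_lim : forall f : V -> R, continuous f ->
      (fun k => (2 * (phi k)%:R)^-1 *
         \sum_(1 <= n < (phi k).+1) (f (r n%:Z) + f (r (- n%:Z))))
      @ \oo --> fine (\int[mu]_(l in setT) (f l)%:E)%E.
Variables (d : measure_display) (T : measurableType d) (P : probability T R).
Variable F : T -> V -> R.
Hypothesis hF_gauss : centred_gaussian_field P F.
Hypothesis hF_cov : forall x y : V,
      ('E_P[fun w => (F w x * F w y)%R])%E = (complex.Re (covK mu (x - y)))%:E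
      /\ complex.Im (covK mu (x - y)) = 0.

Lemma phi_ge n : (n <= phi n)%N.
Proof. by elim: n => // n IH; rewrite (leq_ltn_trans IH). Qed.

Lemma ampc_cvg : (fun n => ampc (phi n)) @ \oo --> 0.
Proof.
apply/cvgrPdist_le => e e0.
have [n0 n0e] : exists n : nat, 2 / e ^+ 2 < n%:R.
  by have [n _ /(_ n (leqnn n))] := @nbhs_infty_gtr R (2 / e ^+ 2); exists n.
exists n0.+1 => // n /= nn0.
have n1 : (0 < phi n)%N by rewrite (leq_trans _ (phi_ge n))// (leq_ltn_trans _ nn0).
rewrite sub0r normrN ger0_norm ?ampc_ge0//; apply: ler_of_sqr; first exact: ltW.
rewrite ampc_sqr// ler_pdivrMr ?ltr0n// mulrC -ler_pdivrMr ?exprn_gt0//.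
by rewrite (le_trans (ltW n0e))// ler_nat (leq_trans _ (phi_ge n))// ltnW.
Qed.

(** Both means are compared with exp(-D) cos psi, D being the half-variance for finite N: the
    central limit theorem on one side, the convergence of D on the other. *)
Lemma charfun_cvg k (t : 'I_k -> R) (y : 'I_k -> V) psi e : 0 < e ->
  \forall n \near \oo, \forall Rad \near +oo,
  `|Ex (unifB m Rad) (fun x => cos (\sum_(j < k) t j * fN a r (phi n) (x + y j) + psi)) -
    Ex P (fun w => cos (\sum_(j < k) t j * F w (y j) + psi))| <= e.
Proof.
move=> e0; set c1 : R := \sum_(j < k) `|t j|.
have c10 : 0 <= c1 by exact: sumr_ge0.
have [mF gF] := hF_gauss.
have bc j j' : bmeas (fun l : BV => cos (2 * pi * dotv (y j - y j') l + 0)).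
  by apply: bmeas_cos; exact: measurable_phase.
have covE : Ex mu (covT t y) =
    \sum_(j < k) \sum_(j' < k) t j * t j' * complex.Re (covK mu (y j - y j')).
  rewrite /covT Ex_sum => [|j]; last by apply: bmeas_sum => j'; exact: bmeasZ.
  apply: eq_bigr => j _; rewrite Ex_sum => [|j']; last exact: bmeasZ.
  apply: eq_bigr => j' _; rewrite ExZ//; congr (_ * _).
  by apply: eq_Ex => l; rewrite addr0.
have gauss : Ex P (fun w => cos (\sum_(j < k) t j * F w (y j) + psi)) =
    expR (- (Ex mu (covT t y) / 2)) * cos psi.
  have [sigma s0 hs] := gF k y t.
  apply: (@gauss0_char _ _ _ _ (fun w => \sum_(j < k) t j * F w (y j)) sigma) => //.
    by apply: measurable_sum => j; apply: measurable_funM.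
  rewrite covE; apply: (second_moment_sum mF (C := fun x y => complex.Re (covK mu (x - y)))).
  by move=> x z; have [] := hF_cov x z.
have ccov : continuous (covT t y : V -> R).
  have cC (c : R) (h : V -> R) : continuous h -> continuous (fun x => c * h x).
    by move=> ch x'; apply: continuousM; [exact: cst_continuous|exact: ch].
  apply: continuous_bigsum => j _; apply: continuous_bigsum => j' _; apply: (cC (t j * t j')) => l.
  apply: (@continuous_comp _ _ _ (fun l : V => 2 * pi * dotv (y j - y j') l + 0)); last exact: continuous_cos.
  apply: (@continuousD _ _ _ (fun l : V => 2 * pi * dotv (y j - y j') l)); last exact: cst_continuous.
  by apply: (cC (2 * pi)); exact: continuous_dotv.
(* Evenness makes the symmetric sum over r_n and r_{-n} twice the sum over positive indices. *)
have covN l : covT t y (- l) = covT t y l.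
  apply: eq_bigr => j _; apply: eq_bigr => j' _.
  by rewrite dotvNr mulrN !addr0 cosN.
have Dcvg : (fun n => (2 * (phi n)%:R)^-1 * \sum_(i < phi n) covT t y (rpos i)) @ \oo -->
    Ex mu (covT t y) / 2.
  have E n : (2 * (phi n)%:R)^-1 * \sum_(i < phi n) covT t y (rpos i) =
     ((2 * (phi n)%:R)^-1 * \sum_(1 <= i < (phi n).+1) (covT t y (r i%:Z) + covT t y (r (- i%:Z)))) / 2.
    rewrite -mulrA big_add1 big_mkord; congr (_ * _).
    rewrite mulr_suml; apply: eq_bigr => i _; rewrite hr_neg// covN /rpos.
    by field.
  by apply: (eq_cvgto E); apply: cvgM; [exact: hmu_lim|exact: cvg_cst].
have ecvg : (fun n => expR (- ((2 * (phi n)%:R)^-1 * \sum_(i < phi n) covT t y (rpos i))) * cos psi)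
    @ \oo --> expR (- (Ex mu (covT t y) / 2)) * cos psi.
  apply: cvgM; last exact: cvg_cst.
  by apply: continuous_cvg; [exact: continuous_expR|exact: cvgN].
have e2 : 0 < e / 2 by rewrite divr_gt0.
have e4 : 0 < e / 4 by rewrite divr_gt0.
have ucvg : (fun n => ampc (phi n) * c1) @ \oo --> 0.
  by rewrite -(mul0r c1); apply: cvgM; [exact: ampc_cvg|exact: cvg_cst].
have vcvg : (fun n => 50 * c1 ^+ 2 * (ampc (phi n) * c1)) @ \oo --> 0.
  by rewrite -(mulr0 (50 * c1 ^+ 2)); apply: cvgM; [exact: cvg_cst|exact: ucvg].
have H1 : \forall n \near \oo, ampc (phi n) * c1 < 1 by exact: (cvgr_lt _ ucvg _ ltr01).
have H2 : \forall n \near \oo, 50 * c1 ^+ 2 * (ampc (phi n) * c1) < e / 4.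
  exact: (cvgr_lt _ vcvg _ e4).
move/cvgrPdist_le : (ecvg) => /(_ _ e2) H3.
have H4 : \forall n \near \oo, (0 < phi n)%N.
  by exists 1%N => // n /= n1; rewrite (leq_trans n1)// phi_ge.
apply: filterS (filterI (filterI H1 H2) (filterI H3 H4)) => n [[h1 h2] [h3 h4]].
have := @clt_fN k t y (phi n) psi (e / 4) h4 (ltW h1) e4.
apply: filterS => Rad h; rewrite gauss.
have := ler_distD (expR (- ((2 * (phi n)%:R)^-1 * \sum_(i < phi n) covT t y (rpos i))) * cos psi)
  (Ex (unifB m Rad) (fun x => cos (\sum_(j < k) t j * fN a r (phi n) (x + y j) + psi)))
  (expR (- (Ex mu (covT t y) / 2)) * cos psi).
rewrite -/c1 in h; rewrite distrC in h3.
by move=> h5; move: h h2 h3; rewrite -/c1; lra.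
Qed.

Definition linphases k : set (('I_k -> R) -> R) :=
  [set th | exists (t : 'I_k -> R) psi, th = fun h => \sum_(j < k) t j * h j + psi].

Lemma linphases_set k : phase_set (@linphases k).
Proof.
split=> [c|_ _ [t [p ->]] [t' [p' ->]]|_ [t [p ->]]].
- exists (fun=> 0), c; apply/funext => h; rewrite big1 ?add0r// => j _; exact: mul0r.
- exists (fun j => t j + t' j), (p + p'); apply/funext => h.
  by under [in RHS]eq_bigr do rewrite mulrDl; rewrite big_split/=; ring.
- exists (fun j => - t j), (- p); apply/funext => h; rewrite opprD -sumrN; congr (_ + _).
  by apply: eq_bigr => j _; rewrite mulNr.
Qed.

Lemma bmeas_linphases k (G : ('I_k -> R) -> R) d' (T' : measurableType d') (X : 'I_k -> T' -> R) :
  trigpoly (@linphases k) G -> (forall j, measurable_fun setT (X j)) ->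
  bmeas (fun x => G (fun j => X j x)).
Proof.
move=> tG mX; elim: tG => [_ [t [psi ->]]|f g _ IHf _ IHg|c f _ IH].
- apply: bmeas_cos; apply: measurable_funD => //.
  by apply: measurable_sum => j; exact: measurable_funM.
- exact: bmeasD.
- exact: bmeasZ.
Qed.

Lemma measurable_fN N y : measurable_fun setT (fun x : BV => fN a r N (x + y)).
Proof.
apply: continuous_measurable_rV => x.
have E : (fun x => fN a r N (x + y)) =
    (fun x => wsum rpos (wv (ampp N) (ampq N) ^~ y) (wv (ampq N) (fun i => - ampp N i) ^~ y) N x).
  by apply/funext => z; rewrite fN_wsum addrC wsum_translate.
rewrite E; exact: continuous_wsum.
Qed.

Lemma trigpoly_cvg k (y : 'I_k -> V) (G : ('I_k -> R) -> R) e : trigpoly (@linphases k) G -> 0 < e ->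
  \forall n \near \oo, \forall Rad \near +oo,
  `|Ex (unifB m Rad) (fun x => G (fun j => fN a r (phi n) (x + y j))) -
    Ex P (fun w => G (fun j => F w (y j)))| <= e.
Proof.
have [mF _] := hF_gauss.
have b1 n G' : trigpoly (@linphases k) G' -> bmeas (fun x : BV => G' (fun j => fN a r (phi n) (x + y j))).
  by move=> h; apply: bmeas_linphases h _ => j; exact: measurable_fN.
have b2 G' : trigpoly (@linphases k) G' -> bmeas (fun w => G' (fun j => F w (y j))).
  by move=> h; apply: (bmeas_linphases h).
move=> tG; elim: tG e => [_ [t [psi ->]]|f g tf IHf tg IHg|c f tf IH] e e0.
- exact: charfun_cvg.
- have e2 : 0 < e / 2 by rewrite divr_gt0.
  apply: filterS2 (IHf _ e2) (IHg _ e2) => n; apply: filterS2 => Rad.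
  rewrite !ExD; [|exact: b2..|exact: b1|exact: b1].
  set A := Ex _ _; set A' := Ex _ _; set B := Ex _ _; set B' := Ex _ _ => h1 h2.
  have -> : A + B - (A' + B') = (A - A') + (B - B') by ring.
  by rewrite (splitr e) (le_trans (ler_normD _ _))// lerD.
- have ec : 0 < e / (`|c| + 1) by rewrite divr_gt0// ltr_wpDl.
  apply: filterS (IH _ ec) => n; apply: filterS => Rad.
  rewrite !ExZ; [|exact: b2|exact: b1].
  rewrite ler_pdivlMr ?ltr_wpDl// => h; rewrite -mulrBr normrM mulrC (le_trans _ h)//.
  by rewrite ler_wpM2l// lerDl.
Qed.

End convergence.

End random_wave.

(** * Comparison of the laws *)

Section bernoulli_weights.
Context (R : realType) (U : finType) (v : U -> R).

(** The probability of the outcome e for independent Bernoulli variables with parameters v u. *)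
Definition bweight (e : {ffun U -> bool}) : R := \prod_u (if e u then v u else 1 - v u).

Lemma bweight_sum : \sum_e bweight e = 1.
Proof.
rewrite /bweight -(bigA_distr_bigA (fun u (b : bool) => if b then v u else 1 - v u)).
by apply: big1 => u _; rewrite big_bool/= addrC subrK.
Qed.

Lemma bweight_cov u u' :
  \sum_e bweight e * (((e u)%:R - v u) * ((e u')%:R - v u')) =
  if u == u' then v u * (1 - v u) else 0.
Proof.
pose g x (b : bool) : R := (if b then v x else 1 - v x) *
  ((if x == u then b%:R - v x else 1) * (if x == u' then b%:R - v x else 1)).
have pE (e : {ffun U -> bool}) (z : U) :
    \prod_x (if x == z then (e x)%:R - v x else 1) = (e z)%:R - v z.
  by rewrite (bigD1 z)//= eqxx big1 ?mulr1// => x /negbTE ->.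
transitivity (\sum_(e : {ffun U -> bool}) \prod_x g x (e x)).
  by apply: eq_bigr => e _; rewrite !big_split/= !pE.
rewrite -(bigA_distr_bigA g); have [uu'|uu'] := eqVneq u u'.
  rewrite (bigD1 (I := U) u)//= [X in _ * X]big1 ?mulr1 => [|x xu]; last first.
    by rewrite big_bool /g -uu' (negbTE xu)/=; ring.
  by rewrite big_bool /g -uu' eqxx/=; ring.
rewrite (bigD1 (I := U) u)//= big_bool /= /g eqxx (negbTE uu')/=.
by set X := \prod_(_ | _) _; ring.
Qed.

Hypothesis v01 : forall u, 0 <= v u <= 1.

Lemma bweight_ge0 e : 0 <= bweight e.
Proof.
apply: prodr_ge0 => u _; have /andP[v0 v1] := v01 u.
by case: (e u); rewrite ?subr_ge0.
Qed.

End bernoulli_weights.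

Section bernstein.
Context (R : realType) (k n : nat) (V : 'I_k -> R).
Hypothesis V01 : forall j, 0 <= V j <= 1.
Local Notation U := ('I_k * 'I_n)%type.
Local Notation wt := (bweight (fun u : U => V u.1)).

(** Chebyshev's inequality, with the binomial variance n V (1 - V) bounded by n / 4. *)
Lemma bernstein_tail j (c : R) : 0 < c -> (0 < n)%N ->
  \sum_(e : {ffun U -> bool} | ~~ (`|\sum_(i < n) ((e (j, i))%:R - V j)| <= n%:R * c)) wt e
    <= (4 * n%:R * c ^+ 2)^-1.
Proof.
move=> c0 n0; have n1 : 0 < n%:R :> R by rewrite ltr0n.
have var : \sum_e wt e * (\sum_(i < n) ((e (j, i))%:R - V j)) ^+ 2 = n%:R * (V j * (1 - V j)).
  under eq_bigr do rewrite expr2 mulr_suml mulr_sumr.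
  rewrite exchange_big/=.
  transitivity (\sum_(i < n) V j * (1 - V j)); last first.
    by rewrite sumr_const card_ord [RHS]mulr_natl.
  apply: eq_bigr => i _.
  under eq_bigr do rewrite mulr_sumr mulr_sumr.
  rewrite exchange_big/= (bigD1 i)//= [X in _ + X]big1 ?addr0 => [|i' ii'].
    by have := bweight_cov (fun u : U => V u.1) (j, i) (j, i); rewrite eqxx.
  have := bweight_cov (fun u : U => V u.1) (j, i) (j, i'); rewrite xpair_eqE eqxx/=.
  by rewrite eq_sym (negbTE ii').
have w0 e : 0 <= wt e by apply: bweight_ge0 => u; exact: V01.
have h4 : V j * (1 - V j) <= 4^-1 by have := sqr_ge0 (V j - 2^-1); nra.
have nc : 0 < n%:R * c by rewrite mulr_gt0.
rewrite -(ler_pM2l (exprn_gt0 2 nc)) mulr_sumr.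
apply: (@le_trans _ _ (n%:R * (V j * (1 - V j)))); last first.
  rewrite (le_trans (ler_wpM2l (ltW n1) h4))// le_eqVlt; apply/orP; left; apply/eqP.
  by field; rewrite !gt_eqF.
rewrite -var big_mkcond/=; apply: ler_sum => e _.
case: ifPn => [|_]; last by rewrite mulr_ge0 ?sqr_ge0.
rewrite -ltNge => h; rewrite mulrC ler_wpM2l// -[leRHS]real_normK ?num_real//.
by rewrite lerXn2r ?nnegrE// ltW.
Qed.

End bernstein.

(** On [-1, 1] the derivative of the sine is at least cos 1, so closeness of sines gives closeness
    of the arguments. *)
Lemma sin_dist_ge (R : realType) (x y : R) : `|x| <= 1 -> `|y| <= 1 ->
  cos 1 * `|x - y| <= `|sin x - sin y|.
Proof.
wlog xy : x y / y <= x.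
  move=> h x1 y1; have [xy|/ltW xy] := leP y x; first exact: h.
  by rewrite distrC [leRHS]distrC; exact: h.
rewrite !ler_norml => /andP[x0 x1] /andP[y0 y1].
have [c ch ->] := @MVT_segment R sin cos y x xy (fun z _ => is_derive_sin z)
  (@continuous_subspaceT _ _ _ _ (@continuous_sin R)).
rewrite normrM ler_wpM2r// (le_trans _ (ler_norm _))//.
move: ch; rewrite in_itv/= => /andP[c0 c1].
have p1 : (1 : R) \in `[0, pi]%R.
  by rewrite in_itv/= ler01 (le_trans _ (pi_ge2 R))// ler1n.
have c1' : `|c| <= 1 by rewrite ler_norml (le_trans y0 c0) (le_trans c1 x1).
have pc : `|c| \in `[0, pi]%R.
  by rewrite in_itv/= normr_ge0 (le_trans c1')// (le_trans _ (pi_ge2 R))// ler1n.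
have -> : cos c = cos `|c| by have [//|_] := ger0P c; rewrite cosN.
by rewrite leNgt ltr_cos// -leNgt.
Qed.

(* Products of Bernstein weights in the variables [(1 + sin (h j / L)) / 2]:
   trigonometric polynomials in [h] which nevertheless localise [h]. *)
Lemma separating_weights (R : realType) (k : nat) (L tau e : R) :
  0 < L -> 0 < tau -> 0 < e ->
  exists (I : finType) (w : I -> ('I_k -> R) -> R) (close : I -> ('I_k -> R) -> Prop),
  [/\ forall i, trigpoly (@linphases R k) (w i),
      forall i h, 0 <= w i h,
      forall h, \sum_i w i h = 1,
      forall h, \sum_(i | ~~ `[< close i h >]) w i h <= e &
      forall i h h', (forall j, `|h j| <= L) -> (forall j, `|h' j| <= L) ->
        close i h -> close i h' -> forall j, `|h j - h' j| <= tau].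
Proof.
move=> L0 t0 e0.
(* Two points close to the same i have values of V within 2 c, hence sines within 4 c, hence
   arguments within 4 c L / cos 1 = tau. *)
pose c : R := tau * cos 1 / (4 * L).
have cos0 : 0 < cos 1 :> R := cos1_gt0 R.
have c0 : 0 < c by rewrite divr_gt0// mulr_gt0.
(* The union bound over k coordinates of [bernstein_tail] gives k / (4 n c^2), made at most e. *)
have [n nb] : exists n : nat, k%:R / (4 * c ^+ 2 * e) < n%:R.
  by have [n _ /(_ n (leqnn n))] := @nbhs_infty_gtr R (k%:R / (4 * c ^+ 2 * e)); exists n.
have d0 : 0 < 4 * c ^+ 2 * e.
  by apply: mulr_gt0 => //; apply: mulr_gt0 => //; exact: exprn_gt0.
have n1 : 0 < n%:R :> R by rewrite (le_lt_trans _ nb)// divr_ge0// ltW.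
have n0 : (0 < n)%N by rewrite -(ltr0n R).
pose V (h : 'I_k -> R) j := (1 + sin (h j / L)) / 2.
have V01 h j : 0 <= V h j <= 1.
  have := sin_geN1 (h j / L); have := sin_le1 (h j / L); rewrite /V => h1 h2.
  by apply/andP; split; lra.
pose U : finType := ('I_k * 'I_n)%type.
pose I : finType := {ffun U -> bool}.
pose close (i : I) h := forall j, `|\sum_(l < n) ((i (j, l))%:R - V h j)| <= n%:R * c.
exists I, (fun i h => bweight (fun u : U => V h u.1) i), close; split.
- have tV j : trigpoly (@linphases R k) (fun h => V h j).
    have tc := trigpoly_cst (linphases_set R k) (2^-1).
    have ts : trigpoly (@linphases R k) (fun h => sin (h j / L)).
      have -> : (fun h : 'I_k -> R => sin (h j / L)) = fun h =>
          cos (\sum_(l < k) (if l == j then L^-1 else 0) * h l + - (pi / 2)).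
        apply/funext => h; rewrite sin_cosB (bigD1 j)//= eqxx big1 ?addr0 1?[h j * _]mulrC//.
        by move=> l /negbTE ->; rewrite mul0r.
      by apply: trigpoly_cos; exists (fun l => if l == j then L^-1 else 0), (- (pi / 2)).
    have -> : (fun h => V h j) = (fun h => 2^-1 + 2^-1 * sin (h j / L)).
      by apply/funext => h; rewrite /V; field.
    by apply: trigpolyD => //; exact: trigpolyZ.
  move=> i; apply: (trigpoly_prod (linphases_set R k)) => u.
  case: (i u); first exact: tV.
  have -> : (fun h => 1 - V h u.1) = (fun h => 1 + (-1) * V h u.1).
    by apply/funext => h; rewrite mulN1r.
  apply: trigpolyD; first exact: trigpoly_cst (linphases_set R k) _.
  exact: trigpolyZ.
- by move=> i h; apply: bweight_ge0 => u; exact: V01.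
- by move=> h; exact: bweight_sum.
- move=> h.
  have w0 i : 0 <= bweight (fun u : U => V h u.1) i by apply: bweight_ge0 => u; exact: V01.
  apply: (@le_trans _ _ (\sum_(j < k) \sum_(i : I | ~~ (`|\sum_(l < n) ((i (j, l))%:R - V h j)| <= n%:R * c))
      bweight (fun u : U => V h u.1) i)).
    under [leRHS]eq_bigr do rewrite big_mkcond.
    rewrite exchange_big/= big_mkcond; apply: ler_sum => i _.
    case: ifPn => [/asboolPn|_]; last by apply: sumr_ge0 => j _; case: ifP.
    move=> /existsNP[j /negP hj]; rewrite (bigD1 j)//= hj lerDl.
    by apply: sumr_ge0 => j' _; case: ifP.
  apply: (@le_trans _ _ (\sum_(j < k) (4 * n%:R * c ^+ 2)^-1)).
    by apply: ler_sum => j _; exact: bernstein_tail.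
  have d1 : 0 < 4 * n%:R * c ^+ 2.
    by apply: mulr_gt0; [exact: mulr_gt0|exact: exprn_gt0].
  have -> : \sum_(j < k) (4 * n%:R * c ^+ 2)^-1 = k%:R / (4 * n%:R * c ^+ 2).
    by rewrite sumr_const card_ord [RHS]mulr_natl.
  rewrite ler_pdivrMr//.
  move: nb; rewrite ltr_pdivrMr// => /ltW /le_trans; apply.
  by rewrite le_eqVlt; apply/orP; left; apply/eqP; ring.
move=> i h h' hL hL' ci ci' j.
have x1 (g : 'I_k -> R) : (forall j, `|g j| <= L) -> `|g j / L| <= 1.
  by move=> gL; rewrite normrM normfV [`|L|]gtr0_norm// ler_pdivrMr// mul1r.
have := sin_dist_ge (x1 _ hL) (x1 _ hL').
have VE g : sin (g j / L) = 2 * V g j - 1 by rewrite /V; field.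
have dV : `|V h j - V h' j| <= 2 * c.
  have sE g : \sum_(l < n) ((i (j, l))%:R - V g j) = \sum_(l < n) (i (j, l))%:R - n%:R * V g j.
    by rewrite sumrB sumr_const card_ord mulr_natl.
  have := ci j; have := ci' j; rewrite !sE.
  set S := \sum_(_ < _) _ => h1 h2.
  rewrite -(ler_pM2l n1) -{1}[n%:R]gtr0_norm// -normrM.
  have -> : n%:R * (V h j - V h' j) = (S - n%:R * V h' j) - (S - n%:R * V h j) by ring.
  by rewrite (le_trans (ler_normB _ _))//; lra.
rewrite !VE -mulrBl normrM normfV [`|L|]gtr0_norm//.
have -> : 2 * V h j - 1 - (2 * V h' j - 1) = 2 * (V h j - V h' j) by ring.
rewrite normrM [`|2|]ger0_norm// => h1.
have h2 : cos 1 * (`|h j - h' j| / L) <= 4 * c by rewrite (le_trans h1)//; lra.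
move: h2; rewrite mulrA ler_pdivrMr// /c.
have -> : 4 * (tau * cos 1 / (4 * L)) * L = cos 1 * tau by field; rewrite gt_eqF.
by rewrite ler_pM2l.
Qed.

(** One representative is picked in each grid cube that meets the ball, so the net lies in the ball;
    the mesh delta / (m + 1) makes the sum of m coordinate differences less than delta. *)
Lemma eball_net (R : realType) (m : nat) (W delta : R) : 0 < W -> 0 < delta ->
  exists (k : nat) (y : 'I_k -> 'rV[R]_m),
    (forall j, eball 0 W (y j)) /\
    forall z, eball 0 W z -> exists j, enorm (z - y j) < delta.
Proof.
move=> W0 d0; pose h : R := delta / (m%:R + 1).
have h0 : 0 < h by rewrite divr_gt0// ltr_wpDl.
pose M := Num.truncn (2 * W / h).
pose cube (z : 'rV[R]_m) : {ffun 'I_m -> 'I_M.+1} := [ffun j => inord (Num.truncn ((z ord0 j + W) / h))].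
have /choice[Y hY] : forall f, exists y : 'rV[R]_m, eball 0 W y /\
    ((exists2 z, eball 0 W z & cube z = f) -> cube y = f).
  move=> f; have [[z Bz zf]|nz] := pselect (exists2 z, eball 0 W z & cube z = f).
    by exists z.
  by exists 0; split; [exact: eball0|].
exists #|{ffun 'I_m -> 'I_M.+1}|, (fun j => Y (enum_val j)); split.
  by move=> j; have [] := hY (enum_val j).
move=> z Bz; exists (enum_rank (cube z)); rewrite enum_rankK.
have [By /(_ (ex_intro2 _ _ z Bz erefl)) E] := hY (cube z).
set y := Y (cube z) in By E *.
have tr (x : 'rV[R]_m) j : eball 0 W x ->
    (nat_of_ord (cube x j))%:R <= (x ord0 j + W) / h < (nat_of_ord (cube x j)).+1%:R.
  rewrite /eball/= subr0 => Bx; have := coord_le_enorm x j => xj.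
  have := le_lt_trans xj Bx; rewrite ltr_norml => /andP[x1 x2].
  have p0 : 0 <= (x ord0 j + W) / h by rewrite divr_ge0 ?ltW//; lra.
  rewrite ffunE inordK ?truncn_itv// ltnS; apply: le_truncn.
  by rewrite ler_pM2r ?invr_gt0//; lra.
have dj j : `|(z - y) ord0 j| <= h.
  have /andP[a1 a2] := tr z j Bz; have /andP[b1 b2] := tr y j By.
  move: a1 a2 b1 b2; rewrite E -natr1; set c := _%:R => a1 a2 b1 b2.
  rewrite ler_pdivlMr// in a1; rewrite ler_pdivlMr// in b1.
  rewrite ltr_pdivrMr// in a2; rewrite ltr_pdivrMr// in b2.
  rewrite mulrDl mul1r in a2; rewrite mulrDl mul1r in b2.
  by rewrite ler_norml !mxE; apply/andP; split; lra.
rewrite (le_lt_trans (enorm_le_sum _))//.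
rewrite (le_lt_trans (ler_sum _ (fun j _ => dj j)))// sumr_const card_ord -[h *+ m]mulr_natl /h.
by rewrite mulrA ltr_pdivrMr ?ltr_wpDl// mulrC ltr_pM2l// ltrDl.
Qed.

(** * Closeness in C^s from closeness at finitely many points *)

Section regularity.
Context (R : realType) (m s : nat) (W : R) (W0 : 0 < W).
Local Notation V := 'rV[R]_m.
Local Notation B := (eball (0 : V) W).
Local Notation S := (@Sset R m s W).
(* [TT e K]: the laws under consideration give mass at most [e] to the complement of [K]. *)
Variable TT : R -> set (set (V -> R)).
Hypothesis TTI : forall e1 e2 K1 K2, TT e1 K1 -> TT e2 K2 -> TT (e1 + e2) (K1 `&` K2).
Hypothesis TTmod : forall e eta, 0 < e -> 0 < eta ->
  exists delta, [/\ 0 < delta, delta <= W & TT e (Smod s W eta delta)].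
Hypothesis TTbd : forall e, 0 < e -> exists2 L, 0 < L & TT e (Sbd s W L).

(** Induction on the order through [interpolation_step]; each order intersects K with one more
    modulus class and spends half of the allowed mass. *)
Lemma derivatives_close l e e1 : (l <= s)%N -> 0 < e -> 0 < e1 ->
  exists tau K, [/\ 0 < tau, TT e1 K, K `<=` S &
    forall p q, K p -> K q -> (forall y, B y -> `|p y - q y| <= tau) ->
    forall al, (mi_order al <= l)%N -> forall y, B y -> `|dalpha al (fun z => p z - q z) y| <= e].
Proof.
elim: l e e1 => [|l IH] e e1 ls e0 e10.
  have [L L0 TL] := TTbd e10; exists e, (Sbd s W L); split => //; first by move=> p [].
  by move=> p q _ _ pq al; rewrite leqn0 => /eqP al0 y By; rewrite mi_order0// pq.
have e12 : 0 < e1 / 2 by rewrite divr_gt0.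
have [|delta [d0 dW Td]] := @TTmod (e1 / 2) (e / 4) e12; first by rewrite divr_gt0.
(* With tau = e delta / 8 and eta = e / 4 the bound 4 tau / delta + 2 eta is exactly e. *)
have e'0 : 0 < Num.min e (e * delta / 8) by rewrite lt_min e0 divr_gt0// mulr_gt0.
have [tau [K [t0 TK KS h]]] := IH _ _ (ltnW ls) e'0 e12.
exists tau, (K `&` Smod s W (e / 4) delta); split => //.
- by rewrite [e1]splitr; exact: TTI.
- by move=> p [/KS].
move=> p q [Kp Mp] [Kq Mq] pq al; rewrite leq_eqVlt => /orP[/eqP alE|].
  have [i [al' [al'l E]]] := dalphaS R alE.
  have := interpolation_step W0 (KS _ Kp) (KS _ Kq) Mp Mq d0 dW _ _ E (tau := e * delta / 8).
  rewrite al'l alE => /(_ ls ls) H y By.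
  apply: (le_trans (H _ y By)).
    move=> z Bz; apply: (le_trans (h p q Kp Kq pq al' _ z Bz)); first by rewrite al'l.
    by rewrite ge_min lexx orbT.
  by rewrite le_eqVlt; apply/orP; left; apply/eqP; field; rewrite gt_eqF.
rewrite ltnS => all y By; apply: (le_trans (h p q Kp Kq pq al all y By)).
by rewrite ge_min lexx.
Qed.

Lemma Csnorm_close e e1 : 0 < e -> 0 < e1 ->
  exists k (y : 'I_k -> V) (L tau : R) K,
  [/\ 0 < L, 0 < tau, forall j, B (y j), TT e1 K & [/\ K `<=` S,
      forall p j, K p -> `|p (y j)| <= L &
      forall p q, K p -> K q -> (forall j, `|p (y j) - q (y j)| <= tau) ->
        Csnorm s W (fun z => p z - q z) < e]].
Proof.
move=> e0 e10.
have e2 : 0 < e / 2 by rewrite divr_gt0.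
have e12 : 0 < e1 / 2 by rewrite divr_gt0.
have e14 : 0 < e1 / 2 / 2 by rewrite divr_gt0.
have [t0 [K0 [t00 TK0 K0S h]]] := derivatives_close (leqnn s) e2 e12.
have t04 : 0 < t0 / 4 by rewrite divr_gt0.
have [delta [d0 dW Td]] := TTmod e14 t04.
have [L L0 TL] := TTbd e14.
have [k [y [By hy]]] := eball_net m W0 d0.
(* Passing from w to the nearest net point costs t0/4 for p and for q; with t0/2 at the net point
   the total is t0. *)
exists k, y, L, (t0 / 2), (K0 `&` (Smod s W (t0 / 4) delta `&` Sbd s W L)); split => //.
- by rewrite divr_gt0.
- rewrite (splitr e1); apply: TTI => //; rewrite {1}(splitr (e1 / 2)); exact: TTI.
split; first by move=> p [/K0S].
  by move=> p j [_ [_ [_ pL]]]; exact: pL.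
move=> p q [Kp [[_ Mp] _]] [Kq [[_ Mq] _]] pq.
apply: (@le_lt_trans _ _ (e / 2)); last by rewrite ltr_pdivrMr// ltr_pMr// ltr1n.
apply: Csnorm_le => // al z als Bz; apply: h => // w Bw.
have [j wj] := hy w Bw.
have mi0 : (mi_order (fun _ : 'I_m => 0%N) <= s)%N by rewrite /mi_order big1.
have mi00 : mi_order (fun _ : 'I_m => 0%N) = 0%N by rewrite /mi_order big1.
have := Mp _ w (y j) mi0 Bw (By j) wj; have := Mq _ w (y j) mi0 Bw (By j) wj.
rewrite !mi_order0//; have := pq j => h1 h2 h3.
have -> : p w - q w = (p w - p (y j)) + (p (y j) - q (y j)) - (q w - q (y j)) by ring.
rewrite (le_trans (ler_normB _ _))//; have := ler_normD (p w - p (y j)) (p (y j) - q (y j)).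
by move: h1 h2 h3; lra.
Qed.

End regularity.

(** * From localised weights to the Levy-Prokhorov inequality *)

Section comparison.
Context (R : realType) (m s : nat) (W : R) (W0 : 0 < W).
Local Notation V := 'rV[R]_m.
Variables (d1 d2 : measure_display) (T1 : measurableType d1) (T2 : measurableType d2).
Variables (P1 : probability T1 R) (P2 : probability T2 R).
Variables (X1 : T1 -> V -> R) (X2 : T2 -> V -> R).
Hypothesis mX1 : forall A, SBorel s W A -> measurable (X1 @^-1` A).
Hypothesis mX2 : forall A, SBorel s W A -> measurable (X2 @^-1` A).
Variables (K : set (V -> R)) (I : finType) (w : I -> (V -> R) -> R)
  (close : I -> (V -> R) -> Prop) (e e1 : R).
Hypothesis KS : K `<=` Sset s W.
Hypothesis mK : SBorel s W K.
Hypothesis w_ge0 : forall i p, 0 <= w i p.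
Hypothesis w_sum : forall p, \sum_i w i p = 1.
Hypothesis w_leak : forall p, \sum_(i | ~~ `[< close i p >]) w i p <= e1.
Hypothesis w_close : forall i p q, K p -> K q -> close i p -> close i q ->
  Csnorm s W (fun y => p y - q y) < e.
Hypothesis bw1 : forall i, bmeas (fun x => w i (X1 x)).
Hypothesis bw2 : forall i, bmeas (fun x => w i (X2 x)).
Hypothesis w_diff : \sum_i `|Ex P1 (fun x => w i (X1 x)) - Ex P2 (fun x => w i (X2 x))| <= e1.
Hypothesis K1 : (P1 (~` (X1 @^-1` K)) <= e1%:E)%E.
Hypothesis K2 : (P2 (~` (X2 @^-1` K)) <= e1%:E)%E.

(* [G] collects the weights localised near a point of [A `&` K]: it is almost 1
   on [A `&` K] and almost 0 on [K] away from the enlargement of [A]. *)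
Lemma law_le A : SBorel s W A ->
  (P1 (X1 @^-1` A) <= P2 (X2 @^-1` (Senl s W A e)) + (5 * e1)%:E)%E.
Proof.
move=> bA; have AS := SBorel_sub bA.
have mA := mX1 bA; have mE := mX2 (SBorel_Senl W0 e AS).
have mK1 : measurable (~` (X1 @^-1` K)) by apply: measurableC; exact: mX1.
have mK2 : measurable (~` (X2 @^-1` K)) by apply: measurableC; exact: mX2.
have e10 : 0 <= e1 by rewrite (le_trans _ w_diff)// sumr_ge0.
pose EA (i : I) := `[< exists p, [/\ A p, K p & close i p] >].
pose G p := \sum_(i | EA i) w i p.
have G0 p : 0 <= G p by apply: sumr_ge0.
have G1 p : G p <= 1 by rewrite -(w_sum p) [leRHS](bigID EA)/= lerDl sumr_ge0.
have leak p (Q : pred I) : (forall i, Q i -> ~~ `[< close i p >]) -> \sum_(i | Q i) w i p <= e1.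
  move=> hQ; rewrite (le_trans _ (w_leak p))// big_mkcond [leRHS]big_mkcond/=.
  by apply: ler_sum => i _; case: ifPn => [/hQ ->//|_]; case: ifP.
have up p : (p \in A)%:R <= G p + e1 + (p \in ~` K)%:R.
  have [Ap|Ap] := boolP (p \in A); last by rewrite !addr_ge0.
  have [Kp|Kp] := pselect (K p); last first.
    by rewrite (_ : (p \in ~` K) = true) ?lerDr ?addr_ge0//; exact/mem_set.
  have -> : true%:R = G p + \sum_(i | ~~ EA i) w i p :> R.
    by rewrite -[LHS](w_sum p) (bigID EA).
  rewrite -addrA lerD2l (@le_trans _ _ e1) ?lerDl//; apply: leak => i.
  apply: contra => /asboolP ci.
  by apply/asboolP; exists p; split => //; exact: set_mem.
have dn q : G q <= (q \in Senl s W A e)%:R + e1 + (q \in ~` K)%:R.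
  have [Kq|Kq] := pselect (K q); last first.
    by rewrite (_ : (q \in ~` K) = true) ?(le_trans (G1 q)) ?lerDr ?addr_ge0//; exact/mem_set.
  have [Eq|Eq] := boolP (q \in Senl s W A e).
    by rewrite (le_trans (G1 q))// -addrA lerDl addr_ge0.
  rewrite add0r (@le_trans _ _ e1) ?lerDl//; apply: leak => i /asboolP[p [Ap Kp cp]].
  apply/asboolPn => cq; move/negP: Eq; apply; apply/mem_set; split; first exact: KS.
  by exists p => //; exact: w_close cq cp.
have bG1 : bmeas (fun x => G (X1 x)) by exact: bmeas_sum.
have bG2 : bmeas (fun x => G (X2 x)) by exact: bmeas_sum.
have bA1 := bmeas_indic R mA; have bE2 := bmeas_indic R mE.
have bK1 := bmeas_indic R mK1; have bK2 := bmeas_indic R mK2.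
have bc d (T : measurableType d) (f : T -> R) : bmeas f -> bmeas (fun x => f x + e1).
  by move=> bf; apply: bmeasD => //; exact: bmeas_cst.
have iE d (T : measurableType d) (X : T -> V -> R) (D : set (V -> R)) x :
   \1_(X @^-1` D) x = (X x \in D)%:R :> R.
  by rewrite indicE; congr (_%:R); congr nat_of_bool; apply/idP/idP => /set_mem h; exact/mem_set.
(* The constant 5 counts, for each law, the leak of the weights and the complement of K ([H1],
   [H2]), plus the difference of the means ([H3]). *)
have H1 : Ex P1 \1_(X1 @^-1` A) <= Ex P1 (fun x => G (X1 x)) + e1 + Ex P1 \1_(~` (X1 @^-1` K)).
  rewrite -(Ex_cst P1 e1) -!ExD//; [|exact: bc|exact: bmeas_cst].
  apply: le_Ex => //; first by apply: bmeasD => //; exact: bc.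
  by move=> x; rewrite preimage_setC !iE.
have H2 : Ex P2 (fun x => G (X2 x)) <=
    Ex P2 \1_(X2 @^-1` (Senl s W A e)) + e1 + Ex P2 \1_(~` (X2 @^-1` K)).
  rewrite -(Ex_cst P2 e1) -!ExD//; [|exact: bc|exact: bmeas_cst].
  apply: le_Ex => //; first by apply: bmeasD => //; exact: bc.
have H3 : Ex P1 (fun x => G (X1 x)) <= Ex P2 (fun x => G (X2 x)) + e1.
  rewrite -lerBlDl /G !Ex_sum// -sumrB (le_trans _ w_diff)// big_mkcond/=.
  by apply: ler_sum => i _; case: ifP => // _; exact: ler_norm.
rewrite -!Ex_indic// -EFinD lee_fin.
move: K1 K2; rewrite -!Ex_indic// !lee_fin => h1 h2; lra.
Qed.

End comparison.

(** Continuity from below; this gives the tightness of the single law of F, whose paths all lie in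
    C^s. *)
Lemma exhaustion (R : realType) d (T : measurableType d) (P : probability T R) (E : nat -> set T) (e : R) :
  (forall j, measurable (E j)) -> (forall j l, (j <= l)%N -> E j `<=` E l) ->
  (forall w, exists j, E j w) -> 0 < e -> exists j, (P (~` E j) <= e%:E)%E.
Proof.
move=> mE hE cE e0.
have UT : \bigcup_j E j = setT.
  by apply/seteqP; split => // w _; have [j Ejw] := cE w; exists j.
have cv : (P \o E) @ \oo --> 1%:E.
  rewrite -(@probability_setT _ _ _ P) -UT; apply: nondecreasing_cvg_mu => //.
    by rewrite UT.
  by move=> j l jl; apply/subsetPset; exact: hE.
have /fine_cvgP[_ /cvgrPdist_le /(_ _ e0)[j _ /(_ j (leqnn j))]] := cv.
rewrite /= => h; exists j; rewrite probability_setC// -(fineK (fin_num_measure P _ (mE j))).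
by rewrite -EFinB lee_fin (le_trans (ler_norm _) h).
Qed.

Section class_facts.
Context (R : realType) (m s : nat) (W : R) (W0 : 0 < W).
Local Notation V := 'rV[R]_m.

Lemma Smod_antimono (eta delta delta' : R) : delta' <= delta ->
  @Smod R m s W eta delta `<=` Smod s W eta delta'.
Proof.
move=> dd p [Sp h]; split => // al y z als By Bz yz; apply: h => //.
exact: lt_le_trans yz dd.
Qed.

Lemma Sbd_mono (L L' : R) : L <= L' -> @Sbd R m s W L `<=` Sbd s W L'.
Proof. by move=> LL p [Sp h]; split => // y By; exact: le_trans (h y By) LL. Qed.

Lemma Smod_exhaust (p : V -> R) (eta : R) : Sset s W p -> 0 < eta ->
  exists j : nat, Smod s W eta j.+1%:R^-1 p.
Proof.
move=> Sp eta0; have [_ _ _ up] := Sp.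
have /choice[dl hdl] : forall be : {ffun 'I_m -> 'I_s.+1}, exists dl : R, 0 < dl /\
    ((mi_order (fun i => be i : nat) <= s)%N -> forall y z, eball 0 W y -> eball 0 W z ->
     enorm (y - z) < dl ->
     `|dalpha (fun i => be i : nat) p y - dalpha (fun i => be i : nat) p z| < eta).
  move=> be; have [h|h] := boolP (mi_order (fun i => be i : nat) <= s)%N; last by exists 1.
  by have [dl dl0 hd] := up _ h _ eta0; exists dl.
(* The sum dominates each inverse radius, so 1/(j + 1) is below all the radii. *)
have [j hj] : exists j : nat, \sum_be (dl be)^-1 < j%:R.
  by have [j _ /(_ j (leqnn j))] := @nbhs_infty_gtr R (\sum_be (dl be)^-1); exists j.
exists j; split => // al y z als By Bz yz.
have [be bal] := mi_finite als.
have E : al = (fun i => be i : nat) by apply/funext.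
rewrite E in als *; have [d0 hd] := hdl be.
apply: ltW; apply: hd => //; apply: (lt_le_trans yz).
rewrite -[dl be]invrK lef_pV2 ?posrE ?ltr0n ?invr_gt0// -natr1.
apply: (@le_trans _ _ j%:R); last by rewrite lerDl.
rewrite (le_trans _ (ltW hj))// (bigD1 be)//= lerDl sumr_ge0// => i _.
by rewrite invr_ge0 ltW//; have [] := hdl i.
Qed.

Lemma Sbd_exhaust (p : V -> R) : Sset s W p -> exists j : nat, Sbd s W j%:R p.
Proof.
move=> Sp.
have mi0 : mi_order (fun _ : 'I_m => 0%N) = 0%N by rewrite /mi_order big1.
have [|M hM] := dalpha_bounded W0 Sp (al := fun=> 0%N); first by rewrite mi0.
have [j hj] : exists j : nat, M < j%:R.
  by have [j _ /(_ j (leqnn j))] := @nbhs_infty_gtr R M; exists j.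
exists j; split => // y By; have := hM y By; rewrite mi_order0// => /le_trans; apply.
exact: ltW.
Qed.

End class_facts.

(** * Bounds on the distance and the iterated limit *)

Section levy_prokhorov.
Context (R : realType) (m s : nat) (W : R).
Local Notation V := 'rV[R]_m.

Lemma dP_ge0 mu1 mu2 : 0 <= @dP R m s W mu1 mu2.
Proof.
rewrite /dP; set E := [set e | _]; have [->|/set0P E0] := eqVneq E set0; first by rewrite inf0.
by apply: lb_le_inf => // x [/ltW].
Qed.

Lemma dP_le mu1 mu2 e : 0 < e ->
  (forall A, SBorel s W A -> (mu1 A <= mu2 (Senl s W A e) + e%:E)%E /\
                             (mu2 A <= mu1 (Senl s W A e) + e%:E)%E) ->
  @dP R m s W mu1 mu2 <= e.
Proof.
move=> e0 h; apply: ge_inf; last by split.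
by exists 0 => x [/ltW].
Qed.

Lemma cvg_limf_esup0 (f : nat -> R -> R) : (forall k x, 0 <= f k x) ->
  (forall e, 0 < e -> \forall k \near \oo, \forall x \near +oo, f k x <= e) ->
  (fun k => limf_esup (fun x : R => (f k x)%:E) (pinfty_nbhs R)) @ \oo --> 0%E.
Proof.
move=> f0 fe.
have ge0 k : (0 <= limf_esup (fun x : R => (f k x)%:E) (pinfty_nbhs R))%E.
  apply: limf_esup_ge0; last by move=> x; rewrite lee_fin.
  exact: (@filter_not_empty _ (pinfty_nbhs R)).
have le e : 0 < e -> \forall k \near \oo,
    (limf_esup (fun x : R => (f k x)%:E) (pinfty_nbhs R) <= e%:E)%E.
  move=> e0; apply: filterS (fe e e0) => k hk.
  apply: ge_ereal_inf; eexists; first by exists [set x | f k x <= e].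
  by apply: ge_ereal_sup => _ [x /= xe <-]; rewrite lee_fin.
apply/fine_cvgP; split.
  by apply: filterS (le 1 ltr01) => k h; rewrite ge0_fin_numE// (le_lt_trans h)// ltry.
apply/cvgrPdist_le => e e0; apply: filterS (le e e0) => k h.
have fk : limf_esup (fun x : R => (f k x)%:E) (pinfty_nbhs R) \is a fin_num.
  by rewrite ge0_fin_numE// (le_lt_trans h)// ltry.
by rewrite /= sub0r normrN ger0_norm ?fine_ge0// -lee_fin fineK.
Qed.

End levy_prokhorov.

(** * Assembly of the estimates *)

Section equidistribution.
Context (R : realType) (m : nat).
Local Notation V := 'rV[R]_m.
Local Notation BV := (BorelRm R m).
Variables (r : int -> V) (a : int -> R[i]).
Hypothesis hr_sph : forall n : nat, (0 < n)%N -> usphere (r n%:Z).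
Hypothesis hr_neg : forall n : nat, (0 < n)%N -> r (- n%:Z) = - r n%:Z.
Hypothesis hr_Qind : forall (k : nat) (c : 'I_k -> rat),
      \sum_(i < k) ratr (c i) *: r (i.+1)%:Z = 0 -> forall i, c i = 0.
Hypothesis ha_unit : forall n : nat, (0 < n)%N -> `|a n%:Z| = 1.
Hypothesis ha_conj : forall n : nat, (0 < n)%N -> a (- n%:Z) = ((a n%:Z)^*)%C.
Variables (phi : nat -> nat) (mu : probability (BorelRm R m) R).
Hypothesis hphi : forall k, (phi k < phi k.+1)%N.
Hypothesis hmu_lim : forall f : V -> R, continuous f ->
      (fun k => (2 * (phi k)%:R)^-1 *
         \sum_(1 <= n < (phi k).+1) (f (r n%:Z) + f (r (- n%:Z))))
      @ \oo --> fine (\int[mu]_(l in setT) (f l)%:E)%E.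
Variables (W : R) (s : nat).
Hypothesis W0 : 0 < W.
Variables (d : measure_display) (T : measurableType d) (P : probability T R).
Variable F : T -> V -> R.
Hypothesis hF_gauss : centred_gaussian_field P F.
Hypothesis hF_cov : forall x y : V,
      ('E_P[fun w => (F w x * F w y)%R])%E = (complex.Re (covK mu (x - y)))%:E
      /\ complex.Im (covK mu (x - y)) = 0.
Hypothesis hF_Cs : forall w, Sset s W (restrB W (F w)).
Hypothesis hF_meas : forall A, SBorel s W A -> measurable [set w | A (restrB W (F w))].

Let X1 n (x : BV) : V -> R := restrB W (fun y => fN a r (phi n) (x + y)).
Let X2 w : V -> R := restrB W (F w).

Let X1E n x : X1 n x = restrB W (fun y => wsum (rpos r) (ampp a (phi n)) (ampq a (phi n)) (phi n) (x + y)).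
Proof. by congr (restrB W _); apply/funext => y; exact: fN_wsum. Qed.

Let mX1 n A : SBorel s W A -> measurable (X1 n @^-1` A).
Proof.
move=> bA; have -> : X1 n @^-1` A = [set x | A (restrB W (fun y => wsum (rpos r) (ampp a (phi n)) (ampq a (phi n)) (phi n) (x + y)))].
  by apply/seteqP; split => x /=; rewrite X1E.
exact: (measurable_translates (rpos1 hr_sph) W0 (ampp a (phi n)) (ampq a (phi n)) (phi n) bA).
Qed.

Let mX2 A : SBorel s W A -> measurable (X2 @^-1` A).
Proof. exact: hF_meas. Qed.

(** K is the same for all n; only the threshold on [Rad] may depend on n. *)
Let TT (e : R) : set (set (V -> R)) := [set K | [/\ SBorel s W K,
  (P (~` (X2 @^-1` K)) <= e%:E)%E &
  forall n, \forall Rad \near +oo, (unifB m Rad (~` (X1 n @^-1` K)) <= e%:E)%E]].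

Let TTI e1 e2 K1 K2 : TT e1 K1 -> TT e2 K2 -> TT (e1 + e2) (K1 `&` K2).
Proof.
move=> [b1 p1 u1] [b2 p2 u2]; split; first exact: SBorelI.
  rewrite preimage_setI setCI EFinD (le_trans (measureU2 _ _ _)) ?leeD//;
    by apply: measurableC; exact: mX2.
move=> n; apply: filterS2 (u1 n) (u2 n) => Rad v1 v2.
rewrite preimage_setI setCI EFinD (le_trans (measureU2 _ _ _)) ?leeD//;
  by apply: measurableC; exact: mX1.
Qed.

Let amp_le n : \sum_(i < phi n) (ampp a (phi n) i ^+ 2 + ampq a (phi n) i ^+ 2) <= 2.
Proof.
rewrite (eq_bigr (fun=> ampc R (phi n) ^+ 2)) => [|i _]; last exact: amp_sqr.
have [->|n0] := posnP (phi n); first by rewrite big_ord0.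
by rewrite sumr_const card_ord ampc_sqr// -[_ *+ phi n]mulr_natr divfK// pnatr_eq0 -lt0n.
Qed.

(** Two sources of tightness are merged: [wave_tight], uniform in n because the squared amplitudes
    sum to at most 2, and [exhaustion] for the Gaussian field. *)
Let tight (e : R) : 0 < e -> exists L : R, [/\ 0 < L, TT e (Sbd s W L) &
  forall eta, 0 < eta -> exists delta, [/\ 0 < delta, delta <= W & TT e (Smod s W eta delta)]].
Proof.
move=> e0.
have [L L0 hL] := wave_tight (rpos1 hr_sph) W0 (rpos_inj hr_Qind) s (ler0n R 2) e0.
have hx n := hL _ _ _ (amp_le n).
have mSbd (L' : R) : SBorel s W (@Sbd R m s W L') by exact: SBorel_Sbd.
have mSmod (eta delta : R) : SBorel s W (@Smod R m s W eta delta) by exact: SBorel_Smod.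
have [j hj] : exists j : nat, (P (~` (X2 @^-1` (Sbd s W j%:R))) <= e%:E)%E.
  apply: (@exhaustion _ _ _ P (fun j => X2 @^-1` (Sbd s W j%:R))) => //.
  - by move=> j; exact: mX2.
  - by move=> j l jl w; apply: Sbd_mono; rewrite ler_nat.
  - by move=> w; exact: (Sbd_exhaust W0 (hF_Cs w)).
exists (L + j%:R); split; first by rewrite ltr_wpDr.
- split => //.
    apply: le_trans hj; apply: le_measure; rewrite ?inE; try (by apply: measurableC; exact: mX2).
    by apply: subsetC => w; apply: Sbd_mono; rewrite lerDr ltW.
  move=> n; apply: filterS (hx n) => Rad [E [mE PE hE]].
  apply: le_trans PE; apply: le_measure; rewrite ?inE//; first by apply: measurableC; exact: mX1.
  move=> x /= nx; apply: contrapT => /hE[h _]; apply: nx.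
  by rewrite /X1 -/(X1 n x) X1E; apply: Sbd_mono h; rewrite lerDl.
move=> eta eta0.
have [l hl] : exists l : nat, (P (~` (X2 @^-1` (Smod s W eta l.+1%:R^-1))) <= e%:E)%E.
  apply: (@exhaustion _ _ _ P (fun l => X2 @^-1` (Smod s W eta l.+1%:R^-1))) => //.
  - by move=> l; exact: mX2.
  - move=> l l' ll w; apply: Smod_antimono; rewrite lef_pV2 ?posrE// ler_nat//.
  - by move=> w; exact: (Smod_exhaust (hF_Cs w) eta0).
have mL : 0 < m%:R * L + 1 by rewrite ltr_wpDl// mulr_ge0// ltW.
(* The three entries serve the interpolation in the ball, the modulus of F, and the Lipschitz
   modulus of the wave sums; the + 1 avoids dividing by 0. *)
pose delta : R := Num.min W (Num.min l.+1%:R^-1 (eta / (m%:R * L + 1))).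
have d0 : 0 < delta by rewrite !lt_min W0 invr_gt0 ltr0n divr_gt0.
have dW : delta <= W by rewrite ge_min lexx.
have dl : delta <= l.+1%:R^-1 by rewrite !ge_min lexx orbT.
have de : delta <= eta / (m%:R * L + 1) by rewrite !ge_min lexx !orbT.
exists delta; split => //; split => //.
  apply: le_trans hl; apply: le_measure; rewrite ?inE; try (by apply: measurableC; exact: mX2).
  by apply: subsetC => w; exact: Smod_antimono.
move=> n; apply: filterS (hx n) => Rad [E [mE PE hE]].
apply: le_trans PE; apply: le_measure; rewrite ?inE//; first by apply: measurableC; exact: mX1.
move=> x /= nx; apply: contrapT => /hE[_ h]; apply: nx; rewrite X1E; apply: h.
move: de; rewrite ler_pdivlMr// => de; apply: le_trans de.
by rewrite mulrDr mulr1 mulrC lerDl ltW.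
Qed.

Let X1_eval n x y : eball 0 W y -> X1 n x y = fN a r (phi n) (x + y).
Proof. by move=> By; rewrite /X1 /restrB asboolT//; exact: ltW. Qed.

Let X2_eval w y : eball 0 W y -> X2 w y = F w y.
Proof. by move=> By; rewrite /X2 /restrB asboolT//; exact: ltW. Qed.

Lemma dP_small e : 0 < e -> \forall n \near \oo, \forall Rad \near +oo,
  dP s W (lawFx W a r (phi n) Rad) (lawF W P F) <= e.
Proof.
move=> e0; have e10 : 0 < e / 5 by rewrite divr_gt0.
have [k [y [L [tau [K [L0 t0 By [mK PK UK] [KS KL Kclose]]]]]]] :=
  @Csnorm_close R m s W W0 TT TTI
   (fun e eta e0 eta0 => let: ex_intro _ (And3 _ _ h) := tight e0 in h eta eta0)
   (fun e e0 => let: ex_intro L (And3 h1 h2 _) := tight e0 in ex_intro2 _ _ L h1 h2)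
   e (e / 5) e0 e10.
have [I [w [close [wt w0 ws wl wc]]]] := @separating_weights R k L tau (e / 5) L0 t0 e10.
pose ev (p : V -> R) : 'I_k -> R := fun j => p (y j).
(* Each weight gets an equal share, so that the sum over I stays below e / 5. *)
have ei : 0 < e / 5 / (#|I|%:R + 1) by rewrite divr_gt0// ltr_wpDl.
have tc i := trigpoly_cvg hr_neg hr_Qind ha_unit ha_conj hphi hmu_lim hF_gauss hF_cov y (wt i) ei.
pose Q (i : I) n Rad := `|Ex (unifB m Rad) (fun x : BV => w i (fun j => fN a r (phi n) (x + y j))) -
  Ex P (fun x => w i (fun j => F x (y j)))| <= e / 5 / (#|I|%:R + 1).
(* Finiteness of I allows the quantifier over the weights to move inside, first past n and then past
   [Rad]. *)
have tc' : \forall n \near \oo, forall i, \forall Rad \near +oo, Q i n Rad.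
  exact: (@filter_forall nat I (fun i n => \forall Rad \near +oo, Q i n Rad)).
apply: filterS tc' => n hn'.
have hn : \forall Rad \near +oo, forall i, Q i n Rad.
  exact: (@filter_forall R I (fun i Rad => Q i n Rad)).
(* For positive [Rad] the probability [unifB] is [volR], from which [lawFx] is built. *)
have hR : \forall Rad \near +oo, 0 < (Rad : R) by exact: (nbhs_pinfty_gt (num_real 0)).
apply: filterS (filterI hR (filterI (UK n) hn)) => Rad [Rad0 [U1 U2]].
have E1 (i : I) (x : BV) : w i (ev (X1 n x)) = w i (fun j => fN a r (phi n) (x + y j)).
  by congr (w i _); apply/funext => j; exact: X1_eval.
have E2 (i : I) x : w i (ev (X2 x)) = w i (fun j => F x (y j)).
  by congr (w i _); apply/funext => j; exact: X2_eval.
have b1 i : bmeas (fun x : BV => w i (ev (X1 n x))).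
  rewrite (_ : (fun x : BV => _) = (fun x => w i (fun j => fN a r (phi n) (x + y j)))).
    by apply: (bmeas_linphases (wt i)) => j; exact: measurable_fN.
  by apply/funext => x; exact: E1.
have b2 i : bmeas (fun x => w i (ev (X2 x))).
  rewrite (_ : (fun x => _) = (fun x => w i (fun j => F x (y j)))).
    by apply: (bmeas_linphases (wt i)) => j; exact: hF_gauss.1.
  by apply/funext => x; exact: E2.
have diff : \sum_i `|Ex (unifB m Rad) (fun x : BV => w i (ev (X1 n x))) - Ex P (fun x => w i (ev (X2 x)))| <= e / 5.
  apply: (@le_trans _ _ (\sum_(i : I) e / 5 / (#|I|%:R + 1))).
    by apply: ler_sum => i _; rewrite (eq_Ex _ (E1 i)) (eq_Ex _ (E2 i)); exact: U2.
  rewrite sumr_const -[_ *+ _]mulr_natr mulrAC ler_pdivrMr ?ltr_wpDl//.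
  by rewrite ler_pM2l// lerDl.
have cl i p q : K p -> K q -> close i (ev p) -> close i (ev q) ->
    Csnorm s W (fun y => p y - q y) < e.
  move=> Kp Kq cp cq; apply: Kclose => //.
  by apply: (wc i (ev p) (ev q)) => // j; exact: KL.
have five : 5 * (e / 5) = e by field.
apply: dP_le => // A bA; split.
  rewrite /lawFx -unifBE// -{2}five.
  apply: (@law_le R m s W W0 _ _ _ _ (unifB m Rad) P (X1 n) X2 (@mX1 n) mX2 K I
    (fun i p => w i (ev p)) (fun i p => close i (ev p)) e (e / 5)) => //.
rewrite /lawFx -unifBE// -{2}five.
apply: (@law_le R m s W W0 _ _ _ _ P (unifB m Rad) X2 (X1 n) mX2 (@mX1 n) K I
    (fun i p => w i (ev p)) (fun i p => close i (ev p)) e (e / 5)) => //.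
by under eq_bigr do rewrite distrC.
Qed.

End equidistribution.

Theorem theorem1p5
  (R : realType) (m : nat) (hm : (2 <= m)%N)
  (* directions r_n (n >= 1), with r_{-n} = - r_n *)
  (r : int -> 'rV[R]_m)
  (hr_sph : forall n : nat, (0 < n)%N -> usphere (r n%:Z))
  (hr_neg : forall n : nat, (0 < n)%N -> r (- n%:Z) = - r n%:Z)
  (* {r_n}_{n>=1} linearly independent over Q *)
  (hr_Qind : forall (k : nat) (c : 'I_k -> rat),
      \sum_(i < k) ratr (c i) *: r (i.+1)%:Z = 0 -> forall i, c i = 0)
  (* {r_n}_{n>=1} not contained in a hyperplane *)
  (hr_span : forall v : 'rV[R]_m,
      (forall n : nat, (0 < n)%N -> dotv v (r n%:Z) = 0) -> v = 0)
  (* coefficients a_n, |a_n| = 1, a_{-n} = conj a_n *)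
  (a : int -> R[i])
  (ha_unit : forall n : nat, (0 < n)%N -> `|a n%:Z| = 1)
  (ha_conj : forall n : nat, (0 < n)%N -> a (- n%:Z) = ((a n%:Z)^*)%C)
  (* the subsequence N_k along which mu_{r,N} -> mu weak-* *)
  (phi : nat -> nat) (hphi : forall k, (phi k < phi k.+1)%N)
  (mu : probability (BorelRm R m) R)
  (hmu_sph : mu [set l | usphere l] = 1%E)
  (hmu_lim : forall f : 'rV[R]_m -> R, continuous f ->
      (fun k => (2 * (phi k)%:R)^-1 *
         \sum_(1 <= n < (phi k).+1) (f (r n%:Z) + f (r (- n%:Z))))
      @ \oo --> fine (\int[mu]_(l in setT) (f l)%:E)%E)
  (W : R) (hW : 1 < W) (s : nat)
  (* F_mu : centred stationary Gaussian field with covariance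
     E[F(x)F(y)] = int e(<x-y,lambda>) dmu(lambda), regarded (restricted to
     the closed ball B(W)) as a random element of C^s(closed ball B(W)) *)
  (d : measure_display) (T : measurableType d) (P : probability T R)
  (F : T -> 'rV[R]_m -> R)
  (hF_gauss : centred_gaussian_field P F)
  (hF_cov : forall x y : 'rV[R]_m,
      ('E_P[fun w => (F w x * F w y)%R])%E = (complex.Re (covK mu (x - y)))%:E
      /\ complex.Im (covK mu (x - y)) = 0)
  (hF_Cs : forall w, Sset s W (restrB W (F w)))
  (hF_meas : forall A, SBorel s W A -> measurable [set w | A (restrB W (F w))]) :
  (fun k => limf_esup
     (fun Rad : R => (dP s W (lawFx W a r (phi k) Rad) (lawF W P F))%:E)
     (pinfty_nbhs R))
  @ \oo --> 0%E.
Proof.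
apply: cvg_limf_esup0; first by move=> k Rad; exact: dP_ge0.
move=> e e0; apply: (dP_small hr_sph hr_neg hr_Qind ha_unit ha_conj hphi hmu_lim _
  hF_gauss hF_cov hF_Cs hF_meas e0).
exact: lt_trans ltr01 hW.
Qed.
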